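(* Let $W\ge 0$ be a random variable with $\mathbb E[W]=1$ such that, for some $c\in(0,\infty]$, $\frac1w\log\mathbb P(W\ge w)\to -c$ as $w\to\infty$. For $r\ge 2$ and $n\ge1$ let $Z_r^n$ be the total mass at height $n$ of the Mandelbrot cascade in the $r$-ary tree (defined in the context). 1. (Moderate deviations) For all $\alpha\in(0,1/2)$ and all integers $n\ge1$, the sequence $(r^\alpha(Z_r^n-1))_{r\ge2}$ satisfies a large deviation principle at speed $(r^{1-2\alpha})_{r\ge2}$ with rate function $J(a)=\dfrac{a^2}{2\operatorname{Var}(W)}$, $a\in\mathbb R$. 2. (Large deviations) For every integer $n\ge1$, the sequence $(Z_r^n)_{r\ge2}$ satisfies a large deviation principle at speed $(r)_{r\ge2}$ with rate function $I^n$, where $I^1=\Lambda_W^*$ and, for $n\ge2$ and all $a\in\mathbb R$, $$I^n(a)=\inf\{cw+I^{n-1}(z)+\Lambda_W^*(s)\;:\; w\ge0,\ z\ge0,\ s\ge0,\ wz+s=a\}.$$ 3. (Very large deviations) For all $\alpha>0$ and all integers $n\ge1$, the sequence $(r^{-\alpha}Z_r^n)_{r\ge2}$ satisfies a large deviation principle at speed $(r^{1+\alpha/n})_{r\ge2}$ with rate function $a\mapsto \infty\,\mathbf 1_{a<0}+c\,n\,a^{1/n}\,\mathbf 1_{a\ge0}$.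
   Context: For each integer $r\ge2$, let $(W_{i_1,\dots,i_n})_{n\ge1,\,1\le i_1,\dots,i_n\le r}$ be i.i.d. copies of $W$ indexed by all nonempty finite words over $\{1,\dots,r\}$, and $$Z_r^n=\frac1{r^n}\sum_{1\le i_1,\dots,i_n\le r}W_{i_1}W_{i_1,i_2}\cdots W_{i_1,\dots,i_n}.$$ $\Lambda_W(t)=\log\mathbb E[e^{tW}]\in(-\infty,\infty]$ for $t\in\mathbb R$, and $\Lambda_W^*(x)=\sup_{t\in\mathbb R}[tx-\Lambda_W(t)]\in[0,\infty]$. Conventions: $\inf\emptyset=\infty$, $\infty\cdot0=0$ (relevant in $cw$ and $c\,n\,a^{1/n}$ when $c=\infty$, and in $\infty\mathbf 1_{a<0}$). If $\operatorname{Var}(W)=0$, $J(a)$ is read as $0$ if $a=0$ and $\infty$ otherwise. A sequence $(Y_r)_{r\ge2}$ of real random variables satisfies a large deviation principle at speed $(v_r)$ (with $v_r\to\infty$) with rate function $I:\mathbb R\to[0,\infty]$ (lower semicontinuous) if $\limsup_{r\to\infty}\frac1{v_r}\log\mathbb P(Y_r\in F)\le-\inf_F I$ for every closed $F\subset\mathbb R$ and $\liminf_{r\to\infty}\frac1{v_r}\log\mathbb P(Y_r\in G)\ge-\inf_G I$ for every open $G\subset\mathbb R$. *)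

(* Defs.v *)
From mathcomp Require Export all_boot all_order all_algebra.
From mathcomp Require Export all_classical all_reals all_analysis.

Set Implicit Arguments.
Unset Strict Implicit.
Unset Printing Implicit Defensive.

Import Order.TTheory GRing.Theory Num.Theory.
Import numFieldNormedType.Exports.

Local Open Scope classical_set_scope.
Local Open Scope ring_scope.
Local Open Scope ereal_scope.

(* Mutual independence of the subfamily of X indexed by D, expressed by the
   product rule over all finite subfamilies. *)
Definition mutually_independent d (T : measurableType d) (R : realType)
    (P : probability T R) (J : eqType) (D : set J) (X : J -> {RV P >-> R}) :=
  forall (s : seq J) (A : J -> set R), uniq s ->
    (forall j, j \in s -> D j) -> (forall j, measurable (A j)) ->
    P (\bigcap_(j in [set` s]) (X j @^-1` A j)) =
    \prod_(j <- s) P (X j @^-1` A j).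

Definition identically_distributed d (T : measurableType d) (R : realType)
    (P : probability T R) (X Y : {RV P >-> R}) :=
  forall A : set R, measurable A -> distribution P X A = distribution P Y A.

(* Words over an alphabet with r letters are sequences over 'I_r; the value of
   the family at the empty word is unconstrained and never used. *)
Definition iid_copies d (T : measurableType d) (R : realType)
    (P : probability T R) (W : {RV P >-> R}) (r : nat)
    (V : seq 'I_r -> {RV P >-> R}) :=
  mutually_independent [set w | w != [::]] V /\
  forall w, w != [::] -> identically_distributed (V w) W.

(* The factors are indexed by the nonempty prefixes of the word t. *)
Definition cascade_mass d (T : measurableType d) (R : realType)
    (P : probability T R) (r : nat) (V : seq 'I_r -> {RV P >-> R})
    (n : nat) (x : T) : R :=
  ((r%:R ^+ n)^-1 *
    \sum_(t : n.-tuple 'I_r) \prod_(k < n) V (take k.+1 t) x)%R.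

Definition log_laplace d (T : measurableType d) (R : realType)
    (P : probability T R) (X : T -> R) (t : R) : \bar R :=
  lne ('M_P X t).

Definition legendre (R : realType) (L : R -> \bar R) (x : R) : \bar R :=
  ereal_sup [set (t * x)%:E - L t | t in [set: R]].

(* Sequences are indexed by r >= 2, so the values at r = 0, 1 play no role.
   lne 0 = -oo and ereal_inf set0 = +oo. *)
Definition large_deviation_principle d (T : measurableType d) (R : realType)
    (P : probability T R) (Y : nat -> T -> R) (v : nat -> R)
    (I : R -> \bar R) :=
  [/\ forall r, (2 <= r)%N -> measurable_fun [set: T] (Y r),
      v r @[r --> \oo] --> +oo%R,
      (forall a, 0 <= I a) /\ lower_semicontinuous I,
      forall F : set R, closed F ->
        limn_esup (fun r => ((v r)^-1)%:E * lne (P (Y r @^-1` F))) <=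
        - ereal_inf (I @` F) &
      forall G : set R, open G ->
        - ereal_inf (I @` G) <=
        limn_einf (fun r => ((v r)^-1)%:E * lne (P (Y r @^-1` G)))].

Definition moderate_rate d (T : measurableType d) (R : realType)
    (P : probability T R) (W : T -> R) (a : R) : \bar R :=
  if 'V_P[W] == 0 then (if a == 0%R then 0 else +oo)
  else (a ^+ 2 / (2 * fine 'V_P[W]))%R%:E.

(* I^n for n >= 1, where I^1 = L; the value at n = 0 is immaterial. The product
   c * w is 0 when c = +oo and w = 0. *)
Fixpoint large_rate (R : realType) (c : \bar R) (L : R -> \bar R) (n : nat)
    : R -> \bar R :=
  match n with
  | 0 => fun=> +oo
  | 1 => L
  | m.+1 => fun a =>
      ereal_inf [set y | exists w z s : R,
        [/\ (0 <= w)%R, (0 <= z)%R, (0 <= s)%R, (w * z + s = a)%R &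
            y = c * w%:E + large_rate c L m z + L s]]
  end.

Definition very_large_rate (R : realType) (c : \bar R) (n : nat) (a : R)
    : \bar R :=
  if (a < 0)%R then +oo else c * (n%:R * a `^ (n%:R^-1))%R%:E.

(* Main.v *)
(* Write Z^(n+1) = r^-1 sum_(i < r) W_i Z_i, where the Z_i are i.i.d. copies of
   Z^n, independent of the W_i.

   Upper tails, by induction on n: split according to the cell of a geometric grid
   that contains max_i Z_i. When the maximum is close to z, a Chernoff bound with a
   parameter t such that t z < c is multiplied by the probability that Z^n is close
   to z. For the large deviations, optimizing over t is dual to the infimum that
   defines I^(n+1); for the very large ones, Bernoulli's inequality replaces this
   duality; for the moderate ones, no Z_i exceeds 2 at the relevant speed and a
   second order expansion of the moment generating function is enough.

   Local lower bounds: one W_i is close to r w while its Z_i is close to z, the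
   other Z_i stay close to 1, and the other W_i have empirical mean close to s. Values
   of s that no exponential tilt of W can reach are traded against a larger w.

   The rates are monotone on both sides of their zero, so that tail estimates and
   local lower bounds give the large deviation principles. *)
Require Import Defs.
From mathcomp Require Import measurable_realfun ring lra zify.

Import Order.TTheory GRing.Theory Num.Theory.
Import numFieldNormedType.Exports.

Local Open Scope classical_set_scope.
Local Open Scope ring_scope.
Local Open Scope ereal_scope.

Set Implicit Arguments.
Unset Strict Implicit.
Unset Printing Implicit Defensive.

(** * Independence of the sigma-algebras generated by disjoint subfamilies *)

Section generated_independence.
Context (R : realType) d (T : measurableType d) (P : probability T R).
Context (J : choiceType) (X : J -> T -> R).
Hypothesis mX : forall j, measurable_fun [set: T] (X j).

(** Chernoff's bound does not apply to the sum directly: when [c] is finite, [exp (t W_i Z_i)] has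
    infinite conditional mean given [Z_i] once [t Z_i > c], which no fixed [t > 0] excludes. Cutting
    at the maximum restores finite moments. At speed [r], a typical truncated offspring still
    contributes about [E exp (t W)], because [Z_i] concentrates at 1 by Chebyshev's inequality; only
    the offspring that reaches the maximum feels the truncation level. Its choice costs a factor
    [r], negligible at all three speeds. Each [Z_i] is built on the words below the letter [i],
    hence on another family than the initial one; so the estimates are stated for every i.i.d.
    family over [r] letters, with a threshold on [r] that does not depend on the family. A closed
    set that avoids the zero of a rate is governed, by monotonicity, by its two points nearest to
    that zero, so neither compactness nor exponential tightness enters. Nonnegativity almost surely
    becomes nonnegativity everywhere by passing to positive parts, which changes the masses only on
    a null set. *)

Definition cylinders (D : set J) : set (set T) :=
  [set B | exists (s : seq J) (A : J -> set R),
     [/\ uniq s, (forall j, j \in s -> D j), (forall j, measurable (A j)) &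
         B = \bigcap_(j in [set` s]) (X j @^-1` A j)]].

Lemma cylinders_setI D : setI_closed (cylinders D).
Proof.
move=> _ _ [s1 [A1 [u1 D1 m1 ->]]] [s2 [A2 [u2 D2 m2 ->]]].
(* The default [setT] imposes nothing on an index that one of the two lists omits. *)
exists (undup (s1 ++ s2)), (fun j => (if j \in s1 then A1 j else setT) `&`
  (if j \in s2 then A2 j else setT)); split.
- exact: undup_uniq.
- by move=> j; rewrite mem_undup mem_cat => /orP[/D1|/D2].
- by move=> j; apply: measurableI; case: ifP => // _.
- apply/seteqP; split => x /=.
    move=> [h1 h2] j /=; rewrite mem_undup mem_cat => _.
    by split; case: ifP => // js; [exact: h1|exact: h2].
  move=> h; split => j /= js.
    by have := h j; rewrite /= mem_undup mem_cat js => /(_ isT) [].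
  by have := h j; rewrite /= mem_undup mem_cat js orbT => /(_ isT) [].
Qed.

Lemma measurable_cylinder D : cylinders D `<=` measurable.
Proof.
move=> _ [s [A [_ _ mA ->]]]; apply: fin_bigcap_measurable.
  exact: finite_seq.
by move=> j _; rewrite -[X in measurable X]setTI; exact: mX.
Qed.

Lemma cylinders_setT D : cylinders D setT.
Proof.
exists [::], (fun=> setT); split => //.
by apply/seteqP; split => // x _ j.
Qed.

Lemma cylinders_preimage D j A : D j -> measurable A -> cylinders D (X j @^-1` A).
Proof.
move=> Dj mA; exists [:: j], (fun=> A); split => //.
  by move=> k; rewrite inE => /eqP ->.
by apply/seteqP; split => x /=; [move=> h k /=; rewrite inE => /eqP ->|
  apply; rewrite /= inE].
Qed.

(** Measurability for the sigma-algebra generated by the [X j] with [j] in [D]. Going through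
    [g_sigma_algebraType] makes the closure lemmas for measurable functions apply unchanged. *)
Definition gen_measurable (D : set J) (Y : T -> R) : Prop :=
  measurable_fun (setT : set (g_sigma_algebraType (cylinders D))) Y.

Lemma cylinders_subset D1 D2 : D1 `<=` D2 -> cylinders D1 `<=` cylinders D2.
Proof. by move=> D12 _ [s [A [us sD mA ->]]]; exists s, A; split => // j /sD/D12. Qed.

Lemma gen_measurableW D1 D2 Y : D1 `<=` D2 ->
  gen_measurable D1 Y -> gen_measurable D2 Y.
Proof.
move=> D12 mY _ A mA; have := mY measurableT A mA.
apply: sub_sigma_algebra2; exact: cylinders_subset.
Qed.

Lemma gen_measurable_coord D j : D j -> gen_measurable D (X j).
Proof.
move=> Dj _ A mA; rewrite setTI; apply: sub_sigma_algebra.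
exact: cylinders_preimage.
Qed.

Lemma sigma_cylinders_measurable D : <<s cylinders D >> `<=` measurable.
Proof.
apply: smallest_sub; first exact: sigma_algebra_measurable.
exact: measurable_cylinder.
Qed.

Lemma gen_measurable_measurable D Y : gen_measurable D Y -> measurable_fun setT Y.
Proof.
move=> mY _ A mA; have := mY measurableT A mA.
exact: sigma_cylinders_measurable.
Qed.

Context (D0 : set J).
Hypothesis indX : forall (s : seq J) (A : J -> set R), uniq s ->
    (forall j, j \in s -> D0 j) -> (forall j, measurable (A j)) ->
    P (\bigcap_(j in [set` s]) (X j @^-1` A j)) =
    \prod_(j <- s) P (X j @^-1` A j).

Context (D1 D2 : set J).
Hypotheses (D10 : D1 `<=` D0) (D20 : D2 `<=` D0).
Hypothesis D12 : D1 `&` D2 = set0.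

Lemma independent_cylinders A B : cylinders D1 A -> cylinders D2 B ->
  P (A `&` B) = P A * P B.
Proof.
move=> [s1 [A1 [u1 sD1 m1 ->]]] [s2 [A2 [u2 sD2 m2 ->]]].
have s21 j : j \in s2 -> j \in s1 = false.
  move=> js2; apply/negP => /sD1 j1.
  have : (D1 `&` D2) j by split => //; exact: sD2.
  by rewrite D12.
have E : \bigcap_(j in [set` s1]) (X j @^-1` A1 j) `&`
   \bigcap_(j in [set` s2]) (X j @^-1` A2 j) =
   \bigcap_(j in [set` s1 ++ s2]) (X j @^-1` (if j \in s1 then A1 j else A2 j)).
  apply/seteqP; split => x /=.
    move=> [h1 h2] j /=; rewrite mem_cat => /orP[js|js].
      by rewrite js; exact: h1.
    by rewrite (s21 _ js); exact: h2.
  move=> h; split => j /= js; have := h j; rewrite /= mem_cat js ?orbT => /(_ isT) //.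
  by rewrite (s21 _ js).
rewrite E indX.
- rewrite big_cat/= !indX//; first last.
    by move=> j /sD1 /D10.
    by move=> j /sD2 /D20.
  congr (_ * _); rewrite !big_seq; apply: eq_bigr => j js.
    by rewrite js.
  by rewrite s21.
- rewrite cat_uniq u1 u2 andbT /=; apply/hasPn => j js2 /=.
  by rewrite s21.
- by move=> j; rewrite mem_cat => /orP[/sD1/D10|/sD2/D20].
- by move=> j; case: ifP.
Qed.

(** The restriction of [P] to [B] and [P B] times [P] are finite measures that agree on a pi-system
    containing the whole space. Applied twice below, once for each of the two subfamilies. *)
Lemma indep_extend (C : set (set T)) (B : set T) : setI_closed C -> C setT ->
  C `<=` measurable -> measurable B ->
  (forall A, C A -> P (A `&` B) = P A * P B) ->
  forall A, <<s C >> A -> P (A `&` B) = P A * P B.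
Proof.
move=> CI CT mC mB H A sA.
pose q : {nonneg R} := NngNum (fine_ge0 (measure_ge0 P B)).
have qE : (q%:num)%:E = P B by rewrite /= fineK// fin_num_measure.
have : mrestr P mB A = mscale q P A.
  apply: (@g_sigma_algebra_measure_unique _ _ _ C mC (fun=> setT)) => //.
  - by apply/seteqP; split => // x _; exists 0%N.
  - by move=> A' CA'; rewrite /= /mrestr H// /mscale/= muleC fineK// fin_num_measure.
  - move=> _; rewrite /= /mrestr setTI; apply: le_lt_trans (ltry 1).
    exact: probability_le1.
by rewrite /mrestr /mscale /= => ->; rewrite muleC fineK// fin_num_measure.
Qed.

Lemma sigma_independence A B : <<s cylinders D1 >> A -> <<s cylinders D2 >> B ->
  P (A `&` B) = P A * P B.
Proof.
move=> sA sB.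
have mA := sigma_cylinders_measurable sA.
have mB := sigma_cylinders_measurable sB.
apply: (@indep_extend (cylinders D1)) => //.
- exact: cylinders_setI.
- exact: cylinders_setT.
- exact: measurable_cylinder.
move=> A' CA'; rewrite setIC muleC; have mA' := measurable_cylinder CA'.
apply: (@indep_extend (cylinders D2)) => //.
- exact: cylinders_setI.
- exact: cylinders_setT.
- exact: measurable_cylinder.
by move=> B' CB'; rewrite setIC muleC; exact: independent_cylinders.
Qed.

Lemma expectation_independent (Y1 Y2 : T -> R) :
  gen_measurable D1 Y1 -> gen_measurable D2 Y2 ->
  (forall x, 0 <= Y1 x)%R -> (forall x, 0 <= Y2 x)%R ->
  \int[P]_x (Y1 x * Y2 x)%:E = \int[P]_x (Y1 x)%:E * \int[P]_x (Y2 x)%:E.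
Proof.
move=> gY1 gY2 Y10 Y20.
have mY1 := gen_measurable_measurable gY1.
have mY2 := gen_measurable_measurable gY2.
pose Z1 : {mfun T >-> R} := mfun_Sub (mem_set mY1).
pose Z2 : {mfun T >-> R} := mfun_Sub (mem_set mY2).
have mZ : measurable_fun setT (fun x => (Y1 x, Y2 x)).
  exact/measurable_fun_pairP.
pose Z : {mfun T >-> (R * R)%type} := mfun_Sub (mem_set mZ).
(* The absolute values make the integrands nonnegative everywhere, as the transfer to image measures
   requires; they change nothing on the values of [Y1] and [Y2]. *)
pose f (u : R * R) : \bar R := (`|u.1| * `|u.2|)%:E.
pose g (u : R) : \bar R := (`|u|)%:E.
have mf : measurable_fun setT f.
  apply/measurable_EFinP; apply: measurable_funM; apply: measurableT_comp => //.
have mg : measurable_fun setT g.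
  by apply/measurable_EFinP; exact: normr_measurable.
have E12 : \int[P]_x (Y1 x * Y2 x)%:E =
    \int[distribution P Z]_u f u.
  rewrite ge0_integral_distribution//; last by move=> u; rewrite lee_fin.
  by apply: eq_integral => x _; rewrite /f /g /= !ger0_norm.
have E1 : \int[P]_x (Y1 x)%:E = \int[distribution P Z1]_u g u.
  rewrite ge0_integral_distribution//; last by move=> u; rewrite lee_fin.
  by apply: eq_integral => x _; rewrite /f /g /= !ger0_norm.
have E2 : \int[P]_x (Y2 x)%:E = \int[distribution P Z2]_u g u.
  rewrite ge0_integral_distribution//; last by move=> u; rewrite lee_fin.
  by apply: eq_integral => x _; rewrite /f /g /= !ger0_norm.
have Eq : \int[distribution P Z]_u f u =
   \int[distribution P Z1 \x distribution P Z2]_u f u.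
  (* The law of the pair agrees with the product of the laws on rectangles, hence everywhere;
     Tonelli's theorem then separates the integrals. *)
  apply: eq_measure_integral => A mA _; apply/esym.
  apply: product_measure_unique => // A1 A2 mA1 mA2.
  change (P (Y1 @^-1` A1 `&` Y2 @^-1` A2) = P (Y1 @^-1` A1) * P (Y2 @^-1` A2)).
  apply: sigma_independence.
    by have := gY1 measurableT A1 mA1; rewrite setTI.
  by have := gY2 measurableT A2 mA2; rewrite setTI.
rewrite E12 E1 E2 Eq fubini_tonelli1//; last first.
  by move=> u; rewrite lee_fin mulr_ge0.
rewrite /fubini_F /f /=.
under eq_integral do (under eq_integral do rewrite EFinM; rewrite ge0_integralZl//).
by rewrite ge0_integralZr// integral_ge0.
Qed.

End generated_independence.

(** * Branching structure of the cascade and independence of its parts *)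

Section cascade.
Context (R : realType) d (T : measurableType d) (P : probability T R).

(** [cascade_mass] for plain functions, because positive parts of the random variables will be
    substituted for the factors. *)
Definition mass (r : nat) (V : seq 'I_r -> T -> R) (n : nat) (x : T) : R :=
  ((r%:R ^+ n)^-1 *
    \sum_(t : n.-tuple 'I_r) \prod_(k < n) V (take k.+1 t) x)%R.

Definition shift (r : nat) (V : seq 'I_r -> T -> R) (i : 'I_r) (w : seq 'I_r) :=
  V (i :: w).

(** [iid_copies] for plain functions, with nonnegativity at every point so that no null set has to
    be carried through the estimates. *)
Definition iid_family (W : T -> R) (r : nat) (V : seq 'I_r -> T -> R) :=
  [/\ forall w, measurable_fun setT (V w),
      forall w x, (0 <= V w x)%R,
      forall (s : seq (seq 'I_r)) (A : seq 'I_r -> set R), uniq s ->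
        (forall j, j \in s -> j != [::]) -> (forall j, measurable (A j)) ->
        P (\bigcap_(j in [set` s]) (V j @^-1` A j)) =
        \prod_(j <- s) P (V j @^-1` A j) &
      forall w, w != [::] -> forall A, measurable A ->
        P (V w @^-1` A) = P (W @^-1` A)].

Lemma mass0 r (V : seq 'I_r -> T -> R) x : mass V 0 x = 1%R.
Proof.
rewrite /mass expr0 invr1 mul1r (big_pred1 [tuple]) ?big_ord0//.
by move=> t; apply/esym/eqP; exact: (tuple0 t).
Qed.

Lemma massS r (V : seq 'I_r -> T -> R) n x : mass V n.+1 x =
  (r%:R^-1 * \sum_(i < r) V [:: i] x * mass (shift V i) n x)%R.
Proof.
rewrite /mass exprS invfM -mulrA; congr (_ * _)%R.
under [RHS]eq_bigr do rewrite mulrCA.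
rewrite -mulr_sumr; congr (_ * _)%R.
under [RHS]eq_bigr do rewrite mulr_sumr.
rewrite pair_big/=.
rewrite (reindex (fun p : 'I_r * n.-tuple 'I_r => [tuple of p.1 :: p.2]))/=.
  by apply: eq_bigr => -[i t] _ /=; rewrite big_ord_recl take0.
exists (fun t : n.+1.-tuple 'I_r => (thead t, [tuple of behead t])).
  by move=> [i t] _ /=; congr pair; apply: val_inj.
by move=> t _; rewrite [RHS]tuple_eta.
Qed.

Lemma iid_shift W r (V : seq 'I_r -> T -> R) i : iid_family W V ->
  iid_family W (shift V i).
Proof.
move=> [mV V0 iV dV]; split.
- by move=> w; exact: mV.
- by move=> w x; exact: V0.
- move=> s A us s0 mA.
  (* A constraint on [w] in the shifted family is a constraint on [i :: w] in [V], so independence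
     of the shift is an instance of independence of [V]. *)
  pose B w := A (behead w).
  have := iV [seq i :: w | w <- s] B; rewrite big_map => <-//.
  + congr (P _); apply/seteqP; split => x /= h j /=.
      by move=> /mapP[w ws ->]; exact: h.
    by move=> js; apply: (h (i :: j)) => /=; rewrite map_f.
  + by rewrite map_inj_uniq// => u v [].
  + by move=> j /mapP[w _ ->].
  + by move=> j; exact: mA.
- by move=> w _; exact: dV.
Qed.

Lemma mass_ge0 W r (V : seq 'I_r -> T -> R) n x : iid_family W V ->
  (0 <= mass V n x)%R.
Proof.
move=> [_ V0 _ _]; rewrite /mass mulr_ge0 ?invr_ge0 ?exprn_ge0//.
by apply: sumr_ge0 => t _; apply: prodr_ge0 => k _; exact: V0.
Qed.

Lemma gen_measurable_mass r (V : seq 'I_r -> T -> R) (mV : forall w, measurable_fun setT (V w))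
    (D : set (seq 'I_r)) u n :
  (forall w, w != [::] -> D (u ++ w)) ->
  gen_measurable V D (mass (fun w => V (u ++ w)) n).
Proof.
move=> Du; rewrite /gen_measurable.
apply: measurable_funM => //; apply: measurable_sum => t.
apply: measurable_prod => k _; apply: gen_measurable_coord; apply: Du.
by rewrite -size_eq0 size_take size_tuple; case: ltnP => //; case: (n) k => // -[].
Qed.

Lemma measurable_mass W r (V : seq 'I_r -> T -> R) n : iid_family W V ->
  measurable_fun setT (mass V n).
Proof.
move=> [mV _ _ _].
exact: (gen_measurable_measurable mV (@gen_measurable_mass _ V mV setT [::] n (fun _ _ => I))).
Qed.


(** These index sets carry, respectively, the weight [W_i], the mass [Z_i] below it, and all the
    variables whose first letter is in [Q]. Their disjointness is the source of every independence
    statement below. *)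
Definition root_word r (i : 'I_r) : set (seq 'I_r) := [set [:: i]].
Definition sub_words r (i : 'I_r) : set (seq 'I_r) :=
  [set w | exists u, u != [::] /\ w = i :: u].
Definition first_letter r (Q : set 'I_r) : set (seq 'I_r) :=
  [set w | exists i u, Q i /\ w = i :: u].

Context (W : T -> R) (r : nat) (V : seq 'I_r -> T -> R).
Hypothesis iidV : iid_family W V.

Let mV w : measurable_fun setT (V w). Proof. by case: iidV. Qed.

Lemma gen_measurable_sub n i : gen_measurable V (sub_words i) (mass (shift V i) n).
Proof.
apply: (@gen_measurable_mass _ V mV _ [:: i]) => w w0.
by exists w.
Qed.

Lemma gen_measurable_root i : gen_measurable V (root_word i) (V [:: i]).
Proof. exact: gen_measurable_coord. Qed.

Lemma sub_first (Q : set 'I_r) i : Q i -> sub_words i `<=` first_letter Q.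
Proof. by move=> Qi w [u [_ ->]]; exists i, u. Qed.

Lemma iid_independence (D1 D2 : set (seq 'I_r)) A B : D1 `&` D2 = set0 ->
  ~ D1 [::] -> ~ D2 [::] ->
  <<s cylinders V D1 >> A -> <<s cylinders V D2 >> B -> P (A `&` B) = P A * P B.
Proof.
move=> D12 D1n D2n; case: iidV => _ _ ind _.
apply: (@sigma_independence _ _ _ _ _ _ mV [set w | w != [::]]) => //.
- by move=> w Dw /=; apply/eqP => w0; apply: D1n; rewrite -w0.
- by move=> w Dw /=; apply/eqP => w0; apply: D2n; rewrite -w0.
Qed.

Lemma iid_expectation (D1 D2 : set (seq 'I_r)) Y1 Y2 : D1 `&` D2 = set0 ->
  ~ D1 [::] -> ~ D2 [::] ->
  gen_measurable V D1 Y1 -> gen_measurable V D2 Y2 ->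
  (forall x, 0 <= Y1 x)%R -> (forall x, 0 <= Y2 x)%R ->
  \int[P]_x (Y1 x * Y2 x)%:E = \int[P]_x (Y1 x)%:E * \int[P]_x (Y2 x)%:E.
Proof.
move=> D12 D1n D2n; case: iidV => _ _ ind _.
apply: (@expectation_independent _ _ _ _ _ _ mV [set w | w != [::]]) => //.
- by move=> w Dw /=; apply/eqP => w0; apply: D1n; rewrite -w0.
- by move=> w Dw /=; apply/eqP => w0; apply: D2n; rewrite -w0.
Qed.

Lemma gen_measurable_comp D (Y : T -> R) (f : R -> R) : measurable_fun setT f ->
  gen_measurable V D Y -> gen_measurable V D (fun x => f (Y x)).
Proof. by move=> mf mY; exact: measurableT_comp. Qed.

Lemma gen_measurable_comp2 D (Y1 Y2 : T -> R) (f : R * R -> R) : measurable_fun setT f ->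
  gen_measurable V D Y1 -> gen_measurable V D Y2 ->
  gen_measurable V D (fun x => f (Y1 x, Y2 x)).
Proof.
move=> mf mY1 mY2; apply: (measurableT_comp mf).
exact/measurable_fun_pairP.
Qed.

Lemma expectation_root_sub i n (f g : R -> R) :
  measurable_fun setT f -> measurable_fun setT g ->
  (forall x, 0 <= f x)%R -> (forall x, 0 <= g x)%R ->
  \int[P]_x (f (V [:: i] x) * g (mass (shift V i) n x))%:E =
  \int[P]_x (f (V [:: i] x))%:E * \int[P]_x (g (mass (shift V i) n x))%:E.
Proof.
move=> mf mg f0 g0.
apply: (@iid_expectation (root_word i) (sub_words i)) => //.
- rewrite -subset0 => w [] -> [u [u0]] [uE]; by rewrite -uE eqxx in u0.
- by move=> [u []].
- by apply: gen_measurable_comp => //; exact: gen_measurable_root.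
- by apply: gen_measurable_comp => //; exact: gen_measurable_sub.
Qed.

Lemma expectation_root (i : 'I_r) (f : R -> R) : measurable_fun setT W ->
  measurable_fun setT f -> (forall x, 0 <= f x)%R ->
  \int[P]_x (f (V [:: i] x))%:E = \int[P]_x (f (W x))%:E.
Proof.
move=> mW mf f0; case: iidV => _ _ _ lawV.
pose Z1 : {mfun T >-> R} := mfun_Sub (mem_set (mV [:: i])).
pose Z2 : {mfun T >-> R} := mfun_Sub (mem_set mW).
pose g (u : R) : \bar R := (f u)%:E.
have mg : measurable_fun setT g by exact/measurable_EFinP.
transitivity (\int[distribution P Z1]_u g u).
  by rewrite ge0_integral_distribution// => u; rewrite lee_fin.
transitivity (\int[distribution P Z2]_u g u); last first.
  by rewrite ge0_integral_distribution// => u; rewrite lee_fin.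
by apply: eq_measure_integral => A mA _; exact: (lawV [:: i]).
Qed.

Lemma expectation_prod n (s : seq 'I_r) (f : 'I_r -> R * R -> R) : uniq s ->
  (forall i, measurable_fun setT (f i)) -> (forall i u, 0 <= f i u)%R ->
  \int[P]_x (\prod_(i <- s) f i (V [:: i] x, mass (shift V i) n x))%:E =
  \prod_(i <- s) \int[P]_x (f i (V [:: i] x, mass (shift V i) n x))%:E.
Proof.
move=> us mf f0; elim: s us => [_|i s ih /= /andP[nis us]].
  by under eq_integral do rewrite big_nil; rewrite big_nil integral_cst// mul1e; exact: probability_setT.
rewrite big_cons -ih//.
under eq_integral do rewrite big_cons.
pose Y j x := f j (V [:: j] x, mass (shift V j) n x).
have gY (Q : set 'I_r) j : Q j -> gen_measurable V (first_letter Q) (Y j).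
  move=> Qj; apply: gen_measurable_comp2 => //.
    by apply: gen_measurable_coord; exists j, [::].
  by apply: gen_measurableW (@gen_measurable_sub n j); exact: sub_first.
apply: (@iid_expectation (first_letter [set i]) (first_letter [set` s]) (Y i)
   (fun x => \prod_(j <- s) Y j x)%R) => //.
- rewrite -subset0 => w [] [_ [u [-> ->]]] [j [v [/= js [ij _]]]].
  by rewrite ij js in nis.
- by move=> [? [? []]].
- by move=> [? [? []]].
- exact: gY.
(* The sigma-algebra of the letters of [s] stays fixed while the product is built over a sublist
   [s']. *)
- suff gYs s' : {subset s' <= s} -> gen_measurable V (first_letter [set` s])
      (fun x => \prod_(j <- s') Y j x)%R by exact: gYs.
  elim: s' => [_|j s' ih' sub].
    rewrite (_ : (fun x => _) = cst 1%R); first exact: measurable_cst.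
    by apply/funext => x; rewrite big_nil.
  rewrite (_ : (fun x => _) = (fun x => Y j x * \prod_(j <- s') Y j x)%R).
    apply: measurable_funM; first by apply: gY; rewrite /= sub ?mem_head.
    by apply: ih' => k ks; rewrite sub// inE ks orbT.
  by apply/funext => x; rewrite big_cons.
- by move=> x; exact: f0.
- by move=> x; apply: prodr_ge0 => j _; exact: f0.
Qed.

Lemma sigma_preimage D (Y : T -> R) A : gen_measurable V D Y -> measurable A ->
  <<s cylinders V D >> (Y @^-1` A).
Proof. by move=> gY mA; have := gY measurableT A mA; rewrite setTI. Qed.

Lemma sigma_setI D A B : <<s cylinders V D >> A -> <<s cylinders V D >> B ->
  <<s cylinders V D >> (A `&` B).
Proof. exact: (@measurableI _ (g_sigma_algebraType (cylinders V D))). Qed.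

Lemma sigmaW D1 D2 A : D1 `<=` D2 -> <<s cylinders V D1 >> A ->
  <<s cylinders V D2 >> A.
Proof. by move=> D12; apply: sub_sigma_algebra2; exact: cylinders_subset. Qed.

(** Factorization of the one big jump scenario: [A] constrains the weight that jumps, [B] the mass
    below it, and [E] all the other offsprings. The large and very large lower bounds rest on it. *)
Lemma one_jump i n A B E : measurable A -> measurable B ->
  <<s cylinders V (first_letter [set j | j != i]) >> E ->
  P (V [:: i] @^-1` A `&` (mass (shift V i) n @^-1` B `&` E)) =
  P (W @^-1` A) * (P (mass (shift V i) n @^-1` B) * P E).
Proof.
move=> mA mB sE; case: (iidV) => _ _ _ lawV; rewrite -(lawV [:: i])//.
have sB := sigma_preimage (@gen_measurable_sub n i) mB.
have sA := sigma_preimage (@gen_measurable_root i) mA.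
pose D2 := sub_words i `|` first_letter [set j | j != i].
rewrite (@iid_independence (root_word i) D2) //.
- congr (_ * _); apply: (@iid_independence (sub_words i) (first_letter [set j | j != i])) => //.
  + rewrite -subset0 => w [] [u [_ ->]] [j [v [/= /eqP ji [ij _]]]].
    by apply: ji.
  + by move=> [? []].
  + by move=> [? [? []]].
- rewrite -subset0 => w [] -> [[u [u0 [uE]]]|[j [v [/= /eqP ji [ij _]]]]].
    by rewrite -uE eqxx in u0.
  by apply: ji.
- by move=> [[? []]|[? [? []]]].
- apply: sigma_setI; first by apply: sigmaW sB => w; left.
  by apply: sigmaW sE => w; right.
Qed.

(** The two conclusions are proved together: the induction step for the probability uses the
    measurability of the event on the remaining letters. *)
Lemma sub_words_prod n (s : seq 'I_r) G : uniq s -> measurable G ->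
  P [set x | forall j, j \in s -> G (mass (shift V j) n x)] =
    \prod_(j <- s) P (mass (shift V j) n @^-1` G) /\
  <<s cylinders V [set w | exists j u, [/\ j \in s, u != [::] & w = j :: u]] >>
    [set x | forall j, j \in s -> G (mass (shift V j) n x)].
Proof.
move=> us mG; elim: s us => [_|i s ih /= /andP[nis us]].
  rewrite big_nil (_ : [set x | _] = setT); last by apply/seteqP; split.
  split; first exact: probability_setT.
  exact: (@measurableT _ (g_sigma_algebraType (cylinders V _))).
have [ih1 ih2] := ih us.
have -> : [set x | forall j, j \in i :: s -> G (mass (shift V j) n x)] =
   mass (shift V i) n @^-1` G `&` [set x | forall j, j \in s -> G (mass (shift V j) n x)].
  apply/seteqP; split => x /=.
    by move=> h; split => [|j js]; apply: h; rewrite inE ?eqxx// js orbT.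
  by move=> [h1 h2] j; rewrite inE => /orP[/eqP ->//|]; exact: h2.
have sG := sigma_preimage (@gen_measurable_sub n i) mG.
split; last first.
  apply: sigma_setI.
    by apply: sigmaW sG => w [u [u0 ->]]; exists i, u; rewrite mem_head.
  by apply: sigmaW ih2 => w [j [u [js u0 ->]]]; exists j, u; rewrite inE js orbT.
rewrite big_cons -ih1.
apply: (@iid_independence (sub_words i) _ _ _ _ _ _ sG ih2).
- rewrite -subset0 => w [] [u [_ ->]] [j [v [/= js _ [ij _]]]].
  by rewrite ij js in nis.
- by move=> [? []].
- by move=> [? [? []]].
Qed.

(** The words of length one and the longer ones are disjoint index sets, so the sum of the weights
    can be tilted without disturbing the masses that multiply them. *)
Lemma sum_good n (s : seq 'I_r) C G : uniq s -> measurable G -> measurable C ->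
  P ((fun x => \sum_(j <- s) V [:: j] x)%R @^-1` C `&`
     [set x | forall j, j \in s -> G (mass (shift V j) n x)]) =
  P ((fun x => \sum_(j <- s) V [:: j] x)%R @^-1` C) *
    \prod_(j <- s) P (mass (shift V j) n @^-1` G).
Proof.
move=> us mG mC; have [<- sG] := sub_words_prod n us mG.
apply: (@iid_independence [set w | exists j, w = [:: j]] _ _ _ _ _ _ _ sG).
- rewrite -subset0 => w [] [i ->] [j [v [/= js v0 [ij vE]]]].
  by rewrite -vE in v0.
- by move=> [].
- by move=> [? [? []]].
- apply: sigma_preimage => //; rewrite /gen_measurable.
  by apply: measurable_sum => j; apply: gen_measurable_coord; exists j.
Qed.

Lemma sigma_rest n i (s : seq 'I_r) C : i \notin s -> measurable C ->
  <<s cylinders V (first_letter [set j | j != i]) >>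
    ((fun x => \sum_(j <- s) V [:: j] x * mass (shift V j) n x)%R @^-1` C).
Proof.
move=> nis mC; apply: sigma_preimage => //.
have : {subset s <= [pred j | j != i]}.
  by move=> j js /=; apply: contraNneq nis => <-.
elim: s {nis} => [_|j s ih sub].
  rewrite (_ : (fun x => _) = cst 0%R); first exact: measurable_cst.
    by apply/funext => x; rewrite big_nil.
rewrite (_ : (fun x => _) = (fun x => V [:: j] x * mass (shift V j) n x +
   \sum_(j <- s) V [:: j] x * mass (shift V j) n x)%R); last first.
  by apply/funext => x; rewrite big_cons.
have ji : j != i by apply: (sub j); rewrite mem_head.
apply: measurable_funD; last by apply: ih => k ks; apply: sub; rewrite inE ks orbT.
apply: measurable_funM.
  by apply: gen_measurable_coord; exists j, [::].
by apply: gen_measurableW (@gen_measurable_sub n j); exact: sub_first.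
Qed.

End cascade.

(** * Elementary inequalities for the exponential *)

Section exponential_inequalities.
Context (R : realType).
Implicit Types x y : R.
Local Open Scope ring_scope.

Lemma nonneg_of_derive (f f' : R -> R) : f 0 = 0 ->
  (forall x, is_derive x 1 f (f' x)) -> (forall x, 0 <= x -> 0 <= f' x) ->
  forall x, 0 <= x -> 0 <= f x.
Proof.
move=> f0 df f'0 x; rewrite le_eqVlt => /orP[/eqP <-|x0]; first by rewrite f0.
have h1 y : y \in `]0, x[ -> is_derive y 1 f (f' y) by move=> _; exact: df.
have h2 : {within `[0, x], continuous f}.
  apply: continuous_subspaceT => y; apply: differentiable_continuous.
  by apply/derivable1_diffP; case: (df y).
have [z zx] := MVT x0 h1 h2.
by rewrite f0 !subr0 => ->; rewrite mulr_ge0 ?f'0// ?(itvP zx)// ltW.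
Qed.

Lemma expRN_le2 x : 0 <= x -> expR (- x) <= 1 - x + x ^+ 2 / 2.
Proof.
move=> x0; rewrite -subr_ge0; move: x x0.
apply: (@nonneg_of_derive _ (fun x => -1 + x + expR (- x))).
- by rewrite oppr0 expR0; lra.
- by move=> x; apply: is_derive_eq; rewrite /GRing.scale /=; field.
- by move=> x x0; have := expR_ge1Dx (- x); lra.
Qed.

Lemma expRN_ge3 x : 0 <= x -> 1 - x + x ^+ 2 / 2 - x ^+ 3 <= expR (- x).
Proof.
move=> x0; rewrite -subr_ge0; move: x x0.
apply: (@nonneg_of_derive _ (fun x => - expR (- x) + 1 - x + 3 * x ^+ 2)).
- by rewrite oppr0 expR0; lra.
- by move=> x; apply: is_derive_eq; rewrite /GRing.scale /=; field.
- by move=> x x0; have := expRN_le2 x0; nra.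
Qed.

Lemma expR_ge2 x : 0 <= x -> 1 + x + x ^+ 2 / 2 <= expR x.
Proof.
move=> x0; rewrite -subr_ge0; move: x x0.
apply: (@nonneg_of_derive _ (fun x => expR x - 1 - x)).
- by rewrite expR0; lra.
- by move=> x; apply: is_derive_eq; rewrite /GRing.scale /=; field.
- by move=> x x0; have := expR_ge1Dx x; lra.
Qed.

Lemma expR_le_sqr x : expR x <= 1 + x + x ^+ 2 * expR `|x|.
Proof.
have [x0|x0] := leP 0 x.
- rewrite ger0_norm//.
  have h : expR x * (1 - x) <= 1.
    have := expR_ge1Dx (- x); rewrite expRN => h.
    have e0 := expR_gt0 x.
    by rewrite -(@ler_pM2l _ (expR x)) in h => //; rewrite divff ?gt_eqF// in h.
  nra.
- rewrite ltr0_norm//; set y := - x; have -> : x = - y by rewrite opprK.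
  have y0 : 0 < y by rewrite oppr_gt0.
  have h : expR (- y) * (1 + y) <= 1.
    have := expR_ge1Dx y; rewrite expRN => h.
    have e0 := expR_gt0 y.
    by rewrite ler_pdivrMl// mulr1.
  have h2 : 1 <= expR y by rewrite -[leLHS]expR0 ler_expR ltW.
  have h3 := expR_gt0 (- y).
  have h4 : expR (- y) <= 1 - y + y ^+ 2.
    rewrite -(@ler_pM2r _ (1 + y)); last by lra.
    by apply: (le_trans h); nra.
  nra.
Qed.

Lemma expR_le3 x : 0 <= x -> expR x <= 1 + x + x ^+ 2 / 2 + x ^+ 3 * expR x.
Proof.
move=> x0; rewrite -subr_ge0; move: x x0.
apply: (@nonneg_of_derive _ (fun x => 1 + x + 3 * x ^+ 2 * expR x + x ^+ 3 * expR x - expR x)).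
- by rewrite expR0; lra.
- by move=> x; apply: is_derive_eq; rewrite /GRing.scale /=; field.
- move=> x x0; have := expR_le_sqr x; rewrite ger0_norm// => h.
  have := expR_gt0 x => h1; have : 0 <= x ^+ 3 * expR x by rewrite mulr_ge0// ?exprn_ge0// ltW.
  have h2 : 0 <= x ^+ 2 * expR x by rewrite mulr_ge0 ?exprn_ge0 ?expR_ge0.
  by move=> h3; lra.
Qed.

Lemma le_invM_expR x e : 0 < e -> x <= e^-1 * expR (e * x).
Proof.
move=> e0; rewrite -(ler_pM2l e0) mulrA divff ?gt_eqF// mul1r.
by have := expR_ge1Dx (e * x); lra.
Qed.

Lemma expRB_le x y : expR y - expR x <= (y - x) * expR y.
Proof.
have : expR x = expR y * expR (x - y) by rewrite -expRD; congr expR; lra.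
have := expR_ge1Dx (x - y); have := expR_gt0 y => h1 h2 ->; nra.
Qed.

End exponential_inequalities.

(** * Extended logarithms and strict inequalities in the extended reals *)

Section extended_log.
Context (R : realType).
Implicit Types (p : \bar R) (x : R).

Lemma lne_le_expR p x : 0 <= p -> (lne p <= x%:E) = (p <= (expR x)%:E).
Proof.
move=> p0; rewrite -[in RHS]lee_lne ?in_itv/= ?p0 ?leey ?lee_fin ?expR_ge0//.
by rewrite (lt_geF (expR_gt0 x)) expRK.
Qed.

Lemma lne_ge_expR p x : 0 <= p -> (x%:E <= lne p) = ((expR x)%:E <= p).
Proof.
move=> p0; rewrite -[in RHS]lee_lne ?in_itv/= ?p0 ?leey ?lee_fin ?expR_ge0//.
by rewrite (lt_geF (expR_gt0 x)) expRK.
Qed.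

Lemma real_between (t : R) (c : \bar R) : t%:E < c ->
  exists u : R, (t < u)%R /\ u%:E < c.
Proof.
case: c => [c| |]//= tc.
- by exists ((t + c) / 2)%R; move: tc; rewrite !lte_fin; lra.
- by exists (t + 1)%R; split; [lra|exact: ltry].
Qed.

End extended_log.

Lemma expR_taylor3 (R : realType) (x : R) :
  (`|expR x - (1 + x + x ^+ 2 / 2)| <= `|x| ^+ 3 * expR `|x|)%R.
Proof.
have [x0|x0] := leP 0%R x.
  rewrite ger0_norm// ?subr_ge0 ?expR_ge2// ger0_norm//.
  by have := expR_le3 x0; lra.
rewrite (ltr0_norm x0); set y := (- x)%R; have -> : x = (- y)%R by rewrite opprK.
have y0 : (0 <= y)%R by rewrite oppr_ge0 ltW.
have h1 := expRN_le2 y0; have h2 := expRN_ge3 y0.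
have h3 : (1 <= expR y)%R by rewrite -[leLHS]expR0 ler_expR.
have h4 : (y ^+ 3 <= y ^+ 3 * expR y)%R by rewrite ler_peMr// exprn_ge0.
by rewrite ler0_norm sqrrN; lra.
Qed.

Record cascade_weight (R : realType) d (T : measurableType d) (P : probability T R)
    (W : T -> R) (c : \bar R) : Prop := CascadeWeight {
  weight_measurable : measurable_fun setT W;
  weight_ge0 : forall x, (0 <= W x)%R;
  weight_mean : \int[P]_x (W x)%:E = 1;
  weight_gt0 : 0 < c;
  weight_tail : (w^-1)%:E * lne (P [set x | (w <= W x)%R]) @[w --> +oo%R] --> - c }.

(** * Exponential moments of the weight *)

Section moments.
Context (R : realType) d (T : measurableType d) (P : probability T R).
Context (W : T -> R) (c : \bar R).
Hypothesis HW : cascade_weight P W c.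

Let mW := weight_measurable HW.
Let W0 := weight_ge0 HW.
Let EW := weight_mean HW.
Let c0 := weight_gt0 HW.
Let Wtail := weight_tail HW.

Lemma measurable_tail w : measurable [set x | (w <= W x)%R].
Proof.
rewrite (_ : [set x | _] = W @^-1` `[w, +oo[%classic).
  by rewrite -[X in measurable X]setTI; exact: mW.
by apply/seteqP; split => x /=; rewrite in_itv/= andbT.
Qed.

Lemma tail_le (t : R) : t%:E < c ->
  \forall w \near +oo%R, P [set x | (w <= W x)%R] <= (expR (- (t * w)))%:E.
Proof.
move=> tc.
have : nbhs (- c) [set y : \bar R | y < (- t)%:E].
  apply: open_nbhs_nbhs; split; first exact: open_ereal_lt_ereal.
  by rewrite /= EFinN lteN2.
move=> /Wtail; rewrite /= => h; near=> w.
have w0 : (0 < w)%R by near: w; exact: nbhs_pinfty_gt.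
rewrite -lne_le_expR//.
have : (w^-1)%:E * lne (P [set x | (w <= W x)%R]) < (- t)%:E by near: w; exact: h.
move=> /ltW; rewrite muleC lee_pdivrMr//.
by rewrite -EFinM -mulNr.
Unshelve. all: by end_near.
Qed.

Lemma tail_ge (t : R) : c < t%:E ->
  \forall w \near +oo%R, (expR (- (t * w)))%:E <= P [set x | (w <= W x)%R].
Proof.
move=> tc.
have : nbhs (- c) [set y : \bar R | (- t)%:E < y].
  apply: open_nbhs_nbhs; split; first exact: open_ereal_gt_ereal.
  by rewrite /= EFinN lteN2.
move=> /Wtail; rewrite /= => h; near=> w.
have w0 : (0 < w)%R by near: w; exact: nbhs_pinfty_gt.
rewrite -lne_ge_expR//.
have : (- t)%:E < (w^-1)%:E * lne (P [set x | (w <= W x)%R]) by near: w; exact: h.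
move=> /ltW; rewrite muleC lee_pdivlMr//.
by rewrite -EFinM -mulNr.
Unshelve. all: by end_near.
Qed.

Lemma integral_constant (r : R) : \int[P]_x r%:E = r%:E.
Proof.
rewrite integral_cst//; apply: (@eq_trans _ _ (r%:E * 1)); last exact: mule1.
by congr (_ * _); exact: probability_setT.
Qed.

(** Formally the [k]-th derivative of the Laplace transform of [W]. The transform is never
    differentiated: inequalities between moments of different orders, obtained under the integral,
    play the part of derivatives. *)
Definition emoment (k : nat) (t : R) : \bar R :=
  \int[P]_x (W x ^+ k * expR (t * W x))%:E.

Definition moment (k : nat) (t : R) : R := fine (emoment k t).

Lemma measurable_expW k t : measurable_fun setT (fun x => W x ^+ k * expR (t * W x))%R.
Proof.
apply: measurable_funM; first exact: measurable_funX.
apply: measurableT_comp => //.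
exact: measurable_funM.
Qed.

Lemma expW_ge0 k t x : (0 <= W x ^+ k * expR (t * W x))%R.
Proof. by rewrite mulr_ge0 ?exprn_ge0 ?expR_ge0. Qed.

Lemma emoment_ge0 k t : 0 <= emoment k t.
Proof. by apply: integral_ge0 => x _; rewrite lee_fin expW_ge0. Qed.

(** With [th] strictly between [t] and [c], the tail is eventually at most [exp (- th w)]; slicing
    [W] by its integer part then yields a geometric series of ratio [exp (t - th)]. *)
Lemma emoment0_lty t : t%:E < c -> emoment 0 t < +oo.
Proof.
move=> tc; have [t0|t0] := leP t 0%R.
  apply: (@le_lt_trans _ _ (\int[P]_x (cst 1 x))); last first.
    by rewrite (integral_constant 1) ltry.
  apply: ge0_le_integral => //.
  - by move=> x _; rewrite lee_fin expW_ge0.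
  - by apply/measurable_EFinP; exact: measurable_expW.
  - move=> x _; rewrite lee_fin expr0 mul1r expR_le1.
    by rewrite mulr_le0_ge0.
have [th [tth thc]] := real_between tc.
have [N [_ HN]] := tail_le thc.
have [K NK] : exists K : nat, (N < K%:R)%R.
  exists (Num.truncn (Num.max N 0%R)).+1.
  have := @truncn_itv _ (Num.max N 0%R); rewrite le_max lexx orbT => /(_ isT).
  by move=> /andP[_]; rewrite gt_max => /andP[].
have KN (k : nat) : (N < (k + K)%:R)%R.
  by apply: (lt_le_trans NK); rewrite ler_nat leq_addl.
(* The slice of the integer part of [W] alone dominates [exp (t W)], hence the successor in the
   exponent; the values of [W] up to [K] are covered by the constant [exp (t K)]. *)
pose a k : R := expR (t * (k + K).+1%:R).
pose u k x : \bar R := (a k * \1_[set y | ((k + K)%:R <= W y)%R] x)%:E.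
have u0 k x : 0 <= u k x by rewrite lee_fin mulr_ge0 ?expR_ge0.
have mu k : measurable_fun setT (u k).
  apply/measurable_EFinP; apply: measurable_funM => //.
  exact/measurable_indic/measurable_tail.
pose q := expR (t - th); pose A : R := expR (t * (K.+1)%:R - th * K%:R).
have q1 : (q < 1)%R by rewrite expR_lt1; lra.
have iu k : \int[P]_x u k x <= (A * q ^+ k)%:E.
  rewrite /u; under eq_integral do rewrite EFinM.
  rewrite ge0_integralZl//; last by rewrite lee_fin expR_ge0.
    rewrite integral_indic//; last exact: measurable_tail.
    rewrite setIT; apply: (@le_trans _ _ ((a k)%:E * (expR (- (th * (k + K)%:R)))%:E)).
      by rewrite lee_pmul2l// ?lte_fin ?expR_gt0//; exact: HN.
    rewrite -EFinM lee_fin /a /A /q -expRM_natl -!expRD ler_expR.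
    by rewrite -!natr1 !natrD; lra.
  by apply/measurable_EFinP; exact/measurable_indic/measurable_tail.
apply: (@le_lt_trans _ _ (\int[P]_x ((expR (t * K%:R))%:E + \sum_(0 <= k <oo) u k x))).
  apply: ge0_le_integral => //.
  - by move=> x _; rewrite lee_fin expW_ge0.
  - by apply/measurable_EFinP; exact: measurable_expW.
  - by apply: emeasurable_funD => //; exact: ge0_emeasurable_sum.
  - move=> x _; rewrite expr0 mul1r.
    have [WK|WK] := leP (W x) K%:R.
      apply: (@le_trans _ _ (expR (t * K%:R))%:E).
        by rewrite lee_fin ler_expR ler_pM2l.
      by rewrite leeDl//; exact: nneseries_ge0.
    pose m := Num.truncn (W x); have := truncn_itv (W0 x) => /andP[mW1 mW2].
    have Km : (K <= m)%N by rewrite truncn_ge_nat// ltW.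
    apply: (@le_trans _ _ (u (m - K)%N x)); last first.
      apply: (@le_trans _ _ (\sum_(0 <= k < (m - K).+1) u k x)).
        by rewrite big_nat_recr//= leeDr// sume_ge0.
      apply: (@le_trans _ _ (\sum_(0 <= k <oo) u k x)); first exact: nneseries_lim_ge.
      by rewrite leeDr// lee_fin expR_ge0.
    rewrite /u indicE mem_set /= ?subnK// mulr1 lee_fin /a subnK//.
    by rewrite ler_expR ler_pM2l// ltW.
rewrite ge0_integralD//; last 2 first.
- by move=> x _; exact: nneseries_ge0.
- exact: ge0_emeasurable_sum.
rewrite integral_constant integral_nneseries// lte_add_pinfty ?ltry//.
apply: (@le_lt_trans _ _ (\sum_(0 <= k <oo) (A * q ^+ k)%:E)).
  by apply: lee_nneseries => // k _ _; exact: integral_ge0.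
apply: (@le_lt_trans _ _ (A / (1 - q))%:E); last exact: ltry.
apply: lime_le; first by apply: is_cvg_nneseries => k _ _; rewrite lee_fin mulr_ge0 ?exprn_ge0 ?expR_ge0.
apply: nearW => n; rewrite sumEFin lee_fin.
apply: (geometric_le_lim n); rewrite ?expR_ge0 ?expR_gt0//.
by rewrite ger0_norm// expR_ge0.
Qed.

Lemma emoment_lty k t : t%:E < c -> emoment k t < +oo.
Proof.
move=> tc; have [th [tth thc]] := real_between tc.
(* Then [W ^+ k] is at most a constant times [exp (k e W)], and [t + k e <= th]. The successor in
   the denominator covers [k = 0]. *)
pose e := ((th - t) / k.+1%:R)%R.
have e0 : (0 < e)%R by rewrite divr_gt0//; lra.
apply: (@le_lt_trans _ _ (\int[P]_x ((e^-1 ^+ k)%:E * (W x ^+ 0 * expR (th * W x))%:E))).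
  apply: ge0_le_integral => //.
  - by move=> x _; rewrite lee_fin expW_ge0.
  - by apply/measurable_EFinP; exact: measurable_expW.
  - by apply: emeasurable_funM => //; apply/measurable_EFinP; exact: measurable_expW.
  - move=> x _; rewrite -EFinM lee_fin expr0 mul1r.
    have h : (W x ^+ k <= e^-1 ^+ k * expR (k%:R * (e * W x)))%R.
      rewrite expRM_natl -exprMn; apply: lerXn2r; rewrite ?nnegrE//.
        by rewrite mulr_ge0 ?invr_ge0 ?expR_ge0// ltW.
      exact: le_invM_expR.
    apply: (le_trans (ler_wpM2r (expR_ge0 (t * W x)) h)).
    rewrite -mulrA -expRD ler_pM2l ?exprn_gt0 ?invr_gt0// ler_expR mulrA -mulrDl.
    apply: ler_wpM2r => //; rewrite /e.
    have k0 : (0 <= k%:R :> R)%R by [].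
    have : (k%:R * ((th - t) / k.+1%:R) <= th - t)%R.
      rewrite mulrCA ger_pMr; last by lra.
      by rewrite ler_pdivrMr// mul1r ler_nat.
    by set y := (_ * _)%R => h'; lra.
rewrite ge0_integralZl//.
- by rewrite lte_mul_pinfty ?lee_fin ?exprn_ge0 ?invr_ge0 ?ltW//; exact: emoment0_lty.
- by apply/measurable_EFinP; exact: measurable_expW.
- by move=> x _; rewrite lee_fin expW_ge0.
- by rewrite lee_fin exprn_ge0 ?invr_ge0 ?ltW.
Qed.

Lemma momentE k t : t%:E < c -> emoment k t = (moment k t)%:E.
Proof. by move=> tc; rewrite /moment fineK// ge0_fin_numE ?emoment_ge0// emoment_lty. Qed.

Lemma integrable_expW k t : t%:E < c ->
  P.-integrable setT (fun x => (W x ^+ k * expR (t * W x))%:E).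
Proof.
move=> tc; apply/integrableP; split.
  by apply/measurable_EFinP; exact: measurable_expW.
under eq_integral do rewrite gee0_abs ?lee_fin ?expW_ge0//.
exact: emoment_lty.
Qed.

(** One integral identity for all the polynomial comparisons below: a polynomial of degree 2 under
    the tilt [t], plus a remainder under the larger tilt [b]. *)
Lemma quadratic_moment (a0 a1 a2 q t b : R) k : t%:E < c -> b%:E < c ->
  P.-integrable setT (fun x => ((a0 + a1 * W x + a2 * W x ^+ 2) * expR (t * W x) +
    q * (W x ^+ k * expR (b * W x)))%:E) /\
  \int[P]_x ((a0 + a1 * W x + a2 * W x ^+ 2) * expR (t * W x) +
    q * (W x ^+ k * expR (b * W x)))%:E =
  (a0 * moment 0 t + a1 * moment 1 t + a2 * moment 2 t + q * moment k b)%:E.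
Proof.
move=> tc bc.
pose f (a : R) j s x : \bar R := a%:E * (W x ^+ j * expR (s * W x))%:E.
have fi a j s : s%:E < c -> P.-integrable setT (f a j s).
  by move=> sc; apply: integrableZl => //; exact: integrable_expW.
have fE a j s : s%:E < c -> \int[P]_x f a j s x = (a * moment j s)%:E.
  by move=> sc; rewrite integralZl//; [rewrite -/(emoment j s) momentE|exact: integrable_expW].
rewrite (_ : (fun x => _) = (fun x => ((f a0 0%N t x + f a1 1%N t x) + f a2 2%N t x) + f q k b x)); last first.
  apply/funext => x; rewrite /f -!EFinM -!EFinD; congr EFin.
  by rewrite expr0 expr1; ring.
have i1 : P.-integrable setT (fun x => f a0 0%N t x + f a1 1%N t x).
  by apply: integrableD => //; exact: fi.
have i2 : P.-integrable setT (fun x => f a0 0%N t x + f a1 1%N t x + f a2 2%N t x).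
  by apply: integrableD => //; exact: fi.
split; first by apply: integrableD => //; exact: fi.
rewrite integralD//; last exact: fi.
rewrite integralD//; last exact: fi.
rewrite integralD//; [|exact: fi|exact: fi].
by rewrite !fE// -!EFinD.
Qed.

Lemma moment00 : moment 0 0 = 1%R.
Proof.
rewrite /moment /emoment; under eq_integral do rewrite expr0 mul0r expR0 mulr1.
by rewrite integral_constant.
Qed.

Lemma moment10 : moment 1 0 = 1%R.
Proof.
rewrite /moment /emoment; under eq_integral do rewrite expr1 mul0r expR0 mulr1.
by rewrite EW.
Qed.

Lemma moment_ge0 k t : (0 <= moment k t)%R.
Proof. by rewrite fine_ge0// emoment_ge0. Qed.

Lemma emoment_le k t u : (t <= u)%R -> emoment k t <= emoment k u.
Proof.
move=> tu; apply: ge0_le_integral => //.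
- by move=> x _; rewrite lee_fin expW_ge0.
- by apply/measurable_EFinP; exact: measurable_expW.
- by apply/measurable_EFinP; exact: measurable_expW.
- by move=> x _; rewrite lee_fin ler_wpM2l ?exprn_ge0// ler_expR ler_wpM2r.
Qed.

Lemma lt_le_c (t u : R) : (t <= u)%R -> u%:E < c -> t%:E < c.
Proof. by move=> tu; apply: le_lt_trans; rewrite lee_fin. Qed.

Lemma moment_le k t u : (t <= u)%R -> u%:E < c -> (moment k t <= moment k u)%R.
Proof.
move=> tu uc; have tc := lt_le_c tu uc.
by rewrite -lee_fin -(momentE k tc) -(momentE k uc) emoment_le.
Qed.

Lemma moment_lipschitz k t u : (t <= u)%R -> u%:E < c ->
  (moment k u - moment k t <= (u - t) * moment k.+1 u)%R.
Proof.
move=> tu uc; have tc := lt_le_c tu uc.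
rewrite lerBlDr addrC -lee_fin EFinD EFinM -!momentE//.
rewrite /emoment -ge0_integralZl//; last 3 first.
- by apply/measurable_EFinP; exact: measurable_expW.
- by move=> x _; rewrite lee_fin expW_ge0.
- by rewrite lee_fin subr_ge0.
rewrite -ge0_integralD//; last 4 first.
- by move=> x _; rewrite lee_fin expW_ge0.
- by apply/measurable_EFinP; exact: measurable_expW.
- by move=> x _; rewrite -EFinM lee_fin mulr_ge0 ?subr_ge0// expW_ge0.
- by apply: emeasurable_funM => //; apply/measurable_EFinP; exact: measurable_expW.
apply: ge0_le_integral => //.
- by move=> x _; rewrite lee_fin expW_ge0.
- by apply/measurable_EFinP; exact: measurable_expW.
- apply: emeasurable_funD; first by apply/measurable_EFinP; exact: measurable_expW.
  by apply: emeasurable_funM => //; apply/measurable_EFinP; exact: measurable_expW.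
- move=> x _; rewrite -EFinM -EFinD lee_fin exprSr.
  rewrite mulrCA -mulrA -mulrDr ler_wpM2l ?exprn_ge0//.
  by have := expRB_le (t * W x) (u * W x); lra.
Qed.

Lemma moment_second_order t b u : (0 <= b)%R -> (t + b)%:E < c -> (`|u| <= b)%R ->
  (moment 0 (t + u) <= moment 0 t + u * moment 1 t + u ^+ 2 * moment 2 (t + b))%R.
Proof.
move=> b0 tbc ub.
have tc : t%:E < c by apply: lt_le_c tbc; lra.
have ub' : (u <= b)%R by apply: le_trans ub; exact: ler_norm.
have tuc : (t + u)%:E < c by apply: lt_le_c tbc; lra.
have [i1 e1] := @quadratic_moment 1 u 0 (u ^+ 2) t (t + b) 2 tc tbc.
rewrite mul1r mul0r addr0 in e1.
rewrite -lee_fin -e1 -momentE//; apply: le_integral => //.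
  exact: integrable_expW.
move=> x _; rewrite lee_fin expr0 mul1r mul0r addr0 mulrDl expRD.
have := expR_le_sqr (u * W x) => h.
have e0 := expR_gt0 (t * W x).
apply: (@le_trans _ _ (expR (t * W x) * (1 + u * W x + (u * W x) ^+ 2 * expR `|u * W x|)))%R.
  by rewrite ler_pM2l.
have h5 : (expR `|u * W x| * expR (t * W x) <= expR ((t + b) * W x))%R.
  rewrite -expRD ler_expR mulrDl addrC lerD2l normrM (ger0_norm (W0 x)).
  exact: ler_wpM2r.
rewrite mulrC mulrDl lerD2l -mulrA exprMn -mulrA.
by rewrite ler_wpM2l ?sqr_ge0// ler_wpM2l ?sqr_ge0.
Qed.

Lemma moment_third_order b u : (0 <= b)%R -> b%:E < c -> (`|u| <= b)%R ->
  (`|moment 0 u - (1 + u + u ^+ 2 / 2 * moment 2 0)| <= `|u| ^+ 3 * moment 3 b)%R.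
Proof.
move=> b0 bc ub.
have zc : (0%R : R)%:E < c by [].
have uc : u%:E < c by apply: lt_le_c bc; apply: le_trans ub; exact: ler_norm.
have [i1 e1] := @quadratic_moment 1 u (u ^+ 2 / 2) (`|u| ^+ 3) 0 b 3 zc bc.
have [i2 e2] := @quadratic_moment 1 u (u ^+ 2 / 2) (- `|u| ^+ 3) 0 b 3 zc bc.
rewrite moment00 moment10 !mulr1 in e1 e2.
have key x : (`|expR (u * W x) - (1 + u * W x + (u * W x) ^+ 2 / 2)| <=
    `|u| ^+ 3 * (W x ^+ 3 * expR (b * W x)))%R.
  apply: (@le_trans _ _ (`|u * W x| ^+ 3 * expR (`|u * W x|)))%R.
    exact: expR_taylor3.
  rewrite normrM (ger0_norm (W0 x)) exprMn -mulrA ler_wpM2l ?exprn_ge0//.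
  by rewrite ler_wpM2l ?exprn_ge0// ler_expR ler_wpM2r.
rewrite ler_norml; apply/andP; split.
  rewrite lerBrDr addrC -mulNr.
  rewrite -lee_fin -e2 -momentE//; apply: le_integral => //.
    exact: integrable_expW.
  move=> x _; rewrite lee_fin mul0r expR0 mulr1 expr0 mul1r.
  by have := key x; rewrite ler_norml exprMn => /andP[]; lra.
rewrite lerBlDr addrC.
rewrite -lee_fin -e1 -momentE//; apply: le_integral => //.
  exact: integrable_expW.
move=> x _; rewrite lee_fin mul0r expR0 mulr1 expr0 mul1r.
by have := key x; rewrite ler_norml exprMn => /andP[]; lra.
Qed.

(** Integrate [exp y >= 1 + y] at [y = (u - t) * (W - s)] against [exp (t W)]. For [t = 0] and
    [s = 1] it is Jensen's inequality; when [s] is the mean of [W] tilted by [t], it is the tangent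
    inequality for the log-Laplace transform. No finiteness is asked at [u]. *)
Lemma mgf_tangent t s u : t%:E < c ->
  (expR ((u - t) * s) * (moment 0 t * (1 - (u - t) * s) + (u - t) * moment 1 t))%:E
    <= emoment 0 u.
Proof.
move=> tc; have [ufin|] := boolP (emoment 0 u \is a fin_num); last first.
  by rewrite ge0_fin_numE ?emoment_ge0// -leNgt leye_eq => /eqP ->; rewrite leey.
set E := expR ((u - t) * s).
have [i1 e1] := @quadratic_moment (E * (1 - (u - t) * s)) (E * (u - t)) 0 0 t t 0 tc tc.
rewrite (_ : (E * _)%R = (E * (1 - (u - t) * s) * moment 0 t +
  E * (u - t) * moment 1 t + 0 * moment 2 t + 0 * moment 0 t)%R); last by ring.
rewrite -e1; apply: le_integral => //.
  apply/integrableP; split.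
    by apply/measurable_EFinP; exact: measurable_expW.
  under eq_integral do rewrite gee0_abs ?lee_fin ?expW_ge0//.
  by rewrite -ge0_fin_numE// emoment_ge0.
move=> x _; rewrite lee_fin expr0 !mul1r !mul0r !addr0.
have -> : (E * (1 - (u - t) * s) + E * (u - t) * W x)%R =
   (E * (1 + ((u - t) * (W x - s))))%R by ring.
have -> : expR (u * W x) = (E * expR ((u - t) * (W x - s)) * expR (t * W x))%R.
  by rewrite /E -!expRD; congr expR; ring.
by rewrite ler_wpM2r ?expR_ge0// ler_wpM2l ?expR_ge0// expR_ge1Dx.
Qed.

End moments.

(* Otherwise unification unfolds [moment] to integrals when it compares moments
   of different orders. *)
Opaque moment.

(** * An intermediate value theorem for Lipschitz functions *)

Section lipschitz.
Context (R : realType).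
Local Open Scope ring_scope.

Lemma lipschitz_difference (x y s h m1 m2 a b : R) : 0 <= h ->
  0 <= x - y -> 0 <= a - b -> x - y <= h * m2 -> a - b <= h * m1 ->
  `|(x - s * a) - (y - s * b)| <= (m2 + `|s| * m1 + 1) * h.
Proof.
move=> h0 x0 y0 xh yh.
have -> : x - s * a - (y - s * b) = (x - y) - s * (a - b) by ring.
apply: (le_trans (ler_normB _ _)).
rewrite normrM (ger0_norm x0) (ger0_norm y0).
have := ler_wpM2l (normr_ge0 s) yh; lra.
Qed.

Let clamp (a b x : R) := Num.max a (Num.min x b).

Let clamp_itv a b x : a <= b -> a <= clamp a b x <= b.
Proof. by move=> ab; rewrite /clamp le_max lexx ge_max ab ge_min lexx orbT. Qed.

Let clamp_lipschitz a b x y : a <= b -> x <= y ->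
  clamp a b x <= clamp a b y /\ clamp a b y - clamp a b x <= y - x.
Proof.
move=> ab xy; rewrite /clamp.
have [yb|yb] := leP y b.
  rewrite (min_l (le_trans xy yb)); have [ax|ax] := leP a x.
    by rewrite (max_r (le_trans ax xy)).
  by have [ay|ay] := leP a y; split; lra.
rewrite (max_r ab); have [xb|xb] := leP x b; last by rewrite max_r//; split; lra.
by have [ax|ax] := leP a x; split; lra.
Qed.

(** Composing [h] with the projection onto [[a, b]] gives a function continuous on the whole line,
    so that nothing is needed about [h] outside the interval. *)
Lemma lipschitz_ivt (h : R -> R) a b K : a <= b -> 0 < K ->
  (forall t u, a <= t -> t <= u -> u <= b -> `|h u - h t| <= K * (u - t)) ->
  h a <= 0 -> 0 <= h b -> exists t, (a <= t <= b) /\ h t = 0.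
Proof.
move=> ab K0 hlip ha hb.
have hc : continuous (h \o clamp a b).
  move=> x; apply/cvgrPdist_lt => e e0; near=> y.
  have yx : `|x - y| < e / K.
    by near: y; apply: cvgr_dist_lt => //; rewrite divr_gt0.
  rewrite ltr_pdivlMr// in yx; apply: le_lt_trans yx; rewrite /=.
  have /andP[x1 x2] := clamp_itv x ab; have /andP[y1 y2] := clamp_itv y ab.
  have [xy|/ltW xy] := leP x y.
    have [c1 c2] := clamp_lipschitz ab xy; rewrite distrC.
    apply: (le_trans (hlip _ _ _ c1 _)) => //.
    by rewrite distrC ger0_norm ?subr_ge0// mulrC ler_wpM2r// ltW.
  have [c1 c2] := clamp_lipschitz ab xy.
  apply: (le_trans (hlip _ _ _ c1 _)) => //.
  by rewrite ger0_norm ?subr_ge0// mulrC ler_wpM2r// ltW.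
have cla : clamp a b a = a by rewrite /clamp min_l// maxxx.
have clb : clamp a b b = b by rewrite /clamp minxx max_r.
have [] := @IVT R (h \o clamp a b) a b 0 ab.
- by apply: continuous_subspaceT.
- by rewrite /= cla clb ge_min le_max ha hb orbT.
move=> t; rewrite in_itv/= => /andP[t1 t2] ht.
exists t; rewrite t1 t2; split => //; move: ht.
by rewrite /= /clamp min_l// max_r.
Unshelve. all: by end_near.
Qed.

End lipschitz.

(** * The log-Laplace transform of the weight and its Legendre transform *)

Section legendre_transform.
Context (R : realType) d (T : measurableType d) (P : probability T R).
Context (W : T -> R) (c : \bar R).
Hypothesis HW : cascade_weight P W c.

Let W0 := weight_ge0 HW.
Let c0 := weight_gt0 HW.

Local Notation M := (moment P W 0).
Local Notation L := (log_laplace P W).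
Local Notation Lst := (legendre (log_laplace P W)).

Definition cumulant (t : R) : R := ln (M t).
(** The mean of [W] under the law with density [exp (t W) / M t], that is, the slope of the cumulant
    at [t]. *)
Definition tilted_mean (t : R) : R := (moment P W 1 t / M t)%R.

Lemma log_laplaceE t : L t = lne (emoment P W 0 t).
Proof.
rewrite /log_laplace /mmt_gen_fun unlock; congr lne; apply: eq_integral => x _.
by rewrite /= expr0 mul1r mulrC.
Qed.

Lemma expR_le_emoment u : (expR u)%:E <= emoment P W 0 u.
Proof.
have := @mgf_tangent _ _ _ _ _ _ HW 0 1 u c0.
by rewrite (moment00 P W) (moment10 HW) subr0 !mulr1 mul1r subrK mulr1.
Qed.

Lemma expR_le_moment t : t%:E < c -> (expR t <= M t)%R.
Proof. by move=> tc; rewrite -lee_fin -(momentE HW)// expR_le_emoment. Qed.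

Lemma moment_gt0 t : t%:E < c -> (0 < M t)%R.
Proof. by move=> tc; apply: lt_le_trans (expR_le_moment tc); exact: expR_gt0. Qed.

Lemma expR_cumulant t : t%:E < c -> expR (cumulant t) = M t.
Proof. by move=> tc; rewrite lnK// posrE moment_gt0. Qed.

Lemma log_laplace_fin t : t%:E < c -> L t = (cumulant t)%:E.
Proof. by move=> tc; rewrite log_laplaceE (momentE HW)// lne_EFin// moment_gt0. Qed.

Lemma log_laplace_ge t : t%:E <= L t.
Proof. by rewrite log_laplaceE lne_ge_expR ?(emoment_ge0 HW) ?expR_le_emoment. Qed.

Lemma cumulant0 : cumulant 0 = 0%R.
Proof. by rewrite /cumulant (moment00 P W) ln1. Qed.

Lemma cumulant_ge t : t%:E < c -> (t <= cumulant t)%R.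
Proof. by move=> tc; rewrite -lee_fin -log_laplace_fin// log_laplace_ge. Qed.

Lemma log_laplace_tangent t u : t%:E < c ->
  (cumulant t + (u - t) * tilted_mean t)%:E <= L u.
Proof.
move=> tc; rewrite log_laplaceE lne_ge_expR ?(emoment_ge0 HW)//.
have := @mgf_tangent _ _ _ _ _ _ HW t (tilted_mean t) u tc; apply: le_trans.
have M0 := moment_gt0 tc.
rewrite lee_fin expRD expR_cumulant// mulrC ler_wpM2l ?expR_ge0//.
rewrite le_eqVlt; apply/orP; left; apply/eqP; rewrite /tilted_mean; field.
by rewrite gt_eqF.
Qed.

Lemma cumulant_tangent t u : t%:E < c -> u%:E < c ->
  (cumulant t + (u - t) * tilted_mean t <= cumulant u)%R.
Proof. by move=> tc uc; rewrite -lee_fin -log_laplace_fin// log_laplace_tangent. Qed.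

Lemma tilt_ge0 t : (0 <= tilted_mean t)%R.
Proof. by rewrite /tilted_mean divr_ge0 ?(moment_ge0 HW). Qed.

(** For [c < th < t], the values of [W] above a single large level [w] already contribute
    [exp ((t - th) w)]. *)
Lemma log_laplace_infty t : c < t%:E -> L t = +oo.
Proof.
move=> ct.
have [th [cth tht]] : exists th : R, c < th%:E /\ (th < t)%R.
  case: (c) c0 ct => [r| |]//= r0; rewrite lte_fin => rt.
  by exists ((r + t) / 2)%R; rewrite lte_fin; lra.
have t0 : (0 < t)%R by rewrite -lte_fin; exact: lt_trans ct.
apply/eqyP => A A0.
have := tail_ge HW cth; move=> [N [_ HN]].
pose w := (Num.max (Num.max N 0) (A / (t - th)) + 1)%R.
have wN : (N < w)%R.
  apply: (@le_lt_trans _ _ (Num.max (Num.max N 0) (A / (t - th)))%R); last by rewrite ltrDl.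
  by rewrite !le_max lexx.
have w0 : (0 <= w)%R.
  by rewrite addr_ge0// !le_max lexx orbT.
have wA : (A <= (t - th) * w)%R.
  rewrite -ler_pdivrMl; last by lra.
  by rewrite mulrC /w ler_wpDr// le_max lexx orbT.
rewrite log_laplaceE lne_ge_expR ?(emoment_ge0 HW)//.
apply: (@le_trans _ _ ((expR (t * w))%:E * P [set x | (w <= W x)%R])).
  apply: (@le_trans _ _ ((expR (t * w))%:E * (expR (- (th * w)))%:E)).
    by rewrite -EFinM -expRD lee_fin ler_expR; lra.
  by rewrite lee_pmul2l// ?lte_fin ?expR_gt0//; exact: HN.
rewrite -(setIT [set x | (w <= W x)%R]) -integral_indic//; last exact: (measurable_tail HW).
rewrite -ge0_integralZl//.
  apply: ge0_le_integral => //.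
  - apply: emeasurable_funM => //; apply/measurable_EFinP.
    exact/measurable_indic/(measurable_tail HW).
  - by apply/measurable_EFinP; exact: (measurable_expW HW).
  - move=> x _; rewrite expr0 mul1r -EFinM lee_fin indicE.
    have [xw|xw] := boolP (x \in _); last by rewrite mulr0 expR_ge0.
    by rewrite mulr1 ler_expR ler_pM2l//; move: xw; rewrite inE.
by apply/measurable_EFinP; exact/measurable_indic/(measurable_tail HW).
Qed.

Lemma legendre_ge t a : (t * a)%:E - L t <= Lst a.
Proof. by apply: ereal_sup_ubound; exists t. Qed.

Lemma legendre_ge_cumulant t a : t%:E < c -> (t * a - cumulant t)%:E <= Lst a.
Proof. by move=> tc; have := legendre_ge t a; rewrite log_laplace_fin. Qed.

Lemma legendre_ge0 a : 0 <= Lst a.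
Proof.
by have := @legendre_ge_cumulant 0 a c0; rewrite mul0r cumulant0 subr0.
Qed.

(** Other parameters are harmless: beyond [c] the transform [L] is infinite, and when [t] and
    [a - 1] have opposite signs Jensen's inequality [t <= L t] makes the term nonpositive. The
    monotonicity of the Legendre transform on both sides of 1 follows at once. *)
Lemma legendre_le a (y : \bar R) : 0 <= y ->
  (forall t, t%:E <= c -> ((a - 1) * t > 0)%R -> (t * a)%:E - L t <= y) -> Lst a <= y.
Proof.
move=> y0 H; apply: ge_ereal_sup => _ [t _ <-].
have [tc|ct] := leP t%:E c; last by rewrite log_laplace_infty// leNye.
have [|ta] := ltP 0%R ((a - 1) * t)%R; first exact: H.
apply: le_trans y0; apply: (@le_trans _ _ ((t * a)%:E - t%:E)).
  by apply: leeB => //; exact: log_laplace_ge.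
by rewrite -EFinB lee_fin; lra.
Qed.

Lemma legendre1 : Lst 1 = 0.
Proof.
apply/eqP; rewrite eq_le legendre_ge0 andbT; apply: legendre_le => // t _.
by rewrite subrr mul0r ltxx.
Qed.

Lemma legendre_nondecreasing a b : (1 <= a)%R -> (a <= b)%R -> Lst a <= Lst b.
Proof.
move=> a1 ab; apply: legendre_le => [|t _ at0]; first exact: legendre_ge0.
apply: le_trans (legendre_ge t b); apply: leeB => //; rewrite lee_fin.
by rewrite ler_wpM2l//; nra.
Qed.

Lemma legendre_nonincreasing a b : (a <= b)%R -> (b <= 1)%R -> Lst b <= Lst a.
Proof.
move=> ab b1; apply: legendre_le => [|t _ at0]; first exact: legendre_ge0.
apply: le_trans (legendre_ge t a); apply: leeB => //; rewrite lee_fin.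
by rewrite ler_wnM2l//; nra.
Qed.

Lemma weight_between : exists b : R, (0 < b)%R /\ b%:E < c.
Proof. exact: real_between. Qed.

Lemma legendre_gt0 a : a != 1%R -> 0 < Lst a.
Proof.
move=> a1; have [b [b0 bc]] := weight_between.
pose C := (moment P W 2 b + 1)%R.
have C0 : (0 < C)%R by rewrite ltr_wpDl// (moment_ge0 HW).
(* Small enough for the linear gain [e * |a - 1|] to exceed the quadratic cost
   [e ^+ 2 * moment P W 2 b]. *)
pose e := (Num.min b (`|a - 1| / (2 * C)))%R.
have a10 : (0 < `|a - 1|)%R by rewrite normr_gt0 subr_eq0.
have e0 : (0 < e)%R by rewrite lt_min b0 divr_gt0// mulr_gt0.
have eb : (e <= b)%R by rewrite ge_min lexx.
have ea : (e * (2 * C) <= `|a - 1|)%R.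
  by rewrite -ler_pdivlMr ?mulr_gt0// ge_min lexx orbT.
pose u := (if 1 <= a then e else - e)%R.
have un : `|u|%R = e by rewrite /u; case: ifP => _; rewrite ?normrN gtr0_norm.
have ua : (u * (a - 1) = e * `|a - 1|)%R.
  rewrite /u; case: (leP 1%R a) => h; first by rewrite ger0_norm// subr_ge0.
  by rewrite ltr0_norm ?subr_lt0//; ring.
have u2 : (u ^+ 2 = e ^+ 2)%R by rewrite -un real_normK// num_real.
have uc : u%:E < c.
  by apply: le_lt_trans bc; rewrite lee_fin (le_trans (ler_norm _))// un.
apply: lt_le_trans (legendre_ge_cumulant a uc).
have : (M u <= expR (u + e ^+ 2 * moment P W 2 b))%R.
  have := @moment_second_order _ _ _ _ _ _ HW 0 b u (ltW b0).
  rewrite !add0r (moment00 P W) (moment10 HW) mulr1 un u2 => /(_ bc eb) h.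
  by apply: (le_trans h); rewrite -addrA expR_ge1Dx.
rewrite -expR_cumulant// ler_expR => h.
rewrite lte_fin; have : (e ^+ 2 * moment P W 2 b < e * `|a - 1|)%R.
  have : (e * moment P W 2 b < e * C)%R by rewrite ltr_pM2l// ltrDl.
  by rewrite expr2 -mulrA ltr_pM2l//; nra.
by nra.
Qed.

Lemma legendre_neg a : (a < 0)%R -> Lst a = +oo.
Proof.
move=> a0; apply/eqyP => A A0.
(* The parameter [A / a] is nonpositive: the linear term is exactly [A], and the cumulant is at most
   0 because [W >= 0]. *)
have tc : (A / a)%:E < c.
  apply: le_lt_trans c0; rewrite lee_fin mulr_ge0_le0 ?invr_le0 ?ltW//.
apply: le_trans (legendre_ge_cumulant a tc).
rewrite divfK ?lt_eqF// lee_fin lerDl oppr_ge0 /cumulant ln_le0//.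
rewrite -lee_fin -(momentE HW)// -(integral_constant P 1).
apply: ge0_le_integral => //.
- by move=> x _; rewrite lee_fin (expW_ge0 HW).
- by apply/measurable_EFinP; exact: (measurable_expW HW).
- move=> x _; rewrite lee_fin expr0 mul1r expR_le1 mulr_le0_ge0//.
  by rewrite mulr_ge0_le0 ?invr_le0 ?ltW.
Qed.

(** Only parameters [t <= c] count, so the slope is at most [c]. Hence a big jump of [W] is never
    cheaper than a tilt when the mass below it is 1. *)
Lemma legendre_shift w s : (0 <= w)%R -> Lst (w + s) <= c * w%:E + Lst s.
Proof.
move=> w0; have cw0 : 0 <= c * w%:E by rewrite mule_ge0 ?lee_fin// ltW.
apply: ge_ereal_sup => _ [t _ <-].
have [tc|ct] := leP t%:E c; last by rewrite log_laplace_infty// leNye.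
rewrite mulrDr EFinD -addeA; apply: leeD; last exact: legendre_ge.
by rewrite EFinM lee_wpmul2r.
Qed.

Lemma legendre_lsc a x : x%:E < Lst a -> exists e : R, (0 < e)%R /\
  forall b, (`|b - a| < e)%R -> x%:E < Lst b.
Proof.
move=> /ereal_sup_gt[_ [t _ <-]].
have := log_laplace_ge t; case: (L t) (@legendre_ge t) => [l| |]//= H _.
rewrite -EFinB lte_fin => xl; set g := (t * a - l - x)%R.
have g0 : (0 < g)%R by rewrite /g; lra.
exists (g / (`|t| + 1))%R; split; first by rewrite divr_gt0// ltr_wpDl.
move=> b; rewrite ltr_pdivlMr; last by rewrite ltr_wpDl.
move=> ab; apply: lt_le_trans (H b); rewrite -EFinB lte_fin.
have h1 : (`|t * (b - a)| < g)%R.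
  rewrite normrM mulrC; apply: le_lt_trans ab; rewrite ler_wpM2l//.
  by rewrite lerDl.
by move: h1; rewrite ltr_norml /g => /andP[h1 _]; lra.
Qed.

(** Convexity, together with the value 0 at 0. It bounds what is lost when a parameter is divided by
    [p] to become admissible. *)
Lemma cumulant_scale t p : (1 <= p)%R -> (t / p)%:E < c ->
  (p * cumulant (t / p))%:E <= L t.
Proof.
move=> p1 tc; apply: le_trans (log_laplace_tangent t tc).
have := cumulant_tangent tc c0; rewrite cumulant0 lee_fin.
have p0 : (0 < p)%R by apply: lt_le_trans p1.
set t' := (t / p)%R; have -> : t = (p * t')%R by rewrite /t' mulrC divfK ?gt_eqF.
by move=> h; nra.
Qed.

(** The infimal convolution of [w z |-> c w] with the Legendre transform is dual to the supremum
    restricted to [t <= c / z]. An explicit minimizer replaces a minimax theorem: either [w = 0], or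
    [s] is the tilted mean at the end point [c / z]. *)
Lemma legendre_duality z a (y : R) : (1 <= z)%R -> (1 < a)%R -> (0 <= y)%R ->
  (forall t, (0 <= t)%R -> (t * z)%:E <= c -> (t * a)%:E - L t <= y%:E) ->
  exists w s, [/\ (0 <= w)%R, (0 <= s)%R, (w * z + s = a)%R &
    c * w%:E + Lst s <= y%:E].
Proof.
move=> z1 a1 y0 H.
have W0case : (forall t, t%:E <= c -> (0 < t)%R -> (t * a)%:E - L t <= y%:E) ->
  exists w s, [/\ (0 <= w)%R, (0 <= s)%R, (w * z + s = a)%R &
    c * w%:E + Lst s <= y%:E].
  move=> H'; exists 0%R, a; split => //; first by lra.
    by rewrite mul0r add0r.
  rewrite mule0 add0e; apply: legendre_le; first by rewrite lee_fin.
  by move=> t tc at0; apply: H' => //; nra.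
have [/eqP z_eq1|zn1] := boolP (z == 1%R).
  by apply: W0case => t tc t0; apply: H; [exact: ltW|rewrite z_eq1 mulr1].
have [E|[r E]] : c = +oo \/ exists r : R, c = r%:E.
- by case: (c) c0 => [r| |]// _; [right; exists r|left].
- by apply: W0case => t _ t0; apply: H; [exact: ltW|rewrite E leey].
have r0 : (0 < r)%R by rewrite -lte_fin -E.
have z0 : (0 < z)%R by apply: lt_le_trans z1.
(* The end point of the admissible parameters; it lies strictly below [c] because [z > 1], so the
   tilt by [t0] has finite moments. *)
pose t0 := (r / z)%R.
have t00 : (0 < t0)%R by rewrite divr_gt0.
have tr : (t0 < r)%R by rewrite ltr_pdivrMr// ltr_pMr// lt_neqAle eq_sym zn1.
have t0c : t0%:E < c by rewrite E lte_fin.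
have Ht0 : (t0 * a - cumulant t0 <= y)%R.
  rewrite -lee_fin EFinB -log_laplace_fin//; apply: H; first exact: ltW.
  by rewrite E lee_fin /t0 divfK// gt_eqF.
have [sa|sa] := leP (tilted_mean t0) a.
  exists ((a - tilted_mean t0) / z)%R, (tilted_mean t0); split.
  - by rewrite divr_ge0 ?subr_ge0// ltW.
  - exact: tilt_ge0.
  - by rewrite divfK ?gt_eqF// subrK.
  rewrite E -EFinM; apply: (@le_trans _ _ ((r * ((a - tilted_mean t0) / z))%:E +
      (t0 * tilted_mean t0 - cumulant t0)%:E)); last first.
    by rewrite -EFinD lee_fin; apply: le_trans Ht0; rewrite /t0; lra.
  apply: leeD2l; apply: ge_ereal_sup => _ [t _ <-].
  apply: (@le_trans _ _ ((t * tilted_mean t0)%:E - (cumulant t0 + (t - t0) * tilted_mean t0)%:E)).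
    by apply: leeB => //; exact: log_laplace_tangent.
  by rewrite -EFinB lee_fin; lra.
apply: W0case => t tc tp; have [tt0|t0t] := leP t t0.
  apply: H; first exact: ltW.
  by rewrite E lee_fin (le_trans (ler_wpM2r (ltW z0) tt0))// /t0 divfK// gt_eqF.
apply: (@le_trans _ _ ((t * a)%:E - (cumulant t0 + (t - t0) * tilted_mean t0)%:E)).
  by apply: leeB => //; exact: log_laplace_tangent.
rewrite -EFinB lee_fin; apply: le_trans Ht0; nra.
Qed.

Lemma tilt_ivt a b s : (a <= b)%R -> b%:E < c -> (tilted_mean a <= s)%R -> (s <= tilted_mean b)%R ->
  exists t, (a <= t <= b)%R /\ tilted_mean t = s.
Proof.
move=> ab bc sa sb.
have ac : a%:E < c by apply: le_lt_trans bc; rewrite lee_fin.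
have m1b := moment_ge0 HW 1 b; have m2b := moment_ge0 HW 2 b.
(* The equation [tilted_mean t = s] is multiplied by [M t]: no quotient is left, and both terms are
   Lipschitz on [[a, b]]. *)
have hlip t u : (a <= t)%R -> (t <= u)%R -> (u <= b)%R ->
    (`|(moment P W 1 u - s * M u) - (moment P W 1 t - s * M t)| <=
     (moment P W 2 b + `|s| * moment P W 1 b + 1) * (u - t))%R.
  move=> at' tu ub; have uc : u%:E < c by apply: le_lt_trans bc; rewrite lee_fin.
  apply: lipschitz_difference.
  - by rewrite subr_ge0.
  - by rewrite subr_ge0 (moment_le HW 1 tu uc).
  - by rewrite subr_ge0 (moment_le HW 0 tu uc).
  - apply: (le_trans (moment_lipschitz HW 1 tu uc)).
    by rewrite ler_wpM2l ?subr_ge0// (moment_le HW 2 ub bc).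
  - apply: (le_trans (moment_lipschitz HW 0 tu uc)).
    by rewrite ler_wpM2l ?subr_ge0// (moment_le HW 1 ub bc).
have [|||t [tab ht]] := lipschitz_ivt ab _ hlip.
- by rewrite ltr_wpDl// addr_ge0// mulr_ge0.
- by rewrite subr_le0 -ler_pdivrMr ?moment_gt0.
- by rewrite subr_ge0 -ler_pdivlMr ?moment_gt0.
have /andP[_ tb] := tab.
have tc : t%:E < c by apply: le_lt_trans bc; rewrite lee_fin.
exists t; split => //.
rewrite /tilted_mean; have /eqP -> : moment P W 1 t == (s * M t)%R by rewrite -subr_eq0; apply/eqP.
by rewrite mulfK ?gt_eqF ?moment_gt0.
Qed.

End legendre_transform.

(** * The rate function of the recursion *)

Section rate.
Context (R : realType) d (T : measurableType d) (P : probability T R).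
Context (W : T -> R) (c : \bar R).
Hypothesis HW : cascade_weight P W c.

Let c0 := weight_gt0 HW.

Local Notation Lst := (legendre (log_laplace P W)).

(* Starting the recursion at the mass 1 of height 0 makes the case n = 1 of
   the theorem an instance of the inductive step. *)
Fixpoint cascade_rate (n : nat) : R -> \bar R :=
  match n with
  | 0 => fun a => if a == 1%R then 0 else +oo
  | m.+1 => fun a =>
      ereal_inf [set y | exists w z s : R,
        [/\ (0 <= w)%R, (0 <= z)%R, (0 <= s)%R, (w * z + s = a)%R &
            y = c * w%:E + cascade_rate m z + Lst s]]
  end.

Let cw_ge0 (w : R) : (0 <= w)%R -> 0 <= c * w%:E.
Proof. by move=> w0; rewrite mule_ge0 ?lee_fin// ltW. Qed.

Lemma cascade_rate_ge0 n a : 0 <= cascade_rate n a.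
Proof.
elim: n a => [|n ih] a /=; first by case: ifP => // _; rewrite leey.
apply: le_ereal_inf_tmp => _ [w [z [s [w0 z0 s0 _ ->]]]].
by rewrite adde_ge0 ?(legendre_ge0 HW)// adde_ge0 ?cw_ge0.
Qed.

Lemma cascade_rateS_le n a w z s : (0 <= w)%R -> (0 <= z)%R -> (0 <= s)%R ->
  (w * z + s = a)%R ->
  cascade_rate n.+1 a <= c * w%:E + cascade_rate n z + Lst s.
Proof. by move=> w0 z0 s0 E; apply: ereal_inf_lbound; exists w, z, s. Qed.

Lemma cascade_rate1 n : cascade_rate n 1 = 0.
Proof.
elim: n => [|n ih]; first by rewrite /= eqxx.
apply/eqP; rewrite eq_le cascade_rate_ge0 andbT.
have := @cascade_rateS_le n 1%R 0%R 1%R 1%R; rewrite mul0r add0r.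
by rewrite ih (legendre1 HW) mule0 !adde0; apply.
Qed.

Lemma cascade_rate_first a : cascade_rate 1 a = Lst a.
Proof.
apply/eqP; rewrite eq_le; apply/andP; split.
  have [a0|a0] := ltP a 0%R; first by rewrite (legendre_neg HW a0) leey.
  have := @cascade_rateS_le 0 a 0%R 1%R a; rewrite mul0r add0r /= eqxx mule0 !add0e.
  by apply.
apply: le_ereal_inf_tmp => _ [w [z [s [w0 z0 s0 <- ->]]]] /=.
case: eqP => [->|_].
  by rewrite mulr1 adde0 (legendre_shift HW).
rewrite addey ?addye ?leey//.
  by rewrite gt_eqF// (lt_le_trans _ (legendre_ge0 HW _))// ltNy0.
by rewrite gt_eqF// (lt_le_trans _ (cw_ge0 w0))// ltNy0.
Qed.

Lemma large_rateE n : large_rate c Lst n.+1 = cascade_rate n.+1.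
Proof.
elim: n => [|n ih]; first by apply/funext => a; rewrite cascade_rate_first.
(* Naming the step as a functional of the previous rate lets the induction hypothesis, an equality
   of functions, be rewritten inside the infimum. *)
pose F (I : R -> \bar R) (a : R) := ereal_inf [set y | exists w z s : R,
  [/\ (0 <= w)%R, (0 <= z)%R, (0 <= s)%R, (w * z + s = a)%R &
      y = c * w%:E + I z + Lst s]].
by rewrite -[LHS]/(F (large_rate c Lst n.+1)) ih.
Qed.

(** A jump is useless below the mean: it forces [s <= a <= 1], where the Legendre transform is
    nonincreasing. *)
Lemma cascade_rate_le1 n a : (a <= 1)%R -> cascade_rate n.+1 a = Lst a.
Proof.
move=> a1; apply/eqP; rewrite eq_le; apply/andP; split.
  have [a0|a0] := ltP a 0%R; first by rewrite (legendre_neg HW a0) leey.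
  have := @cascade_rateS_le n a 0%R 1%R a; rewrite mul0r add0r cascade_rate1 mule0 !add0e.
  by apply.
apply: le_ereal_inf_tmp => _ [w [z [s [w0 z0 s0 E ->]]]].
apply: (@le_trans _ _ (Lst s)); last first.
  by rewrite leeDr// adde_ge0 ?cw_ge0// cascade_rate_ge0.
by apply: (legendre_nonincreasing HW) => //; rewrite -E lerDr mulr_ge0.
Qed.

Lemma cascade_rate_nondecreasing n a b : (1 <= a)%R -> (a <= b)%R ->
  cascade_rate n a <= cascade_rate n b.
Proof.
move=> a1 ab; case: n => [|n].
  rewrite /=; case: (eqVneq b 1%R) => [b1|_]; last by rewrite leey.
  by rewrite (_ : a = 1%R) ?eqxx//; apply/eqP; rewrite eq_le a1 -b1 ab.
apply: le_ereal_inf_tmp => _ [w [z [s [w0 z0 s0 E ->]]]].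
have [as_|sa] := leP a s.
  apply: (@le_trans _ _ (c * 0%:E + cascade_rate n 1 + Lst a)).
    by apply: cascade_rateS_le; rewrite ?mul0r ?add0r//; lra.
  rewrite cascade_rate1 mule0 !add0e.
  apply: (@le_trans _ _ (Lst s)); first exact: (legendre_nondecreasing HW).
  by rewrite leeDr// adde_ge0 ?cw_ge0// cascade_rate_ge0.
have bs : (0 < b - s)%R by lra.
(* Shrinking the jump by [q <= 1] turns a decomposition of [b] into one of [a] with the same [z] and
   [s], at a lower cost. *)
pose q := ((a - s) / (b - s))%R.
have q0 : (0 <= q)%R by rewrite divr_ge0; lra.
have q1 : (q <= 1)%R by rewrite ler_pdivrMr//; lra.
apply: (@le_trans _ _ (c * (w * q)%:E + cascade_rate n z + Lst s)).
  apply: cascade_rateS_le => //; first by rewrite mulr_ge0.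
  rewrite mulrAC (_ : w * z = b - s)%R; last by lra.
  by rewrite /q mulrC divfK ?gt_eqF// subrK.
apply: leeD => //; apply: leeD => //; apply: lee_wpmul2l; first exact: ltW.
by rewrite lee_fin ler_piMr.
Qed.

Lemma cascade_rate_max1 n z : cascade_rate n (Num.max z 1%R) <= cascade_rate n z.
Proof.
have [z1|z1] := leP z 1%R; last by [].
by rewrite cascade_rate1 cascade_rate_ge0.
Qed.

(** For finite [c] the rate grows with slope at most [c]: the excess [h] is added to the jump.
    Raising [z] to at least 1 costs nothing and ensures that [w] grows by at most [h]. *)
Lemma cascade_rate_shift n a h r : c = r%:E -> (0 <= h)%R ->
  cascade_rate n.+1 (a + h) <= cascade_rate n.+1 a + (r * h)%:E.
Proof.
move=> cr h0; rewrite -leeBlDr//.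
apply: le_ereal_inf_tmp => _ [w [z [s [w0 z0 s0 E ->]]]].
rewrite -/(cascade_rate n) leeBlDr//.
pose z' := Num.max z 1%R.
have z'1 : (1 <= z')%R by rewrite le_max lexx orbT.
have zz' : (z <= z')%R by rewrite le_max lexx.
have z'0 : (0 < z')%R by apply: lt_le_trans z'1.
pose w' := ((w * z + h) / z')%R.
have w'0 : (0 <= w')%R by rewrite divr_ge0 ?addr_ge0 ?mulr_ge0// ltW.
have w'w : (w' <= w + h)%R by rewrite ler_pdivrMr//; nra.
apply: (@le_trans _ _ (c * w'%:E + cascade_rate n z' + Lst s)).
  apply: cascade_rateS_le => //; first exact: ltW.
  by rewrite /w' divfK ?gt_eqF//; lra.
apply: (@le_trans _ _ (c * (w + h)%:E + cascade_rate n z + Lst s)).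
  apply: leeD => //; apply: leeD; last exact: cascade_rate_max1.
  by apply: lee_wpmul2l; [exact: ltW|rewrite lee_fin].
rewrite cr -!EFinM mulrDr EFinD -!addeA leeD2l//.
by rewrite addeC -addeA.
Qed.

Lemma cascade_rate_pinfty n a : c = +oo -> cascade_rate n.+1 a = Lst a.
Proof.
move=> cy; apply/eqP; rewrite eq_le; apply/andP; split.
  have [a0|a0] := ltP a 0%R; first by rewrite (legendre_neg HW a0) leey.
  have := @cascade_rateS_le n a 0%R 1%R a; rewrite mul0r add0r cascade_rate1 mule0 !add0e.
  by apply.
apply: le_ereal_inf_tmp => _ [w [z [s [w0 z0 s0 <- ->]]]].
rewrite -/(cascade_rate n); have [->|wn0] := eqVneq w 0%R.
  by rewrite mul0r add0r leeDr// mule0 add0e cascade_rate_ge0.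
have {wn0} w0' : (0 < w)%R by rewrite lt_neqAle eq_sym wn0.
rewrite cy gt0_mulye ?lte_fin// addye ?addye ?leey//.
  by rewrite gt_eqF// (lt_le_trans _ (legendre_ge0 HW _))// ltNy0.
by rewrite gt_eqF// (lt_le_trans _ (cascade_rate_ge0 _ _))// ltNy0.
Qed.

(** For finite [c] the bound on the slope suffices. For [c = +oo] the rate may jump to infinity, but
    it is then the Legendre transform, a supremum of affine functions. *)
Lemma cascade_rate_lsc n a x : (1 < a)%R -> x%:E < cascade_rate n.+1 a ->
  exists b, [/\ (1 <= b)%R, (b < a)%R & x%:E < cascade_rate n.+1 b].
Proof.
move=> a1 xa.
have [cy|[r cr]] : c = +oo \/ exists r : R, c = r%:E.
  by case: (c) c0 => [r| |]// _; [right; exists r|left].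
  rewrite cascade_rate_pinfty// in xa.
  have [e [e0 He]] := legendre_lsc HW xa.
  exists (Num.max 1 (a - e / 2))%R; split; first by rewrite le_max lexx.
    by rewrite gt_max a1/=; lra.
  rewrite cascade_rate_pinfty//; apply: He.
  by rewrite ltr_norml; have [h|h] := leP 1%R (a - e / 2)%R; apply/andP; split; lra.
have r0 : (0 < r)%R by rewrite -lte_fin -cr.
have [x' [xx' Hx']] := real_between xa.
pose h := (Num.min (a - 1) ((x' - x) / r))%R.
have h0 : (0 < h)%R by rewrite lt_min subr_gt0 a1 divr_gt0// subr_gt0.
have h1 : (h <= a - 1)%R by rewrite ge_min lexx.
have rh : (r * h <= x' - x)%R.
  by rewrite mulrC -ler_pdivlMr// ge_min lexx orbT.
exists (a - h)%R; split; [lra|lra|].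
have := @cascade_rate_shift n (a - h) h r cr (ltW h0); rewrite subrK => H.
have := lt_le_trans Hx' H; rewrite -lteBlDr//; apply: le_lt_trans.
by rewrite -EFinB lee_fin; lra.
Qed.

Lemma cascade_rate_duality n z a (y : R) : (1 <= z)%R -> (1 < a)%R -> (0 <= y)%R ->
  (forall t, (0 <= t)%R -> (t * z)%:E <= c ->
     (t * a)%:E - log_laplace P W t <= y%:E) ->
  cascade_rate n.+1 a <= cascade_rate n z + y%:E.
Proof.
move=> z1 a1 y0 /(legendre_duality HW z1 a1 y0)[w [s [w0 s0 E H]]].
apply: (@le_trans _ _ (c * w%:E + cascade_rate n z + Lst s)).
  by apply: cascade_rateS_le => //; lra.
by rewrite (addeC (c * _)) -addeA; apply: leeD.
Qed.

(** If [z < 2] and [s < (1 + a) / 2], then [w >= (a - 1) / 4]; each of the three ways to reach [a]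
    has a positive cost. A real bound is produced since the rate may be infinite. *)
Lemma cascade_rate_gt0 n a : (1 < a)%R -> exists k : R, (0 < k)%R /\ k%:E <= cascade_rate n a.
Proof.
have pos (y : \bar R) : 0 < y -> exists k : R, (0 < k)%R /\ k%:E <= y.
  case: y => [r| |]//; first by rewrite lte_fin => r0; exists r.
  by exists 1%R; rewrite leey.
elim: n a => [|n ih] a a1; first by exists 1%R; rewrite /= gt_eqF// leey.
have [k1 [k10 H1]] := ih 2%R (ltr1n _ 2).
have [k2 [k20 H2]] : exists k : R, (0 < k)%R /\ k%:E <= Lst ((1 + a) / 2)%R.
  by apply/pos/(legendre_gt0 HW)/eqP => h; lra.
have [k3 [k30 H3]] : exists k : R, (0 < k)%R /\ k%:E <= c * ((a - 1) / 4)%R%:E.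
  by apply/pos; rewrite mule_gt0// lte_fin; lra.
exists (Num.min k1 (Num.min k2 k3)); split; first by rewrite !lt_min k10 k20.
apply: le_ereal_inf_tmp => _ [w [z [s [w0 z0 s0 E ->]]]].
have [z2|z2] := leP 2%R z.
  apply: (@le_trans _ _ (cascade_rate n z)).
    apply: (@le_trans _ _ k1%:E); first by rewrite lee_fin ge_min lexx.
    by apply: (le_trans H1); apply: cascade_rate_nondecreasing => //; lra.
  by rewrite addeAC leeDr// adde_ge0 ?cw_ge0// (legendre_ge0 HW).
have [sa|sa] := leP ((1 + a) / 2)%R s.
  apply: (@le_trans _ _ (Lst s)).
    apply: (@le_trans _ _ k2%:E); first by rewrite lee_fin !ge_min lexx orbT.
    by apply: (le_trans H2); apply: (legendre_nondecreasing HW) => //; lra.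
  by rewrite leeDr// adde_ge0 ?cw_ge0// cascade_rate_ge0.
apply: (@le_trans _ _ (c * w%:E)).
  apply: (@le_trans _ _ k3%:E); first by rewrite lee_fin !ge_min lexx !orbT.
  apply: (le_trans H3); apply: lee_wpmul2l; first exact: ltW.
  by rewrite lee_fin; nra.
by rewrite -addeA leeDl// adde_ge0 ?cascade_rate_ge0 ?(legendre_ge0 HW).
Qed.

Lemma cascade_rate_infty n (x : R) : exists A : R, (1 < A)%R /\ x%:E <= cascade_rate n A.
Proof.
elim: n x => [|n ih] x; first by exists 2%R; rewrite /= gt_eqF ?leey ?ltr1n.
have [A1 [A11 H1]] := ih x.
have [b [b0 bc]] := weight_between HW.
have kb0 : (0 <= cumulant P W b)%R by apply: le_trans (cumulant_ge HW bc); exact: ltW.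
pose x' := (Num.max x 0)%R.
have x'0 : (0 <= x')%R by rewrite le_max lexx orbT.
have xx' : (x <= x')%R by rewrite le_max lexx.
pose S := ((x' + cumulant P W b) / b + 1)%R.
have S1 : (1 <= S)%R by rewrite lerDr divr_ge0 ?addr_ge0// ltW.
have HS : x%:E <= Lst S.
  apply: le_trans (legendre_ge_cumulant HW S bc); rewrite lee_fin /S mulrDr mulr1.
  by rewrite mulrC divfK ?gt_eqF//; lra.
pose B := (x' / b)%R.
have B0 : (0 <= B)%R by rewrite divr_ge0// ltW.
(* A decomposition of this value has [z >= A1], [s >= S] or [w >= B], and each of these costs at
   least [x]. *)
exists (S + B * A1 + 1)%R; split; first by nra.
apply: le_ereal_inf_tmp => _ [w [z [s [w0 z0 s0 E ->]]]].
have [zA|zA] := leP A1 z.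
  apply: (@le_trans _ _ (cascade_rate n z)).
    by apply: (le_trans H1); apply: cascade_rate_nondecreasing => //; exact: ltW.
  by rewrite addeAC leeDr// adde_ge0 ?cw_ge0// (legendre_ge0 HW).
have [sS|sS] := leP S s.
  apply: (@le_trans _ _ (Lst s)).
    by apply: (le_trans HS); apply: (legendre_nondecreasing HW).
  by rewrite leeDr// adde_ge0 ?cw_ge0// cascade_rate_ge0.
have wB : (B <= w)%R by nra.
apply: (@le_trans _ _ (c * w%:E)); last first.
  by rewrite -addeA leeDl// adde_ge0 ?cascade_rate_ge0 ?(legendre_ge0 HW).
apply: (@le_trans _ _ (b%:E * w%:E)); last by apply: lee_wpmul2r; rewrite ?lee_fin// ltW.
rewrite -EFinM lee_fin; apply: (le_trans xx'); rewrite mulrC -ler_pdivrMr//.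
Qed.

End rate.

(** * Large deviation principles from tails and local lower bounds *)

Section large_deviation_criterion.
Context (R : realType) d (T : measurableType d) (P : probability T R).

Lemma ereal_between (x y : \bar R) : x < y -> exists z : R, x < z%:E /\ z%:E < y.
Proof.
case: x => [x| |]; case: y => [y| |]//.
- by rewrite lte_fin => xy; exists ((x + y) / 2)%R; rewrite !lte_fin; lra.
- by move=> _; exists (x + 1)%R; rewrite lte_fin ltry; lra.
- by move=> _; exists (y - 1)%R; rewrite lte_fin ltNyr; lra.
- by move=> _; exists 0%R; rewrite ltNyr ltry.
Qed.

Lemma limn_esup_le_near (u : nat -> \bar R) (y : \bar R) :
  (\forall r \near \oo, u r <= y) -> limn_esup u <= y.
Proof.
move=> h; apply: (@le_trans _ _ (ereal_sup (u @` [set r | u r <= y]))).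
  by apply: ereal_inf_lbound; exists [set r | u r <= y].
by apply: ge_ereal_sup => _ [r ur <-].
Qed.

Lemma limn_einf_ge_near (u : nat -> \bar R) (y : \bar R) :
  (\forall r \near \oo, y <= u r) -> y <= limn_einf u.
Proof.
move=> h; rewrite /limn_einf leeNr; apply: limn_esup_le_near.
by apply: filterS h => r; rewrite leeN2.
Qed.

Lemma closed_inf_mem (S : set R) (m : R) : closed S -> (exists y, S y /\ (m <= y)%R) ->
  ~ S m -> exists a, [/\ S a, (m < a)%R & forall y, S y -> (m <= y)%R -> (a <= y)%R].
Proof.
move=> cS [y0 [Sy0 my0]] Sm.
pose A := [set y | S y /\ (m <= y)%R].
have A0 : has_inf A by split; [exists y0|exists m => y []].
have lb y : A y -> (inf A <= y)%R by move=> Ay; apply: inf_lbound => //; case: A0.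
have mA : (m <= inf A)%R by apply: lb_le_inf; [exists y0|move=> y []].
have SA : S (inf A).
  apply: contrapT => nS.
  have : nbhs (inf A) (~` S).
    by apply: open_nbhs_nbhs; split => //; exact: closed_openC.
  move=> /nbhs_ballP[e /= e0 eS].
  have [y [Sy my] yA] := inf_adherent e0 A0.
  apply: (eS y) => //=; rewrite /ball /= distrC ger0_norm ?subr_ge0; last exact: lb.
  by rewrite ltrBlDl.
exists (inf A); split => //; last by move=> y Sy my; apply: lb.
by rewrite lt_neqAle mA andbT; apply: contra_notN Sm => /eqP ->.
Qed.

Lemma closed_sup_mem (S : set R) (m : R) : closed S -> (exists y, S y /\ (y <= m)%R) ->
  ~ S m -> exists a, [/\ S a, (a < m)%R & forall y, S y -> (y <= m)%R -> (y <= a)%R].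
Proof.
move=> cS [y0 [Sy0 my0]] Sm.
have cS' : closed ((fun y : R => - y)%R @^-1` S).
  by apply: closed_comp => // y _; exact: opp_continuous.
have [||a [Sa ma Ha]] := closed_inf_mem (m := (- m)%R) cS'.
- by exists (- y0)%R; rewrite /= opprK lerN2.
- by rewrite /= opprK.
exists (- a)%R; split => //; first by rewrite ltrNl.
by move=> y Sy my; rewrite lerNr; apply: Ha; rewrite /= ?opprK// lerN2.
Qed.

Context (Y : nat -> T -> R) (v : nat -> R) (I : R -> \bar R) (m : R).
Hypothesis mY : forall r, (2 <= r)%N -> measurable_fun setT (Y r).
Hypothesis vy : v r @[r --> \oo] --> +oo%R.
Hypothesis I0 : forall a, 0 <= I a.
Hypothesis Im : I m = 0.
Hypothesis I_right : forall a b, (m <= a)%R -> (a <= b)%R -> I a <= I b.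
Hypothesis I_left : forall a b, (a <= b)%R -> (b <= m)%R -> I b <= I a.
Hypothesis I_lscr : forall a x, (m < a)%R -> x%:E < I a ->
  exists b, [/\ (m <= b)%R, (b < a)%R & x%:E < I b].
Hypothesis I_lscl : forall a x, (a < m)%R -> x%:E < I a ->
  exists b, [/\ (b <= m)%R, (a < b)%R & x%:E < I b].
Hypothesis upper : forall a x, (m < a)%R -> x%:E < I a ->
  \forall r \near \oo, P [set x | (a <= Y r x)%R] <= (expR (- (v r * x)))%:E.
Hypothesis lower : forall a x, (a < m)%R -> x%:E < I a ->
  \forall r \near \oo, P [set x | (Y r x <= a)%R] <= (expR (- (v r * x)))%:E.
Hypothesis local_bound : forall a x e, (0 < e)%R -> I a < x%:E ->
  \forall r \near \oo, (expR (- (v r * x)))%:E <= P [set x | (`|Y r x - a| < e)%R].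

Let v_gt A : \forall r \near \oo, (A < v r)%R.
Proof. by move/cvgryPgt: vy; apply. Qed.

(** By monotonicity, one point nearer to [m] where the rate still exceeds [x] bounds it on a whole
    neighbourhood. *)
Let lsc_I : lower_semicontinuous I.
Proof.
move=> a x xa; have [am|ma|am] := ltgtP a m.
- have [b [bm ab xb]] := I_lscl am xa.
  exists [set y | (y < b)%R].
    by apply: open_nbhs_nbhs; split; [exact: open_lt|].
  by move=> y /= yb; apply: (lt_le_trans xb); apply: I_left => //; exact: ltW.
- have [b [bm ab xb]] := I_lscr ma xa.
  exists [set y | (b < y)%R].
    by apply: open_nbhs_nbhs; split; [exact: open_gt|].
  by move=> y /= yb; apply: (lt_le_trans xb); apply: I_right => //; exact: ltW.
- rewrite am Im in xa; exists setT; first exact: filterT.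
  by move=> y _; apply: (lt_le_trans xa).
Qed.

Let scaled_le r x (p : \bar R) : (0 < v r)%R -> 0 <= p -> p <= (expR (- (v r * x)))%:E ->
  ((v r)^-1)%:E * lne p <= (- x)%:E.
Proof.
move=> v0 p0 h; rewrite muleC lee_pdivrMr// lne_le_expR//.
by rewrite mulNr mulrC.
Qed.

Let scaled_ge r x (p : \bar R) : (0 < v r)%R -> 0 <= p -> (expR (- (v r * x)))%:E <= p ->
  (- x)%:E <= ((v r)^-1)%:E * lne p.
Proof.
move=> v0 p0 h; rewrite muleC lee_pdivlMr// lne_ge_expR//.
by rewrite mulNr mulrC.
Qed.

Let measurable_preimage r A : (2 <= r)%N -> measurable A -> measurable (Y r @^-1` A).
Proof. by move=> r2 mA; rewrite -[X in measurable X]setTI; exact: mY. Qed.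

Let measurable_ge a : measurable [set y : R | (a <= y)%R].
Proof.
rewrite (_ : [set y | _] = `[a, +oo[%classic) //.
by apply/seteqP; split => y /=; rewrite in_itv/= andbT.
Qed.

Let measurable_le a : measurable [set y : R | (y <= a)%R].
Proof.
by rewrite (_ : [set y | _] = `]-oo, a]%classic).
Qed.

(** The part of [F] on the right of [m] lies beyond its smallest point [a]; as [F] is closed, [a]
    belongs to it and [I a] is at least the infimum over [F]. *)
Let upper_side (F : set R) x : closed F -> ~ F m -> x%:E < ereal_inf (I @` F) ->
  \forall r \near \oo, P (Y r @^-1` [set y | F y /\ (m <= y)%R]) <= (expR (- (v r * x)))%:E.
Proof.
move=> cF Fm xF.
have [Fr|Fr] := pselect (exists y, F y /\ (m <= y)%R); last first.
  near=> r; rewrite (_ : _ @^-1` _ = set0) ?measure0 ?lee_fin ?expR_ge0//.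
  by apply/seteqP; split => // t /= ?; apply: Fr; exists (Y r t).
have [a [Fa ma Ha]] := closed_inf_mem cF Fr Fm.
have xa : x%:E < I a by apply: lt_le_trans xF _; apply: ereal_inf_lbound; exists a.
near=> r; have r2 : (2 <= r)%N by near: r; exact: nbhs_infty_ge.
have : P [set x | (a <= Y r x)%R] <= (expR (- (v r * x)))%:E.
  by near: r; exact: upper.
apply: le_trans; apply: le_measure; rewrite ?inE.
- by apply: measurable_preimage => //; apply: measurableI;
    [exact: closed_measurable|exact: measurable_ge].
- by apply: (measurable_preimage r2 (A := [set y | (a <= y)%R])); exact: measurable_ge.
- by move=> y /= [Fy my]; exact: Ha.
Unshelve. all: by end_near.
Qed.

Let lower_side (F : set R) x : closed F -> ~ F m -> x%:E < ereal_inf (I @` F) ->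
  \forall r \near \oo, P (Y r @^-1` [set y | F y /\ (y <= m)%R]) <= (expR (- (v r * x)))%:E.
Proof.
move=> cF Fm xF.
have [Fr|Fr] := pselect (exists y, F y /\ (y <= m)%R); last first.
  near=> r; rewrite (_ : _ @^-1` _ = set0) ?measure0 ?lee_fin ?expR_ge0//.
  by apply/seteqP; split => // t /= ?; apply: Fr; exists (Y r t).
have [a [Fa ma Ha]] := closed_sup_mem cF Fr Fm.
have xa : x%:E < I a by apply: lt_le_trans xF _; apply: ereal_inf_lbound; exists a.
near=> r; have r2 : (2 <= r)%N by near: r; exact: nbhs_infty_ge.
have : P [set x | (Y r x <= a)%R] <= (expR (- (v r * x)))%:E.
  by near: r; exact: lower.
apply: le_trans; apply: le_measure; rewrite ?inE.
- by apply: measurable_preimage => //; apply: measurableI;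
    [exact: closed_measurable|exact: measurable_le].
- by apply: (measurable_preimage r2 (A := [set y | (y <= a)%R])); exact: measurable_le.
- by move=> y /= [Fy my]; exact: Ha.
Unshelve. all: by end_near.
Qed.

Lemma ldp_of_tails : large_deviation_principle P Y v I.
Proof.
split => //.
- move=> F cF; have [Fm|Fm] := pselect (F m).
    apply: (@le_trans _ _ 0); last first.
      have : ereal_inf (I @` F) <= 0 by apply: ereal_inf_lbound; exists m.
      by rewrite leeNr oppe0.
    apply: limn_esup_le_near; near=> r.
    have r2 : (2 <= r)%N by near: r; exact: nbhs_infty_ge.
    rewrite mule_ge0_le0 ?lee_fin ?invr_ge0//; first by rewrite ltW//; near: r.
    by rewrite lne_le0 probability_le1//; apply: measurable_preimage => //; exact: closed_measurable.
  rewrite leNgt; apply/negP => /ereal_between[z [z1 z2]].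
  rewrite lteNl -EFinN in z1.
  have [x [zx xF]] := real_between z1.
  suff : limn_esup (fun r => ((v r)^-1)%:E * lne (P (Y r @^-1` F))) <= z%:E.
    by rewrite leNgt z2.
  apply: limn_esup_le_near; near=> r.
  have r2 : (2 <= r)%N by near: r; exact: nbhs_infty_ge.
  have v0 : (0 < v r)%R by near: r; exact: v_gt.
  rewrite -(opprK z); apply: scaled_le => //.
  (* Each side of [m] contributes one term; the factor 2 is absorbed by the gap [x + z > 0] as [v r]
     grows. *)
  apply: (@le_trans _ _ ((expR (- (v r * x)))%:E + (expR (- (v r * x)))%:E)).
    apply: (@le_trans _ _ (P (Y r @^-1` [set y | F y /\ (m <= y)%R]) +
       P (Y r @^-1` [set y | F y /\ (y <= m)%R]))); last first.
      apply: leeD; first by near: r; exact: upper_side.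
      by near: r; exact: lower_side.
    apply: (@le_trans _ _ (P (Y r @^-1` [set y | F y /\ (m <= y)%R] `|`
       Y r @^-1` [set y | F y /\ (y <= m)%R]))).
      apply: le_measure; rewrite ?inE.
      - by apply: measurable_preimage => //; exact: closed_measurable.
      - by apply: measurableU; apply: measurable_preimage => //; apply: measurableI;
          [exact: closed_measurable|exact: measurable_ge|exact: closed_measurable|
           exact: measurable_le].
      - by move=> y /= Fy; case: (leP m (Y r y)) => [h|/ltW h]; [left|right].
    by apply: measureU2; apply: measurable_preimage => //; apply: measurableI;
      [exact: closed_measurable|exact: measurable_ge|exact: closed_measurable|
       exact: measurable_le].
  have -> : (- (v r * - z) = - (v r * x) + v r * (x + z))%R by ring.
  rewrite -EFinD lee_fin expRD -mulr2n -mulr_natr ler_wpM2l ?expR_ge0//.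
  have xz : (0 < x + z)%R by lra.
  have h1 : ((x + z)^-1 < v r)%R by near: r; exact: v_gt.
  apply: le_trans (expR_ge1Dx _).
  have : (1 <= v r * (x + z))%R by rewrite -ler_pdivrMr// mul1r ltW.
  lra.
- move=> G oG; rewrite leeNl; apply: le_ereal_inf_tmp => _ [a Ga <-].
  rewrite leNgt; apply/negP => /ereal_between[x [x1 x2]].
  have [e e0 eG] : exists2 e : R, (0 < e)%R & [set y | `|y - a| < e]%R `<=` G.
    have /nbhs_ballP[e /= e0 eG] : nbhs a G by exact: open_nbhs_nbhs.
    by exists e => // y /= ya; apply: eG; rewrite /ball /= distrC.
  suff : (- x)%:E <= limn_einf (fun r => ((v r)^-1)%:E * lne (P (Y r @^-1` G))).
    by rewrite leNgt EFinN lteNr x2.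
  apply: limn_einf_ge_near; near=> r.
  have r2 : (2 <= r)%N by near: r; exact: nbhs_infty_ge.
  have v0 : (0 < v r)%R by near: r; exact: v_gt.
  apply: scaled_ge => //.
  apply: (@le_trans _ _ (P [set x | (`|Y r x - a| < e)%R])).
    by near: r; exact: local_bound.
  apply: le_measure; rewrite ?inE.
  - apply: (measurable_preimage r2 (A := [set y | (`|y - a| < e)%R])).
    apply: open_measurable; rewrite (_ : [set y | _] = ball a e); first exact: ball_open.
    by apply/seteqP; split => y; rewrite /ball /= distrC.
  - by apply: measurable_preimage => //; exact: open_measurable.
  - by move=> y /= h; exact: eG.
Unshelve. all: by end_near.
Qed.

End large_deviation_criterion.

(** * Expectations of nonnegative functions *)

Section nonnegative_expectation.
Context (R : realType) d (T : measurableType d) (P : probability T R).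
Implicit Types f g : T -> R.

Lemma expectation_mono f g : measurable_fun setT f -> measurable_fun setT g ->
  (forall x, 0 <= f x)%R -> (forall x, f x <= g x)%R ->
  \int[P]_x (f x)%:E <= \int[P]_x (g x)%:E.
Proof.
move=> mf mg f0 fg; apply: ge0_le_integral => //.
- by move=> x _; rewrite lee_fin.
- exact/measurable_EFinP.
- exact/measurable_EFinP.
- by move=> x _; rewrite lee_fin.
Qed.

Lemma expectation_add f g : measurable_fun setT f -> measurable_fun setT g ->
  (forall x, 0 <= f x)%R -> (forall x, 0 <= g x)%R ->
  \int[P]_x (f x + g x)%:E = \int[P]_x (f x)%:E + \int[P]_x (g x)%:E.
Proof.
move=> mf mg f0 g0; under eq_integral do rewrite EFinD.
rewrite ge0_integralD//.
- by move=> x _; rewrite lee_fin.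
- exact/measurable_EFinP.
- by move=> x _; rewrite lee_fin.
- exact/measurable_EFinP.
Qed.

Lemma expectation_scale f k : measurable_fun setT f -> (0 <= k)%R ->
  (forall x, 0 <= f x)%R ->
  \int[P]_x (k * f x)%:E = k%:E * \int[P]_x (f x)%:E.
Proof.
move=> mf k0 f0; under eq_integral do rewrite EFinM.
rewrite ge0_integralZl//.
- exact/measurable_EFinP.
- by move=> x _; rewrite lee_fin.
Qed.

Lemma expectation_indic A : measurable A -> \int[P]_x (\1_A x)%:E = P A.
Proof. by move=> mA; rewrite integral_indic// setIT. Qed.

Lemma expectation_indic_comp f (A : set R) : measurable_fun setT f -> measurable A ->
  \int[P]_x (\1_A (f x))%:E = P (f @^-1` A).
Proof.
move=> mf mA; rewrite -expectation_indic; last first.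
  by rewrite -[X in measurable X]setTI; exact: mf.
by apply: eq_integral => x _; rewrite !indicE; congr (_%:R%:E); apply/idP/idP; rewrite !inE.
Qed.

Lemma probability_le_expectation A g : measurable A -> measurable_fun setT g ->
  (forall x, 0 <= g x)%R -> (forall x, A x -> 1 <= g x)%R ->
  P A <= \int[P]_x (g x)%:E.
Proof.
move=> mA mg g0 Ag; rewrite -expectation_indic//; apply: expectation_mono => // x.
by rewrite indicE; have [xA|] := boolP (x \in A) => //; apply: Ag; rewrite inE in xA.
Qed.

Lemma expectation_sum (J : Type) (s : seq J) (f : J -> T -> R) :
  (forall j, measurable_fun setT (f j)) -> (forall j x, 0 <= f j x)%R ->
  \int[P]_x (\sum_(j <- s) f j x)%:E = \sum_(j <- s) \int[P]_x (f j x)%:E.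
Proof.
move=> mf f0; elim: s => [|j s ih].
  by under eq_integral do rewrite big_nil; rewrite big_nil integral0.
under eq_integral do rewrite big_cons.
rewrite big_cons expectation_add// ?ih//.
- exact: measurable_sum.
- by move=> x; apply: sumr_ge0.
Qed.

Lemma measurable_preimage_fun f (A : set R) : measurable_fun setT f -> measurable A ->
  measurable (f @^-1` A).
Proof. by move=> mf mA; rewrite -[X in measurable X]setTI; exact: mf. Qed.

Lemma measurable_set_ge f a : measurable_fun setT f -> measurable [set x | (a <= f x)%R].
Proof.
move=> mf; rewrite (_ : [set x | _] = f @^-1` `[a, +oo[); first exact: measurable_preimage_fun.
by apply/seteqP; split => x /=; rewrite in_itv/= andbT.
Qed.

Lemma measurable_set_le f a : measurable_fun setT f -> measurable [set x | (f x <= a)%R].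
Proof.
move=> mf; rewrite (_ : [set x | _] = f @^-1` `]-oo, a]); first exact: measurable_preimage_fun.
by apply/seteqP; split => x /=; rewrite in_itv.
Qed.

Lemma measurable_set_oo f a b : measurable_fun setT f -> measurable [set x | (a < f x < b)%R].
Proof.
move=> mf; rewrite (_ : [set x | _] = f @^-1` `]a, b[); first exact: measurable_preimage_fun.
by apply/seteqP; split => x /=; rewrite in_itv.
Qed.

Lemma measurable_ball_set f a e : measurable_fun setT f ->
  measurable [set x | (`|f x - a| < e)%R].
Proof.
move=> mf; rewrite (_ : [set x | _] = f @^-1` ball a e).
  by apply: measurable_preimage_fun => //; apply: open_measurable; exact: ball_open.
by apply/seteqP; split => x; rewrite /ball /= distrC.
Qed.

Lemma measurable_far_set f a e : measurable_fun setT f ->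
  measurable [set x | (e <= `|f x - a|)%R].
Proof.
move=> mf; rewrite (_ : [set x | _] = ~` [set x | (`|f x - a| < e)%R]).
  by apply: measurableC; exact: measurable_ball_set.
by apply/seteqP; split => x /= h; [apply/negP; rewrite -leNgt|rewrite leNgt; apply/negP].
Qed.

End nonnegative_expectation.

Lemma lee_prod_real (R : realType) (J : Type) (s : seq J) (Q : pred J) (a : J -> \bar R)
    (E : R) : (forall j, Q j -> 0 <= a j <= E%:E) ->
  \prod_(j <- s | Q j) a j <= (\prod_(j <- s | Q j) E)%:E.
Proof.
move=> H; elim: s => [|j s ih]; first by rewrite !big_nil.
rewrite !big_cons; case: ifP => // Qj; have /andP[a0 aE] := H _ Qj.
rewrite EFinM; apply: lee_pmul => //.
by apply: prode_ge0 => k /H /andP[].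
Qed.

(** * Chernoff bounds and moments over one generation *)

Section one_level.
Context (R : realType) d (T : measurableType d) (P : probability T R).
Context (W : T -> R) (c : \bar R).
Hypothesis HW : cascade_weight P W c.
Context (r : nat) (V : seq 'I_r -> T -> R).
Hypothesis iidV : iid_family P W V.
Context (n : nat).

Let mW := weight_measurable HW.
Let W0 := weight_ge0 HW.
Let c0 := weight_gt0 HW.

Local Notation Wi i := (V [:: i]).
Local Notation Zi i := (mass (shift V i) n).

Let mWi i : measurable_fun setT (Wi i). Proof. by case: iidV. Qed.
Let Wi0 i x : (0 <= Wi i x)%R. Proof. by case: iidV. Qed.
Let mZi i : measurable_fun setT (Zi i). Proof. exact: (measurable_mass _ (iid_shift i iidV)). Qed.
Let Zi0 i x : (0 <= Zi i x)%R. Proof. exact: (mass_ge0 _ _ (iid_shift i iidV)). Qed.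

Definition offspring_sum (x : T) : R := (\sum_(i < r) Wi i x * Zi i x)%R.

Lemma measurable_offspring_sum : measurable_fun setT offspring_sum.
Proof. by apply: measurable_sum => i; apply: measurable_funM. Qed.

Let mpair (f : R -> R) (A : set R) : measurable_fun setT f -> measurable A ->
  measurable_fun setT (fun u : R * R => f (u.1 * u.2) * \1_A u.2)%R.
Proof.
move=> mf mA; apply: measurable_funM.
  by apply: measurableT_comp => //; apply: measurable_funM.
by apply: (measurableT_comp (measurable_indic mA)).
Qed.

Let mexp (t : R) : measurable_fun setT (fun y : R => expR (t * y)).
Proof. by apply: measurableT_comp => //; apply: measurable_funM. Qed.

Let mpairx i (f : R -> R) (A : set R) : measurable_fun setT f -> measurable A ->
  measurable_fun setT (fun x => f (Wi i x * Zi i x) * \1_A (Zi i x))%R.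
Proof.
move=> mf mA; apply: measurable_funM.
  by apply: measurableT_comp => //; apply: measurable_funM.
by apply: (measurableT_comp (measurable_indic mA)).
Qed.

Lemma expectation_root_exp i t : \int[P]_x (expR (t * Wi i x))%:E = emoment P W 0 t.
Proof.
rewrite (expectation_root iidV i mW (mexp t)); last by move=> y; exact: expR_ge0.
by apply: eq_integral => x _; rewrite expr0 mul1r.
Qed.

(** Replacing [Z_i] by its upper bound [z] in the exponent leaves a function of [W_i] times a
    function of [Z_i], which are independent. *)
Lemma expectation_exp_on i t z (A : set R) : measurable A -> (0 <= t)%R ->
  (forall y, A y -> y <= z)%R ->
  \int[P]_x (expR (t * (Wi i x * Zi i x)) * \1_A (Zi i x))%:E <=
  emoment P W 0 (t * z) * P (Zi i @^-1` A).
Proof.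
move=> mA t0 Az; rewrite -(expectation_root_exp i) -(expectation_indic_comp P (mZi i) mA).
rewrite -(expectation_root_sub iidV i n (mexp (t * z)) (measurable_indic mA)) //.
apply: expectation_mono => //.
- exact: (mpairx i (mexp t)).
- apply: measurable_funM; last by apply: (measurableT_comp (measurable_indic mA)).
  by apply: (measurableT_comp (mexp _)).
- move=> x; rewrite indicE; have [xA|_] := boolP (_ \in A); last by rewrite !mulr0.
  rewrite !mulr1 ler_expR -mulrA ler_wpM2l// mulrC ler_wpM2r//.
  by apply: Az; rewrite inE in xA.
Qed.

Lemma measurable_cell A z z' : measurable
  [set x | [/\ (A <= offspring_sum x)%R, (forall i, Zi i x <= z')%R &
               exists i, (z < Zi i x)%R]].
Proof.
rewrite (_ : [set x | _] = offspring_sum @^-1` `[A, +oo[ `&`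
    (\bigcap_i (Zi i @^-1` `]-oo, z']) `&` \bigcup_i (Zi i @^-1` `]z, +oo[))).
  apply: measurableI; [|apply: measurableI].
  - exact: measurable_preimage_fun measurable_offspring_sum _.
  - apply: fin_bigcap_measurable; first exact: finite_finset.
    by move=> i _; apply: measurable_preimage_fun (mZi i) _.
  - apply: fin_bigcup_measurable; first exact: finite_finset.
    by move=> i _; apply: measurable_preimage_fun (mZi i) _.
apply/seteqP; split => x /=.
  move=> [h1 h2 [i h3]]; rewrite in_itv/= h1; split => //; split.
    by move=> j _ /=; rewrite in_itv/= h2.
  by exists i => //=; rewrite in_itv/= h3.
move=> [h1 [h2 [i _ h3]]]; rewrite in_itv/= andbT in h1; split => //.
  by move=> j; have := h2 j I; rewrite /= in_itv.
by exists i; move: h3; rewrite /= in_itv/= andbT.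
Qed.

Lemma measurable_exists_gt z : measurable [set x | exists i, (z < Zi i x)%R].
Proof.
rewrite (_ : [set x | _] = \bigcup_i (Zi i @^-1` `]z, +oo[)).
  apply: fin_bigcup_measurable; first exact: finite_finset.
  by move=> i _; apply: measurable_preimage_fun (mZi i) _.
apply/seteqP; split => x /=.
  by move=> [i h]; exists i => //=; rewrite in_itv/= h.
by move=> [i _ h]; exists i; move: h; rewrite /= in_itv/= andbT.
Qed.

Lemma exists_gt_bound z q : (forall i, P (Zi i @^-1` `]z, +oo[) <= q%:E) ->
  P [set x | exists i, (z < Zi i x)%R] <= (r%:R * q)%:E.
Proof.
move=> Hq.
have mi i : measurable_fun setT (fun x => \1_(`]z, +oo[) (Zi i x) : R).
  by apply: (measurableT_comp (measurable_indic (measurable_itv _))).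
apply: (@le_trans _ _ (\int[P]_x (\sum_(i < r) \1_(`]z, +oo[) (Zi i x))%:E)).
  apply: probability_le_expectation.
  - exact: measurable_exists_gt.
  - exact: measurable_sum.
  - by move=> x; apply: sumr_ge0.
  - move=> x [i zi]; rewrite (bigD1 i)//= indicE mem_set.
      by rewrite lerDl sumr_ge0.
    by rewrite /= in_itv/= zi.
rewrite expectation_sum//.
apply: (@le_trans _ _ (\sum_(i < r) q%:E)).
  by apply: lee_sum => i _; rewrite expectation_indic_comp.
by rewrite sumEFin sumr_const card_ord mulr_natl.
Qed.

(** The factor [r] counts the choices of an offspring with mass in []z, z']]. That offspring pays
    the probability [q] and a moment at [t * z']; each of the [r - 1] others pays [E]. *)
Lemma upper_tail_cell t z z' A q E : (0 <= t)%R -> (t * z')%:E < c -> (0 <= q)%R -> (0 <= E)%R ->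
  (forall i, P (Zi i @^-1` `]z, +oo[) <= q%:E) ->
  (forall i, \int[P]_x (expR (t * (Wi i x * Zi i x)) * \1_(`]-oo, z']) (Zi i x))%:E <= E%:E) ->
  P [set x | [/\ (A <= offspring_sum x)%R, (forall i, Zi i x <= z')%R &
                 exists i, (z < Zi i x)%R]] <=
  (r%:R * (q * moment P W 0 (t * z') * E ^+ r.-1 * expR (- (t * A))))%:E.
Proof.
move=> t0 tz q0 E0 Hq HE.
(* On the event, some term of the sum over [i0] has all its indicators equal to 1, and is then
   [exp (t * offspring_sum)]. *)
pose B (i0 i : 'I_r) : set R := if i == i0 then `]z, z']%classic else `]-oo, z']%classic.
have mB i0 i : measurable (B i0 i) by rewrite /B; case: ifP.
pose f (i0 i : 'I_r) (u : R * R) : R := (expR (t * (u.1 * u.2)) * \1_(B i0 i) u.2)%R.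
have mf i0 i : measurable_fun setT (f i0 i) by exact: (mpair (mexp t)).
have f0 i0 i u : (0 <= f i0 i u)%R by rewrite mulr_ge0// expR_ge0.
have mfx i0 i : measurable_fun setT (fun x => f i0 i (Wi i x, Zi i x)).
  exact: (mpairx i (mexp t) (mB i0 i)).
have mprod i0 : measurable_fun setT (fun x => \prod_(i < r) f i0 i (Wi i x, Zi i x))%R.
  by apply: measurable_prod => i _; exact: mfx.
have prod0 i0 x : (0 <= \prod_(i < r) f i0 i (Wi i x, Zi i x))%R by apply: prodr_ge0.
apply: (@le_trans _ _ (\int[P]_x (expR (- (t * A)) *
    \sum_(i0 < r) \prod_(i < r) f i0 i (Wi i x, Zi i x))%:E)).
  apply: probability_le_expectation.
  - exact: measurable_cell.
  - apply: measurable_funM => //; exact: measurable_sum.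
  - by move=> x; rewrite mulr_ge0 ?expR_ge0//; apply: sumr_ge0.
  - move=> x [xA xz' [i0 xz]].
    rewrite (bigD1 i0)//= mulrDr ler_wpDr//.
      by rewrite mulr_ge0 ?expR_ge0//; apply: sumr_ge0.
    rewrite (_ : \prod_(i < r) _ = expR (t * offspring_sum x))%R.
      by rewrite -expRD -[leLHS]expR0 ler_expR addrC -mulrBr mulr_ge0// subr_ge0.
    rewrite /offspring_sum mulr_sumr expR_sum; apply: eq_bigr => i _.
    rewrite /f /= indicE mem_set ?mulr1// /B.
    by case: eqP => [->|_] /=; rewrite in_itv/= ?xz ?xz'.
rewrite expectation_scale ?expR_ge0//; last 2 first.
- exact: measurable_sum.
- by move=> x; apply: sumr_ge0.
rewrite expectation_sum//.
apply: (@le_trans _ _ ((expR (- (t * A)))%:E * \sum_(i0 < r) (q * moment P W 0 (t * z') * E ^+ r.-1)%:E)); last first.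
  by rewrite sumEFin sumr_const card_ord -EFinM lee_fin -mulr_natl; lra.
rewrite lee_pmul2l ?lte_fin ?expR_gt0//; apply: lee_sum => i0 _.
rewrite (expectation_prod iidV n (index_enum_uniq _) (mf i0))//.
rewrite (bigD1 i0)//= EFinM; apply: lee_pmul.
- by apply: integral_ge0 => x _; rewrite lee_fin.
- by apply: prode_ge0 => i _; apply: integral_ge0 => x _; rewrite lee_fin.
- rewrite /f /B eqxx/=; apply: le_trans (expectation_exp_on i0 _ t0 (z := z') _) _ => //.
    by move=> y /=; rewrite in_itv/= => /andP[].
  rewrite (momentE HW)// muleC EFinM; apply: lee_wpmul2r.
    by rewrite lee_fin (moment_ge0 HW).
  apply: le_trans (Hq i0); apply: le_measure; rewrite ?inE.
  + exact: measurable_preimage_fun.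
  + exact: measurable_preimage_fun.
  + by move=> x /=; rewrite !in_itv/= => /andP[->].
- apply: (@le_trans _ _ (\prod_(i < r | i != i0) E)%:E).
    apply: lee_prod_real => i ii0; rewrite integral_ge0 => [|x _]; last by rewrite lee_fin.
    by rewrite /f /B (negbTE ii0)/=; exact: HE.
  by rewrite prodr_const cardC1 card_ord.
Qed.

Lemma lower_tail_bound t A E : (0 <= t)%R -> (0 <= E)%R ->
  (forall i, \int[P]_x (expR (- t * (Wi i x * Zi i x)))%:E <= E%:E) ->
  P [set x | (offspring_sum x <= A)%R] <= (expR (t * A) * E ^+ r)%:E.
Proof.
move=> t0 E0 HE.
pose f (i : 'I_r) (u : R * R) : R := (expR (- t * (u.1 * u.2)) * \1_setT u.2)%R.
have mf i : measurable_fun setT (f i) by exact: (mpair (mexp (- t))).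
have f0 i u : (0 <= f i u)%R by rewrite mulr_ge0// expR_ge0.
have mfx i : measurable_fun setT (fun x => f i (Wi i x, Zi i x)).
  exact: (mpairx i (mexp (- t)) measurableT).
have mprod : measurable_fun setT (fun x => \prod_(i < r) f i (Wi i x, Zi i x))%R.
  by apply: measurable_prod => i _; exact: mfx.
have prod0 x : (0 <= \prod_(i < r) f i (Wi i x, Zi i x))%R by apply: prodr_ge0.
apply: (@le_trans _ _ (\int[P]_x (expR (t * A) *
    \prod_(i < r) f i (Wi i x, Zi i x))%:E)).
  apply: probability_le_expectation.
  - exact: measurable_set_le measurable_offspring_sum.
  - exact: measurable_funM.
  - by move=> x; rewrite mulr_ge0 ?expR_ge0.
  - move=> x xA; rewrite (_ : \prod_(i < r) _ = expR (- t * offspring_sum x))%R.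
      by rewrite -expRD -[leLHS]expR0 ler_expR mulNr -mulrBr mulr_ge0// subr_ge0.
    rewrite /offspring_sum mulr_sumr expR_sum; apply: eq_bigr => i _.
    by rewrite /f /= indicT mulr1.
rewrite expectation_scale ?expR_ge0// EFinM lee_pmul2l ?lte_fin ?expR_gt0//.
rewrite (expectation_prod iidV n (index_enum_uniq _) mf)//.
apply: (@le_trans _ _ (\prod_(i < r) E)%:E).
  apply: lee_prod_real => i _; rewrite integral_ge0 => [|x _]; last by rewrite lee_fin.
  rewrite /f /=; under eq_integral do rewrite indicT mulr1; exact: HE.
by rewrite prodr_const card_ord.
Qed.

(** Split at [1 + h]: masses below it behave like 1, and masses between it and [z] have a large but
    finite moment times a small probability. *)
Lemma truncated_exponential i t h z : (0 <= t)%R ->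
  \int[P]_x (expR (t * (Wi i x * Zi i x)) * \1_(`]-oo, z]) (Zi i x))%:E <=
  emoment P W 0 (t * (1 + h)) +
  emoment P W 0 (t * z) * P (Zi i @^-1` `](1 + h)%R, +oo[).
Proof.
move=> t0.
pose A1 := `]-oo, (1 + h)%R]%classic; pose A2 := `](1 + h)%R, z]%classic.
apply: (@le_trans _ _ (\int[P]_x (expR (t * (Wi i x * Zi i x)) * \1_A1 (Zi i x) +
  expR (t * (Wi i x * Zi i x)) * \1_A2 (Zi i x))%:E)).
  apply: expectation_mono.
  - exact: (mpairx i (mexp t)).
  - by apply: measurable_funD; exact: (mpairx i (mexp t) (measurable_itv _)).
  - by move=> x; rewrite mulr_ge0// expR_ge0.
  - move=> x; rewrite -mulrDr ler_wpM2l ?expR_ge0// !indicE.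
    have [h1|h1] := boolP (Zi i x \in `]-oo, z]%classic); last by rewrite addr_ge0.
    rewrite inE/= in_itv/= in h1.
    have [h2|h2] := leP (Zi i x) (1 + h)%R.
      by rewrite (_ : _ \in A1) ?lerDl// inE /A1/= in_itv.
    by rewrite (_ : _ \in A2) ?lerDr// inE /A2/= in_itv/= h2.
rewrite expectation_add; last 4 first.
- exact: (mpairx i (mexp t) (measurable_itv _)).
- exact: (mpairx i (mexp t) (measurable_itv _)).
- by move=> x; rewrite mulr_ge0// expR_ge0.
- by move=> x; rewrite mulr_ge0// expR_ge0.
apply: leeD.
  apply: le_trans (expectation_exp_on i (measurable_itv _) t0 (z := (1 + h)%R) _) _ => //.
  rewrite -[leRHS]mule1; apply: lee_wpmul2l; first exact: (emoment_ge0 HW).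
  by apply: probability_le1; exact: measurable_preimage_fun.
apply: le_trans (expectation_exp_on i (measurable_itv _) t0 (z := z) _) _ => //.
  by move=> y; rewrite /A2 /= in_itv/= => /andP[].
apply: lee_wpmul2l; first exact: (emoment_ge0 HW).
apply: le_measure; rewrite ?inE.
- exact: measurable_preimage_fun.
- exact: measurable_preimage_fun.
- by move=> x /=; rewrite !in_itv/= => /andP[->].
Qed.

Lemma exponential_lower i t h : (0 <= t)%R ->
  \int[P]_x (expR (- t * (Wi i x * Zi i x)))%:E <=
  emoment P W 0 (- (t * (1 - h))) + P (Zi i @^-1` `]-oo, (1 - h)%R[).
Proof.
move=> t0; set B := `]-oo, (1 - h)%R[%classic.
rewrite -(expectation_root_exp i) -(expectation_indic_comp P (mZi i)); last exact: measurable_itv.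
have m1 : measurable_fun setT (fun x => expR (- (t * (1 - h)) * Wi i x)).
  exact: (measurableT_comp (mexp _)).
have m2 : measurable_fun setT (fun x => \1_B (Zi i x) : R).
  by apply: (measurableT_comp (measurable_indic (measurable_itv _))).
rewrite -expectation_add//.
apply: expectation_mono.
- by apply: (measurableT_comp (mexp _)); exact: measurable_funM.
- exact: measurable_funD.
- by move=> x; exact: expR_ge0.
- move=> x; rewrite indicE; have [zB|zB] := boolP (Zi i x \in B).
    apply: ler_wpDl; first exact: expR_ge0.
    by apply: (@le_trans _ _ 1%R) => //; rewrite expR_le1 mulNr oppr_le0 mulr_ge0// mulr_ge0.
  rewrite addr0 ler_expR !mulNr lerN2 -mulrA ler_wpM2l// mulrC ler_wpM2l//.
  by move: zB; rewrite notin_setE /B /= in_itv/= => /negP; rewrite -leNgt.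
Qed.

Lemma expectation_monomial i k l :
  \int[P]_x (Wi i x ^+ k * Zi i x ^+ l)%:E =
  emoment P W k 0 * \int[P]_x (Zi i x ^+ l)%:E.
Proof.
have ma j : measurable_fun setT (fun y : R => `|y| ^+ j)%R.
  by apply: measurable_funX; exact: normr_measurable.
transitivity (\int[P]_x ((`|Wi i x| ^+ k) * (`|Zi i x| ^+ l))%:E).
  by apply: eq_integral => x _; rewrite !ger0_norm.
rewrite (expectation_root_sub iidV i n (ma k) (ma l)).
- congr (_ * _); last by apply: eq_integral => x _; rewrite ger0_norm.
  rewrite (expectation_root iidV i mW (ma k)) => [|y]; last exact: exprn_ge0.
  by apply: eq_integral => x _; rewrite ger0_norm// mul0r expR0 mulr1.
- by move=> y; exact: exprn_ge0.
- by move=> y; exact: exprn_ge0.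
Qed.

Hypothesis mean_Zi : forall i, \int[P]_x (Zi i x)%:E = 1.

Lemma expectation_offspring i : \int[P]_x (Wi i x * Zi i x)%:E = 1.
Proof.
have := expectation_monomial i 1 1; under eq_integral do rewrite !expr1; move=> ->.
under [X in _ * X]eq_integral do rewrite expr1.
by rewrite mean_Zi (momentE HW)// (moment10 HW) mule1.
Qed.

Lemma mean_massS : (0 < r)%N -> \int[P]_x (mass V n.+1 x)%:E = 1.
Proof.
move=> r0; under eq_integral do rewrite massS.
rewrite expectation_scale ?invr_ge0//; last 2 first.
- exact: measurable_offspring_sum.
- by move=> x; apply: sumr_ge0 => i _; rewrite mulr_ge0.
rewrite expectation_sum//; last 2 first.
- by move=> i; exact: measurable_funM.
- by move=> i x; rewrite mulr_ge0.
under eq_bigr do rewrite expectation_offspring.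
rewrite sumEFin sumr_const card_ord -EFinM -mulr_natl mulr1 mulVf//.
by rewrite pnatr_eq0 -lt0n.
Qed.

Lemma expectation_offspring_pair i j : i != j ->
  \int[P]_x ((Wi i x * Zi i x) * (Wi j x * Zi j x))%:E = 1.
Proof.
move=> ij; pose f (k : 'I_r) (u : R * R) : R := (`|u.1 * u.2| * \1_setT u.2)%R.
have mf k : measurable_fun setT (f k) by apply: mpair => //; exact: normr_measurable.
have := @expectation_prod _ _ _ _ _ _ _ iidV n [:: i; j] f _ mf.
rewrite /= inE ij => /(_ isT) H.
transitivity (\int[P]_x (\prod_(k <- [:: i; j]) f k (Wi k x, Zi k x))%:E).
  apply: eq_integral => x _; rewrite !big_cons big_nil mulr1 /f /= !indicT !mulr1.
  by rewrite !(ger0_norm (mulr_ge0 (Wi0 _ _) (Zi0 _ _))).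
rewrite H; last by move=> k u; rewrite mulr_ge0.
have E k : \int[P]_x (f k (Wi k x, Zi k x))%:E = 1.
  rewrite -(expectation_offspring k); apply: eq_integral => x _.
  by rewrite /f /= indicT mulr1 (ger0_norm (mulr_ge0 (Wi0 _ _) (Zi0 _ _))).
by rewrite !big_cons big_nil !E !mule1.
Qed.

Context (B : R).
Hypothesis square_Zi : forall i, \int[P]_x (Zi i x ^+ 2)%:E <= B%:E.

Lemma second_moment_offspring i :
  \int[P]_x ((Wi i x * Zi i x) ^+ 2)%:E <= (moment P W 2 0 * B)%:E.
Proof.
under eq_integral do rewrite exprMn.
rewrite expectation_monomial (momentE HW)// EFinM.
by apply: lee_wpmul2l; rewrite ?lee_fin ?(moment_ge0 HW).
Qed.

(** Products over distinct offsprings have mean 1, so only the [r] diagonal terms, each at most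
    [moment P W 2 0 * B], create the correction of order [1 / r]. *)
Lemma second_moment_massS : (0 < r)%N ->
  \int[P]_x (mass V n.+1 x ^+ 2)%:E <= (1 + moment P W 2 0 * B / r%:R)%:E.
Proof.
move=> r0; have r0' : (0 < r%:R :> R)%R by rewrite ltr0n.
have mX i : measurable_fun setT (fun x => Wi i x * Zi i x)%R by exact: measurable_funM.
have X0 i x : (0 <= Wi i x * Zi i x)%R by rewrite mulr_ge0.
have mXX i j : measurable_fun setT (fun x => Wi i x * Zi i x * (Wi j x * Zi j x))%R.
  exact: measurable_funM.
under eq_integral do rewrite massS exprMn expr2 [X in (_ * X)%R]expr2 big_distrlr/=.
rewrite expectation_scale ?mulr_ge0 ?invr_ge0//; last 2 first.
- by apply: measurable_sum => i; apply: measurable_sum => j; exact: mXX.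
- by move=> x; apply: sumr_ge0 => i _; apply: sumr_ge0 => j _; rewrite mulr_ge0.
rewrite expectation_sum; last 2 first.
- by move=> i; apply: measurable_sum => j; exact: mXX.
- by move=> i x; apply: sumr_ge0 => j _; rewrite mulr_ge0.
apply: (@le_trans _ _ ((r%:R^-1 * r%:R^-1)%:E *
    \sum_(i < r) (moment P W 2 0 * B + r%:R)%:E)).
  rewrite lee_pmul2l ?lte_fin ?mulr_gt0 ?invr_gt0//; apply: lee_sum => i _.
  rewrite expectation_sum; last 2 first.
  - by move=> j; exact: mXX.
  - by move=> j x; rewrite mulr_ge0.
  rewrite (bigD1 i)//= EFinD; apply: leeD; first exact: second_moment_offspring.
  under eq_bigr do rewrite expectation_offspring_pair 1?eq_sym//.
  rewrite sumEFin sumr_const cardC1 card_ord -mulr_natl mulr1 lee_fin ler_nat.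
  exact: leq_pred.
rewrite sumEFin sumr_const card_ord -EFinM lee_fin -[X in (_ * X)%R]mulr_natl.
rewrite mulrA mulfVK ?gt_eqF// mulrDr mulVf ?gt_eqF// addrC.
by rewrite lerD2l mulrC.
Qed.

(** Where [Z_i <= 2], the remainder of order 3 is bounded through [W_i Z_i <= 2 W_i], whence
    [8 = 2 ^ 3] and the parameter [t * 2]. *)
Lemma truncated_exponential_taylor i t : (0 <= t)%R -> (t * 2)%:E < c ->
  \int[P]_x (expR (t * (Wi i x * Zi i x)) * \1_(`]-oo, 2%R]) (Zi i x))%:E <=
  (1 + t + t ^+ 2 / 2 * (moment P W 2 0 * B) + 8 * t ^+ 3 * moment P W 3 (t * 2))%:E.
Proof.
move=> t0 tc.
pose X x := (Wi i x * Zi i x)%R.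
have mX : measurable_fun setT X by exact: measurable_funM.
have X0 x : (0 <= X x)%R by rewrite mulr_ge0.
pose f1 x := (1 + t * X x)%R; pose f2 x := (t ^+ 2 / 2 * X x ^+ 2)%R.
pose f3 x := (8 * t ^+ 3 * (Wi i x ^+ 3 * expR (t * 2 * Wi i x)))%R.
have m1 : measurable_fun setT f1 by apply: measurable_funD => //; exact: measurable_funM.
have m2 : measurable_fun setT f2 by apply: measurable_funM => //; exact: measurable_funX.
have mWe : measurable_fun setT (fun x => Wi i x ^+ 3 * expR (t * 2 * Wi i x))%R.
  apply: measurable_funM; first exact: measurable_funX.
  exact: (measurableT_comp (mexp _)).
have m3 : measurable_fun setT f3 by exact: measurable_funM.
have f10 x : (0 <= f1 x)%R by rewrite addr_ge0// mulr_ge0.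
have f20 x : (0 <= f2 x)%R by rewrite mulr_ge0 ?exprn_ge0// divr_ge0// exprn_ge0.
have We0 x : (0 <= Wi i x ^+ 3 * expR (t * 2 * Wi i x))%R by rewrite mulr_ge0 ?exprn_ge0 ?expR_ge0.
have f30 x : (0 <= f3 x)%R by rewrite mulr_ge0// mulr_ge0// exprn_ge0.
apply: (@le_trans _ _ (\int[P]_x (f1 x + f2 x + f3 x)%:E)).
  apply: expectation_mono.
  - exact: (mpairx i (mexp t)).
  - by apply: measurable_funD => //; exact: measurable_funD.
  - by move=> x; rewrite mulr_ge0// expR_ge0.
  - move=> x; rewrite indicE; have [h1|_] := boolP (_ \in _); last first.
      by rewrite mulr0 addr_ge0// addr_ge0.
    rewrite inE/= in_itv/= in h1; rewrite mulr1.
    have tX0 : (0 <= t * X x)%R by rewrite mulr_ge0.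
    apply: (le_trans (expR_le3 tX0)).
    apply: lerD; first by rewrite /f1 /f2 lerD2l exprMn mulrAC.
    have XW : (X x <= 2 * Wi i x)%R by rewrite /X mulrC ler_wpM2r.
    apply: (@le_trans _ _ ((t * (2 * Wi i x)) ^+ 3 * expR (t * 2 * Wi i x)))%R.
      apply: ler_pM; rewrite ?exprn_ge0 ?expR_ge0//.
        have tW0 : (0 <= t * (2 * Wi i x))%R by rewrite mulr_ge0// mulr_ge0.
        by apply: lerXn2r; rewrite ?nnegrE// ler_wpM2l.
      by rewrite ler_expR -mulrA ler_wpM2l.
    by rewrite /f3 le_eqVlt; apply/orP; left; apply/eqP; ring.
rewrite expectation_add//; [|exact: measurable_funD|by move=> x; rewrite addr_ge0].
rewrite expectation_add// EFinD; apply: leeD; last first.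
  rewrite expectation_scale ?mulr_ge0 ?exprn_ge0// EFinM.
  rewrite (_ : \int[P]_x _ = emoment P W 3 (t * 2)) ?(momentE HW)//.
  pose g (y : R) := (`|y| ^+ 3 * expR (t * 2 * y))%R.
  have mg : measurable_fun setT g.
    by apply: measurable_funM => //; apply: measurable_funX; exact: normr_measurable.
  transitivity (\int[P]_x (g (Wi i x))%:E).
    by apply: eq_integral => x _; rewrite /g ger0_norm.
  rewrite (expectation_root iidV i mW mg) => [|y]; last by rewrite mulr_ge0 ?exprn_ge0 ?expR_ge0.
  rewrite -(momentE HW)//.
  by apply: eq_integral => x _; rewrite /g ger0_norm.
rewrite EFinD; apply: leeD.
  rewrite expectation_add//; [|exact: measurable_funM|by move=> x; rewrite mulr_ge0].
  by rewrite (integral_constant P 1) expectation_scale// expectation_offspring mule1.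
rewrite expectation_scale ?divr_ge0 ?exprn_ge0//; last 2 first.
- exact: measurable_funX.
- by move=> x; rewrite exprn_ge0.
rewrite [leRHS]EFinM; apply: lee_wpmul2l; first by rewrite lee_fin divr_ge0// exprn_ge0.
exact: second_moment_offspring.
Qed.

Lemma exponential_lower_taylor i t : (0 <= t)%R ->
  \int[P]_x (expR (- t * (Wi i x * Zi i x)))%:E <=
  (1 - t + t ^+ 2 / 2 * (moment P W 2 0 * B))%:E.
Proof.
move=> t0; pose X x := (Wi i x * Zi i x)%R.
have mX : measurable_fun setT X by exact: measurable_funM.
have X0 x : (0 <= X x)%R by rewrite mulr_ge0.
have me : measurable_fun setT (fun x => expR (- t * X x)) by exact: (measurableT_comp (mexp _)).
have mX2 : measurable_fun setT (fun x => X x ^+ 2)%R by exact: measurable_funX.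
have X20 x : (0 <= X x ^+ 2)%R by rewrite exprn_ge0.
(* The negative term [- t] is moved to the other side, where it becomes the mean of [t W_i Z_i], so
   that all integrands are nonnegative. *)
rewrite [leRHS](_ : _ = (1 + t ^+ 2 / 2 * (moment P W 2 0 * B))%:E - t%:E); last first.
  by rewrite -EFinB; congr EFin; ring.
rewrite leeBrDr//.
apply: (@le_trans _ _ (\int[P]_x (expR (- t * X x) + t * X x)%:E)).
  rewrite expectation_add//; last 2 first.
  - exact: measurable_funM.
  - by move=> x; rewrite mulr_ge0.
  by rewrite expectation_scale// expectation_offspring mule1.
apply: (@le_trans _ _ (\int[P]_x (1 + t ^+ 2 / 2 * X x ^+ 2)%:E)).
  apply: expectation_mono.
  - by apply: measurable_funD => //; exact: measurable_funM.
  - by apply: measurable_funD => //; exact: measurable_funM.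
  - by move=> x; rewrite addr_ge0 ?expR_ge0// mulr_ge0.
  - move=> x; have tX0 : (0 <= t * X x)%R by rewrite mulr_ge0.
    by have := expRN_le2 tX0; rewrite exprMn mulNr; lra.
have t20 : (0 <= t ^+ 2 / 2)%R by rewrite divr_ge0// exprn_ge0.
rewrite expectation_add//; [|exact: measurable_funM|by move=> x; rewrite mulr_ge0].
rewrite (integral_constant P 1) expectation_scale// [leRHS]EFinD leeD2l//.
rewrite [leRHS]EFinM; apply: lee_wpmul2l; first by rewrite lee_fin.
exact: second_moment_offspring.
Qed.

End one_level.

(** * Concentration of the masses, uniformly over families *)

Section uniform_bounds.
Context (R : realType) d (T : measurableType d) (P : probability T R).
Context (W : T -> R) (c : \bar R).
Hypothesis HW : cascade_weight P W c.

Let W0 := weight_ge0 HW.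
Let c0 := weight_gt0 HW.

Local Notation M := (moment P W 0).
Local Notation K := (cumulant P W).
Local Notation rate := (cascade_rate P W c).

(* Holds for all families of i.i.d. copies of W, uniformly, once r is large. *)
Definition eventually_iid (Q : forall r, (seq 'I_r -> T -> R) -> Prop) :=
  \forall r \near \oo, (0 < r)%N /\
    forall V : seq 'I_r -> T -> R, iid_family P W V -> Q r V.

(** The property at a fixed [r], indexed by the proof that it holds eventually, for use under
    [near]. *)
Definition holds_at Q of eventually_iid Q := fun r : nat => (0 < r)%N /\
  forall V : seq 'I_r -> T -> R, iid_family P W V -> Q r V.

Lemma mean_mass n r (V : seq 'I_r -> T -> R) : (0 < r)%N -> iid_family P W V ->
  \int[P]_x (mass V n x)%:E = 1.
Proof.
move=> r0; elim: n V => [|n ih] V iidV.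
  under eq_integral do rewrite mass0.
  exact: integral_constant.
by apply: (mean_massS HW iidV) => // i; apply: ih; exact: iid_shift.
Qed.

Lemma second_moment_mass n : exists C, (0 <= C)%R /\
  forall r (V : seq 'I_r -> T -> R), (0 < r)%N -> iid_family P W V ->
  \int[P]_x (mass V n x ^+ 2)%:E <= (1 + C / r%:R)%:E.
Proof.
elim: n => [|n [C [C0 ih]]].
  exists 0%R; split => // r V r0 iidV; under eq_integral do rewrite mass0 expr1n.
  by rewrite integral_constant mul0r addr0.
(* Bounding [1 + C / r] by [1 + C] keeps the constant independent of [r]. *)
exists (moment P W 2 0 * (1 + C))%R; split.
  by rewrite mulr_ge0 ?(moment_ge0 HW)// addr_ge0.
move=> r V r0 iidV; apply: (second_moment_massS HW iidV) => //.
  by move=> i; apply: mean_mass => //; exact: iid_shift.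
move=> i; apply: le_trans (ih r _ r0 (iid_shift i iidV)) _.
rewrite lee_fin lerD2l ler_piMr// invf_le1 ?ltr0n// ler1n.
by [].
Qed.

Lemma chebyshev_mass n : exists C, (0 <= C)%R /\
  forall r (V : seq 'I_r -> T -> R) h, (0 < r)%N -> iid_family P W V -> (0 < h)%R ->
  P [set x | (h <= `|mass V n x - 1|)%R] <= (C / (r%:R * h ^+ 2))%:E.
Proof.
have [C [C0 H]] := second_moment_mass n; exists C; split => // r V h r0 iidV h0.
have mZ := measurable_mass n iidV; have Z0 x := mass_ge0 n x iidV.
set A := [set x | _].
have mA : measurable A.
  rewrite (_ : A = (fun x => `|mass V n x - 1|%R) @^-1` `[h, +oo[); last first.
    by apply/seteqP; split => x /=; rewrite in_itv/= andbT.
  apply: measurable_preimage_fun => //; apply: measurableT_comp => //.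
  exact: measurable_funB.
have h2 : (0 < h ^+ 2)%R by rewrite exprn_gt0.
have mA' : measurable_fun setT (\1_A : T -> R) by exact: measurable_indic.
(* Chebyshev's inequality without subtraction: [h ^+ 2 * \1_A + 2 * Z <= Z ^+ 2 + 1] involves
   nonnegative functions only, and [Z] has mean 1. *)
have : (h ^+ 2)%:E * P A + (2 : R)%:E <= (1 + C / r%:R)%:E + 1.
  apply: (@le_trans _ _ (\int[P]_x (h ^+ 2 * \1_A x + 2 * mass V n x)%:E)).
    rewrite expectation_add//; last 4 first.
    - exact: measurable_funM.
    - exact: measurable_funM.
    - by move=> x; rewrite mulr_ge0// ltW.
    - by move=> x; rewrite mulr_ge0.
    rewrite expectation_scale ?(ltW h2)// expectation_indic//.
    by rewrite expectation_scale// mean_mass// mule1.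
  apply: (@le_trans _ _ (\int[P]_x (mass V n x ^+ 2 + 1)%:E)).
    apply: expectation_mono.
    - by apply: measurable_funD; exact: measurable_funM.
    - by apply: measurable_funD => //; exact: measurable_funX.
    - by move=> x; rewrite addr_ge0// mulr_ge0// ltW.
    - move=> x; rewrite indicE; have [xA|_] := boolP (x \in A); last first.
        by rewrite mulr0 add0r; have := sqr_ge0 (mass V n x - 1)%R; nra.
      rewrite inE /A /= in xA; have : (h ^+ 2 <= (mass V n x - 1) ^+ 2)%R.
        by rewrite -[leRHS]real_normK ?num_real// lerXn2r// nnegrE ltW.
      by rewrite mulr1; nra.
  rewrite expectation_add//; last 2 first.
  - exact: measurable_funX.
  - by move=> x; rewrite exprn_ge0.
  by rewrite (integral_constant P 1) leeD2r//; exact: H.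
have PA : P A = (fine (P A))%:E by rewrite fineK// fin_num_measure.
rewrite PA -EFinM -!EFinD !lee_fin => H'.
by rewrite invfM mulrA ler_pdivlMr// mulrC; lra.
Qed.

Lemma near_natr_gt (A : R) : \forall r \near \oo, (A < r%:R)%R.
Proof. exact: nbhs_infty_gtr. Qed.

Lemma mass_concentration n h e : (0 < h)%R -> (0 < e)%R ->
  eventually_iid (fun r V => P [set x | (h <= `|mass V n x - 1|)%R] <= e%:E).
Proof.
move=> h0 e0; have [C [C0 H]] := chebyshev_mass n.
near=> r; have r0 : (0 < r)%N by near: r; exact: nbhs_infty_gt.
split => // V iidV; apply: le_trans (H r V h r0 iidV h0) _.
have r0' : (0 < r%:R :> R)%R by rewrite ltr0n.
rewrite lee_fin ler_pdivrMr; last by rewrite mulr_gt0// exprn_gt0.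
have : (C / (e * h ^+ 2) < r%:R)%R by near: r; exact: near_natr_gt.
by rewrite ltr_pdivrMr ?mulr_gt0 ?exprn_gt0// => /ltW; lra.
Unshelve. all: by end_near.
Qed.

Lemma mass_concentration_right n h e : (0 < h)%R -> (0 < e)%R ->
  eventually_iid (fun r V => P (mass V n @^-1` `](1 + h)%R, +oo[) <= e%:E).
Proof.
move=> h0 e0; apply: filterS (mass_concentration n h0 e0) => r [r0 H].
split => // V iidV; apply: le_trans _ (H V iidV).
have mZ := measurable_mass n iidV.
apply: le_measure; rewrite ?inE.
- exact: measurable_preimage_fun.
- exact: measurable_far_set.
- move=> x /=; rewrite in_itv/= andbT => hx; apply: le_trans (ler_norm _); lra.
Qed.

Lemma mass_concentration_left n h e : (0 < h)%R -> (0 < e)%R ->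
  eventually_iid (fun r V => P (mass V n @^-1` `]-oo, (1 - h)%R[) <= e%:E).
Proof.
move=> h0 e0; apply: filterS (mass_concentration n h0 e0) => r [r0 H].
split => // V iidV; apply: le_trans _ (H V iidV).
have mZ := measurable_mass n iidV.
apply: le_measure; rewrite ?inE.
- exact: measurable_preimage_fun.
- exact: measurable_far_set.
- move=> x /=; rewrite in_itv/= => hx; rewrite distrC; apply: le_trans (ler_norm _); lra.
Qed.

Lemma moment_right_continuous t D : t%:E < c -> (M t < D)%R ->
  exists h, [/\ (0 < h)%R, (t + h)%:E < c & forall u, (0 <= u)%R -> (u <= h)%R -> (M (t + u) <= D)%R].
Proof.
move=> tc MD; have [b [tb bc]] := real_between tc.
pose m := (moment P W 1 b + 1)%R.
have m0 : (0 < m)%R by rewrite ltr_wpDl// (moment_ge0 HW).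
pose h := Num.min (b - t)%R ((D - M t) / m)%R.
have h0 : (0 < h)%R by rewrite lt_min subr_gt0 tb divr_gt0// subr_gt0.
have hb : (h <= b - t)%R by rewrite ge_min lexx.
have hD : (h * m <= D - M t)%R by rewrite -ler_pdivlMr// ge_min lexx orbT.
have tuc u : (u <= h)%R -> (t + u)%:E < c.
  by move=> uh; apply: le_lt_trans bc; rewrite lee_fin; lra.
exists h; split => //; first exact: tuc.
move=> u u0 uh; have tu : (t <= t + u)%R by rewrite lerDl.
have h2 := moment_lipschitz HW 0 tu (tuc _ uh).
have tub : (t + u <= b)%R by rewrite -lerBrDl (le_trans uh).
have h4 : (moment P W 1 (t + u) <= m)%R.
  by apply: (le_trans (moment_le HW 1 tub bc)); rewrite /m lerDl.
have h3 := ler_pM u0 (moment_ge0 HW 1 (t + u)) uh h4.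
rewrite [(t + u - t)%R]addrAC subrr add0r lerBlDl in h2; apply: (le_trans h2).
by rewrite -lerBrDl; exact: le_trans h3 hD.
Qed.

Lemma eventually_iidI Q1 Q2 : eventually_iid Q1 -> eventually_iid Q2 ->
  eventually_iid (fun r V => Q1 r V /\ Q2 r V).
Proof.
move=> H1 H2; near=> r; have [r0 h1] : holds_at H1 r by near: r.
have [_ h2] : holds_at H2 r by near: r.
by split => // V iidV; split; [exact: h1|exact: h2].
Unshelve. all: by end_near.
Qed.

(** Asymptotically the truncation level disappears: as long as [t * z < c], the truncated moment is
    at most any [D] above [M t]. *)
Lemma eventually_truncated_exponential n t z D : (0 <= t)%R -> t%:E < c ->
  (t * z)%:E < c -> (M t < D)%R ->
  eventually_iid (fun r V => forall i,
    \int[P]_x (expR (t * (V [:: i] x * mass (shift V i) n x)) *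
               \1_(`]-oo, z]) (mass (shift V i) n x))%:E <= D%:E).
Proof.
move=> t0 tc tzc MD.
have MD' : (M t < (M t + D) / 2)%R by rewrite midf_lt.
have [h' [h'0 h'c Hh']] := moment_right_continuous tc MD'.
pose h := (h' / (t + 1))%R.
have t10 : (0 < t + 1)%R by rewrite ltr_wpDl.
have h0 : (0 < h)%R by rewrite divr_gt0.
have th : (t * h <= h')%R.
  by rewrite mulrA ler_pdivrMr// mulrC ler_wpM2l ?lerDl// ltW.
(* Half of the gap [D - M t] is left to the masses above [1 + h]; the other half covers those below,
   by continuity of [M]. *)
pose e := ((D - M t) / 2 / (M (t * z) + 1))%R.
have Mz0 : (0 < M (t * z) + 1)%R by rewrite ltr_wpDl// (moment_ge0 HW).
have e0 : (0 < e)%R by rewrite divr_gt0// divr_gt0// subr_gt0.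
apply: filterS (mass_concentration_right n h0 e0) => r [r0 H].
split => // V iidV i.
apply: le_trans (truncated_exponential HW iidV n i h z t0) _.
have t1hE : (t * (1 + h) = t + t * h)%R by ring.
have t1h : (t * (1 + h))%:E < c.
  by apply: le_lt_trans h'c; rewrite lee_fin t1hE lerD2l.
rewrite !(momentE HW)//.
apply: (@le_trans _ _ (((M t + D) / 2)%:E + (M (t * z))%:E * e%:E)).
  apply: leeD.
    by rewrite lee_fin t1hE; apply: Hh' => //; rewrite mulr_ge0// ltW.
  by apply: lee_wpmul2l; [rewrite lee_fin (moment_ge0 HW)|apply: H; exact: iid_shift].
rewrite -EFinM -EFinD lee_fin.
have : (M (t * z) * e <= (D - M t) / 2)%R.
  rewrite /e mulrCA ler_piMr//; first by rewrite divr_ge0// subr_ge0 ltW.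
  by rewrite ler_pdivrMr// mul1r lerDl.
move=> hM; rewrite -lerBrDl; apply: (le_trans hM).
by rewrite le_eqVlt; apply/orP; left; apply/eqP; field.
Qed.

Lemma eventually_exponential_lower n t D : (0 <= t)%R -> (M (- t) < D)%R ->
  eventually_iid (fun r V => forall i,
    \int[P]_x (expR (- t * (V [:: i] x * mass (shift V i) n x)))%:E <= D%:E).
Proof.
move=> t0 MD; have tc : (- t)%:E < c by apply: le_lt_trans c0; rewrite lee_fin oppr_le0.
have MD' : (M (- t) < (M (- t) + D) / 2)%R by rewrite midf_lt.
have [h' [h'0 h'c Hh']] := moment_right_continuous tc MD'.
pose h := (h' / (t + 1))%R.
have t10 : (0 < t + 1)%R by rewrite ltr_wpDl.
have h0 : (0 < h)%R by rewrite divr_gt0.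
have th : (t * h <= h')%R.
  by rewrite mulrA ler_pdivrMr// mulrC ler_wpM2l ?lerDl// ltW.
pose e := ((D - M (- t)) / 2)%R.
have e0 : (0 < e)%R by rewrite divr_gt0// subr_gt0.
apply: filterS (mass_concentration_left n h0 e0) => r [r0 H].
split => // V iidV i.
apply: le_trans (exponential_lower HW iidV n i h t0) _.
have t1hE : (- (t * (1 - h)) = - t + t * h)%R by ring.
have t1h : (- (t * (1 - h)))%:E < c.
  by apply: le_lt_trans h'c; rewrite lee_fin t1hE lerD2l.
rewrite (momentE HW)//.
apply: (@le_trans _ _ (((M (- t) + D) / 2)%:E + e%:E)).
  apply: leeD; last by apply: H; exact: iid_shift.
  by rewrite lee_fin t1hE; apply: Hh' => //; rewrite mulr_ge0// ltW.
by rewrite -EFinD lee_fin /e; lra.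
Qed.

End uniform_bounds.

(** * Upper and lower tails at speed [r] *)

Section tail_bounds.
Context (R : realType) d (T : measurableType d) (P : probability T R).
Context (W : T -> R) (c : \bar R).
Hypothesis HW : cascade_weight P W c.

Let c0 := weight_gt0 HW.

Local Notation M := (moment P W 0).
Local Notation K := (cumulant P W).
Local Notation L := (log_laplace P W).
Local Notation rate := (cascade_rate P W c).
Local Notation Lst := (legendre (log_laplace P W)).

Lemma near_polynomial_exp (C e : R) : (0 <= C)%R -> (0 < e)%R ->
  \forall r \near \oo, (C * r%:R <= expR (r%:R * e))%R.
Proof.
move=> C0 e0; near=> r.
have r0 : (0 <= r%:R :> R)%R by [].
have re0 : (0 <= r%:R * e)%R by rewrite mulr_ge0// ltW.
apply: le_trans (expR_ge2 re0).
have : (2 * C / e ^+ 2 < r%:R)%R by near: r; exact: near_natr_gt.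
by rewrite ltr_pdivrMr ?exprn_gt0// => h; nra.
Unshelve. all: by end_near.
Qed.

Lemma measurable_mass_ge n r (V : seq 'I_r -> T -> R) a : iid_family P W V ->
  measurable [set x | (a <= mass V n x)%R].
Proof.
by move=> iidV; apply: measurable_set_ge; exact: (measurable_mass n iidV).
Qed.

Lemma massS_ge n r (V : seq 'I_r -> T -> R) a x : (0 < r)%N ->
  (a <= mass V n.+1 x)%R = (r%:R * a <= offspring_sum V n x)%R.
Proof. by move=> r0; rewrite massS mulrC ler_pdivlMr ?ltr0n// mulrC. Qed.

Lemma massS_le n r (V : seq 'I_r -> T -> R) a x : (0 < r)%N ->
  (mass V n.+1 x <= a)%R = (offspring_sum V n x <= r%:R * a)%R.
Proof. by move=> r0; rewrite massS mulrC ler_pdivrMr ?ltr0n// mulrC. Qed.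

(* Optimal exponential parameter for a cell of offspring masses close to z;
   the factor p^2 > 1 is the price of the discretization. *)
Lemma cell_parameter n a z p x : (1 < a)%R -> (1 <= z)%R -> (1 < p)%R ->
  (0 <= x)%R -> (p ^+ 2 * x)%:E < rate n.+1 a -> rate n z <= x%:E ->
  exists t, [/\ (0 <= t)%R, t%:E < c, (t * (p * z))%:E < c &
    x%:E - (t * a - K t)%:E < rate n z].
Proof.
move=> a1 z1 p1 x0 Hx Hz.
have [i iE] : exists i : R, rate n z = i%:E.
  have := cascade_rate_ge0 HW n z; case: (rate n z) Hz => [i| |]//= _ _; by exists i.
have i0 : (0 <= i)%R by rewrite -lee_fin -iE (cascade_rate_ge0 HW).
rewrite iE lee_fin in Hz.
have p0 : (0 < p)%R by lra.
have p2 : (1 < p ^+ 2)%R by rewrite exprn_egt1.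
have y0 : (0 <= p ^+ 2 * x - i)%R by nra.
(* If no such [t] existed, duality would give [rate n.+1 a <= p ^+ 2 * x]. *)
have [t [t0 tz Ht]] : exists t, [/\ (0 <= t)%R, (t * z)%:E <= c &
    (p ^+ 2 * x - i)%:E < (t * a)%:E - L t].
  apply: contrapT => H.
  have : rate n.+1 a <= rate n z + (p ^+ 2 * x - i)%:E.
    apply: (cascade_rate_duality HW) => // t t0 tz; rewrite leNgt; apply/negP => Ht.
    by apply: H; exists t.
  by rewrite iE -EFinD subrKC leNgt Hx.
have p20 : (0 < p ^+ 2)%R by lra.
have tp0 : (0 <= t / p ^+ 2)%R by rewrite divr_ge0// ltW.
have z0 : (0 < z)%R by lra.
have tpz : (t / p ^+ 2 * (p * z))%:E < c.
  have [->|tn0] := eqVneq t 0%R; first by rewrite !mul0r.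
  apply: lt_le_trans tz; rewrite lte_fin.
  have -> : (t / p ^+ 2 * (p * z) = t * z / p)%R by field; rewrite gt_eqF.
  by rewrite ltr_pdivrMr// ltr_pMr// mulr_gt0// lt_neqAle eq_sym tn0.
have tpc : (t / p ^+ 2)%:E < c.
  apply: le_lt_trans tpz; rewrite lee_fin ler_peMr//; nra.
(* The division makes the constraint strict at the upper end [p * z] of the cell, and by convexity
   it divides the gain by at most [p ^+ 2]. *)
exists (t / p ^+ 2)%R; split => //.
have := cumulant_scale HW (ltW p2) tpc.
have := log_laplace_ge HW t; move: Ht; case: (L t) => [l| |]//=.
rewrite -EFinB !lte_fin !lee_fin iE lte_fin => Ht _ Hl.
have : (p ^+ 2 * (x - (t / p ^+ 2 * a - K (t / p ^+ 2))) < p ^+ 2 * i)%R.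
  have -> : (p ^+ 2 * (x - (t / p ^+ 2 * a - K (t / p ^+ 2))) =
     p ^+ 2 * x - t * a + p ^+ 2 * K (t / p ^+ 2))%R by field; rewrite gt_eqF.
  by have : (i <= p ^+ 2 * i)%R; [rewrite ler_peMl// ltW|lra].
by rewrite ltr_pM2l.
Qed.

(** Either a mass above [y] is already rarer than the target, and a union bound suffices, or the
    parameter of [cell_parameter] is used. The lower end [y] is separate from [z] because the first
    cell has no positive lower end. *)
Lemma upper_tail_cell_bound n a z y p x : (1 < a)%R -> (1 <= z)%R -> (1 < p)%R ->
  (0 <= x)%R -> (p ^+ 2 * x)%:E < rate n.+1 a ->
  (forall q, q%:E < rate n z ->
     eventually_iid P W (fun r V => P (mass V n @^-1` `]y, +oo[) <= (expR (- (r%:R * q)))%:E)) ->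
  exists C, (0 <= C)%R /\ eventually_iid P W (fun r V =>
    P [set u | [/\ (r%:R * a <= offspring_sum V n u)%R,
      (forall i, mass (shift V i) n u <= p * z)%R &
      exists i, (y < mass (shift V i) n u)%R]] <= (C * r%:R * expR (- (r%:R * x)))%:E).
Proof.
move=> a1 z1 p1 x0 Hx Hq.
have [xz|zx] := ltP x%:E (rate n z).
  exists 1%R; split => //; apply: filterS (Hq x xz) => r [r0 H]; split => // V iidV.
  apply: (@le_trans _ _ (P [set u | exists i, (y < mass (shift V i) n u)%R])).
    apply: le_measure; rewrite ?inE.
    - exact: (measurable_cell iidV).
    - exact: (measurable_exists_gt iidV).
    - by move=> u /= [].
  rewrite mul1r; apply: (exists_gt_bound iidV) => i.
  by apply: H; exact: iid_shift.
have [t [t0 tc tz Ht]] := cell_parameter a1 z1 p1 x0 Hx zx.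
have [q [q1 q2]] := real_between Ht.
(* The strict inequality leaves a slack [g] per letter, which pays for the truncated moments being
   only asymptotically bounded by [M t]. *)
pose g := (q - (x - (t * a - K t)))%R.
have g0 : (0 < g)%R by rewrite subr_gt0.
have M1 : (1 <= M t)%R.
  by apply: le_trans (expR_le_moment HW tc); rewrite -[leLHS]expR0 ler_expR.
have M0 : (0 < M t)%R by apply: lt_le_trans M1.
pose E := (M t * expR g)%R.
have ME : (M t < E)%R by rewrite ltr_pMr// expR_gt1.
have E1 : (1 <= E)%R by rewrite (le_trans M1)// ltW.
have EE : E = expR (K t + g) by rewrite expRD (expR_cumulant HW tc).
exists (M (t * (p * z))); split; first exact: (moment_ge0 HW).
have H1 := Hq q q2.
have H2 := eventually_truncated_exponential HW n t0 tc tz ME.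
near=> r; have [r0 /= h1] : holds_at H1 r by near: r; exact: H1.
have [_ /= h2] : holds_at H2 r by near: r; exact: H2.
split => // V iidV.
have hq i : P (mass (shift V i) n @^-1` `]y, +oo[) <= (expR (- (r%:R * q)))%:E.
  by apply: h1; exact: iid_shift.
have E0 : (0 <= E)%R by apply: le_trans E1.
apply: le_trans (upper_tail_cell HW iidV (r%:R * a)%R t0 tz (expR_ge0 _) E0 hq (h2 V iidV)) _.
rewrite lee_fin mulrAC (mulrC _ r%:R) -!mulrA ler_wpM2l//.
rewrite mulrCA ler_wpM2l ?(moment_ge0 HW)//.
apply: (@le_trans _ _ (expR (- (r%:R * q)) * (expR (- (t * (r%:R * a))) * E ^+ r)))%R.
  rewrite ler_wpM2l ?expR_ge0// ler_wpM2l ?expR_ge0//.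
  by rewrite ler_weXn2l// leq_pred.
rewrite EE -expRM_natl -!expRD ler_expR le_eqVlt; apply/orP; left; apply/eqP.
by rewrite /g; ring.
Unshelve. all: by end_near.
Qed.

Definition upper_tail n := forall a x, (1 <= a)%R -> x%:E < rate n a ->
  eventually_iid P W (fun r V => P [set u | (a <= mass V n u)%R] <= (expR (- (r%:R * x)))%:E).

Lemma upper_tail_trivial (Q : forall r, (seq 'I_r -> T -> R) -> set T) x : (x <= 0)%R ->
  (forall r (V : seq 'I_r -> T -> R), iid_family P W V -> measurable (Q r V)) ->
  eventually_iid P W (fun r V => P (Q r V) <= (expR (- (r%:R * x)))%:E).
Proof.
move=> x0 mQ; near=> r; split; first by near: r; exact: nbhs_infty_gt.
move=> V iidV; apply: (@le_trans _ _ 1); first by apply: probability_le1; exact: mQ.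
by rewrite lee_fin -[leLHS]expR0 ler_expR oppr_ge0 mulr_ge0_le0.
Unshelve. all: by end_near.
Qed.

Lemma upper_tail_right n a x : upper_tail n -> (1 <= a)%R -> x%:E < rate n a ->
  eventually_iid P W (fun r V => P (mass V n @^-1` `]a, +oo[) <= (expR (- (r%:R * x)))%:E).
Proof.
move=> U a1 xa; apply: filterS (U a x a1 xa) => r [r0 H]; split => // V iidV.
apply: le_trans (H V iidV); apply: le_measure; rewrite ?inE.
- by apply: measurable_preimage_fun => //; exact: (measurable_mass n iidV).
- exact: measurable_mass_ge iidV.
- by move=> u /=; rewrite in_itv/= andbT => /ltW.
Qed.

(** Every mass exceeds [-1], so the last condition is void for [r > 0] and the union of the first
    cells keeps the shape of a cell. The bottom cell reaches up to [p] and uses that the rate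
    vanishes at 1. *)
Lemma upper_tail_cells n a p x j : upper_tail n -> (1 < a)%R -> (1 < p)%R ->
  (0 <= x)%R -> (p ^+ 2 * x)%:E < rate n.+1 a ->
  exists C, (0 <= C)%R /\ eventually_iid P W (fun r V =>
    P [set u | [/\ (r%:R * a <= offspring_sum V n u)%R,
      (forall i, mass (shift V i) n u <= p ^+ j.+1)%R &
      exists i, (-1 < mass (shift V i) n u)%R]] <= (C * r%:R * expR (- (r%:R * x)))%:E).
Proof.
move=> U a1 p1 x0 Hx; elim: j => [|j [C1 [C10 H1]]].
  have [|C [C0 H]] := @upper_tail_cell_bound n a 1%R (- 1)%R p x a1 (lexx _) p1 x0 Hx.
    move=> q; rewrite (cascade_rate1 HW) => q0.
    apply: (@upper_tail_trivial (fun r V => mass V n @^-1` `](-1)%R, +oo[)).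
      by rewrite -lee_fin ltW.
    move=> r V iidV; apply: measurable_preimage_fun => //; exact: (measurable_mass n iidV).
  exists C; split => //; apply: filterS H => r [r0 H]; split => // V iidV.
  by apply: le_trans (H V iidV); rewrite expr1 mulr1.
have pj : (1 <= p ^+ j.+1)%R by rewrite exprn_ege1// ltW.
have [|C2 [C20 H2]] := @upper_tail_cell_bound n a (p ^+ j.+1)%R (p ^+ j.+1)%R p x a1 pj p1 x0 Hx.
  by move=> q Hq; exact: upper_tail_right.
exists (C1 + C2)%R; split; first by rewrite addr_ge0.
apply: filterS (eventually_iidI H1 H2) => r [r0 H]; split => // V iidV.
have [{}H1 {}H2] := H V iidV.
rewrite !mulrDl EFinD; apply: le_trans (leeD H1 H2).
apply: le_trans (measureU2 _ _ _); [|exact: (measurable_cell iidV)..].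
apply: le_measure; rewrite ?inE.
- exact: (measurable_cell iidV).
- by apply: measurableU; exact: (measurable_cell iidV).
- move=> u /= [h1 h2 h3].
  have [h4|h4] := pselect (forall i, mass (shift V i) n u <= p ^+ j.+1)%R; [left|right] => //.
  split => //.
  by move/existsNP: h4 => [i h]; exists i; rewrite ltNge; apply/negP.
Qed.

Lemma exists_power_gt (p A : R) : (1 < p)%R -> exists j, (A < p ^+ j.+1)%R.
Proof.
move=> p1; exists (Num.truncn (Num.max A 0%R / (p - 1))%R).
have p0 : (0 < p - 1)%R by rewrite subr_gt0.
set m := Num.truncn _.
have hm : (Num.max A 0 < m.+1%:R * (p - 1))%R.
  have := @truncn_itv _ (Num.max A 0%R / (p - 1))%R.
  rewrite divr_ge0 ?(ltW p0) ?le_max ?lexx ?orbT// => /(_ isT) /andP[_].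
  by rewrite ltr_pdivrMr.
have bern k : (k%:R * (p - 1) <= p ^+ k - 1)%R.
  elim: k => [|k ih]; first by rewrite mul0r expr0 subrr.
  have : (1 <= p ^+ k)%R by rewrite exprn_ege1// ltW.
  by rewrite -natr1 exprS; nra.
have := bern m.+1; move: hm; rewrite gt_max => /andP[h _] h2; lra.
Qed.

Lemma upper_tail_holds n : upper_tail n.
Proof.
elim: n => [|n U] a x a1 xa.
  have [x0|x0] := leP x 0%R.
    apply: (@upper_tail_trivial (fun r V => [set u | (a <= mass V 0 u)%R])) => //.
    by move=> r V; exact: measurable_mass_ge.
  have an1 : (1 < a)%R.
    rewrite lt_neqAle a1 andbT eq_sym; apply/eqP => E.
    by move: xa; rewrite /= E eqxx lte_fin ltNge ltW.
  near=> r; split; first by near: r; exact: nbhs_infty_gt.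
  move=> V iidV; rewrite (_ : [set u | _] = set0) ?measure0 ?lee_fin ?expR_ge0//.
  by apply/seteqP; split => // u /=; rewrite mass0 leNgt an1.
have [x0|x0] := leP x 0%R.
  apply: (@upper_tail_trivial (fun r V => [set u | (a <= mass V n.+1 u)%R])) => //.
  by move=> r V; exact: measurable_mass_ge.
have an1 : (1 < a)%R.
  rewrite lt_neqAle a1 andbT eq_sym; apply/eqP => E.
  by move: xa; rewrite E (cascade_rate1 HW) lte_fin ltNge ltW.
have [x2 [x2x x2a]] := real_between xa.
pose x1 := ((x + x2) / 2)%R.
have x1x : (x < x1)%R by rewrite /x1; lra.
have x12 : (x1 < x2)%R by rewrite /x1; lra.
have x10 : (0 < x1)%R by lra.
(* For [h <= 1] one has [(1 + h) ^+ 2 <= 1 + 3 * h <= x2 / x1], so the price of the discretization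
   fits between [x1] and [x2]. *)
pose h := Num.min 1%R ((x2 / x1 - 1) / 3)%R.
have h0 : (0 < h)%R by rewrite lt_min ltr01 divr_gt0// subr_gt0 ltr_pdivlMr// mul1r.
have h1 : (h <= 1)%R by rewrite ge_min lexx.
have h2 : (h * 3 <= x2 / x1 - 1)%R by rewrite -ler_pdivlMr// ge_min lexx orbT.
pose p := (1 + h)%R.
have p1 : (1 < p)%R by rewrite ltrDl.
have Hx : (p ^+ 2 * x1)%:E < rate n.+1 a.
  apply: le_lt_trans x2a; rewrite lee_fin -ler_pdivlMr// /p; nra.
(* Beyond [A] the masses alone are rarer than the target, so that finitely many cells, independently
   of [r], cover the rest. *)
have [A [A1 HA]] := cascade_rate_infty HW n (x1 + 1).
have [j Aj] := exists_power_gt A p1.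
have [C [C0 H1]] := upper_tail_cells j U an1 p1 (ltW x10) Hx.
have pj : (1 <= p ^+ j.+1)%R by rewrite exprn_ege1// ltW.
have Hj : x1%:E < rate n (p ^+ j.+1)%R.
  apply: (@lt_le_trans _ _ (x1 + 1)%:E); first by rewrite lte_fin ltrDl.
  by apply: (le_trans HA); apply: (cascade_rate_nondecreasing HW); apply: ltW.
have H2 := upper_tail_right U pj Hj.
have x1x' : (0 < x1 - x)%R by rewrite subr_gt0.
have C10 : (0 <= C + 1)%R by rewrite addr_ge0.
near=> r; have [r0 /= h3] : holds_at H1 r by near: r; exact: H1.
have [_ /= h4] : holds_at H2 r by near: r; exact: H2.
split => // V iidV.
apply: (@le_trans _ _ ((C * r%:R * expR (- (r%:R * x1)))%:E +
   (r%:R * expR (- (r%:R * x1)))%:E)).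
  have h4' i : P (mass (shift V i) n @^-1` `](p ^+ j.+1)%R, +oo[) <= (expR (- (r%:R * x1)))%:E.
    by apply: h4; exact: iid_shift.
  apply: le_trans (leeD (h3 V iidV) (exists_gt_bound iidV h4')).
  apply: le_trans (measureU2 _ _ _); last 2 first.
  - exact: (measurable_cell iidV).
  - exact: (measurable_exists_gt iidV).
  apply: le_measure; rewrite ?inE.
  - exact: measurable_mass_ge iidV.
  - by apply: measurableU; [exact: (measurable_cell iidV)|exact: (measurable_exists_gt iidV)].
  - move=> u /=; rewrite massS_ge// => ha.
    have [h5|h5] := pselect (forall i, mass (shift V i) n u <= p ^+ j.+1)%R; [left|right].
      split => //; exists (Ordinal r0); apply: (@lt_le_trans _ _ 0%R) => //.
      exact: mass_ge0 (iid_shift _ iidV).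
    by move/existsNP: h5 => [i h5]; exists i; rewrite ltNge; apply/negP.
rewrite -EFinD lee_fin -mulrDl -[X in (_ + X)%R]mul1r -mulrDl.
have hr : ((C + 1) * r%:R <= expR (r%:R * (x1 - x)))%R by near: r; exact: near_polynomial_exp.
apply: (le_trans (ler_wpM2r (expR_ge0 _) hr)).
by rewrite -expRD ler_expR; lra.
Unshelve. all: by end_near.
Qed.

Lemma lower_tail_holds n a x : (a <= 1)%R -> x%:E < Lst a ->
  eventually_iid P W (fun r V => P [set u | (mass V n.+1 u <= a)%R] <= (expR (- (r%:R * x)))%:E).
Proof.
move=> a1 xa.
have mQ r (V : seq 'I_r -> T -> R) : iid_family P W V ->
    measurable [set u | (mass V n.+1 u <= a)%R].
  by move=> iidV; apply: measurable_set_le; exact: (measurable_mass n.+1 iidV).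
have [x0|x0] := leP x 0%R; first exact: upper_tail_trivial.
move: xa => /ereal_sup_gt[_ [t _ <-]].
have := log_laplace_ge HW t.
case E : (L t) => [l| |]//; rewrite lee_fin -EFinB lte_fin => tl xl.
(* As [a <= 1] and [t <= L t], a positive value of [t * a - L t] forces [t < 0]. *)
have tn : (t < 0)%R by nra.
have tc : t%:E < c by apply: lt_trans c0; rewrite lte_fin.
have lK : l = K t by move: E; rewrite (log_laplace_fin HW tc) => -[].
pose g := (t * a - l - x)%R.
have g0 : (0 < g)%R by rewrite /g; lra.
have M0 := moment_gt0 HW tc.
pose D := (M t * expR g)%R.
have MD : (M (- - t) < D)%R by rewrite opprK ltr_pMr// expR_gt1.
have DE : D = expR (l + g) by rewrite expRD lK (expR_cumulant HW tc).
have t0 : (0 <= - t)%R by rewrite oppr_ge0 ltW.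
apply: filterS (eventually_exponential_lower HW n t0 MD) => r [r0 H]; split => // V iidV.
under [X in P X]eq_set do rewrite massS_le//.
apply: le_trans (lower_tail_bound iidV (r%:R * a)%R t0 _ (H V iidV)) _.
  by rewrite mulr_ge0 ?expR_ge0// ltW.
rewrite lee_fin DE -expRM_natl -expRD ler_expR le_eqVlt; apply/orP; left; apply/eqP.
by rewrite /g; ring.
Qed.

End tail_bounds.

(** * Lower bounds by exponential tilting *)

Section tilting.
Context (R : realType) d (T : measurableType d) (P : probability T R).

(** Cramer's lower bound without a change of measure: [exp (t S)] is at most [exp m] inside the
    window, and outside it is dominated by tilts of parameter [t + u] on the right and [t - u] on
    the left. *)
Lemma tilting_bound (S : T -> R) (t u lo hi A B1 B2 m : R) : measurable_fun setT S ->
  (0 <= u)%R -> (t * lo <= m)%R -> (t * hi <= m)%R ->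
  (expR A)%:E <= \int[P]_x (expR (t * S x))%:E ->
  \int[P]_x (expR ((t + u) * S x))%:E <= (expR B1)%:E ->
  \int[P]_x (expR ((t - u) * S x))%:E <= (expR B2)%:E ->
  (B1 - u * hi + 2 <= A)%R -> (B2 + u * lo + 2 <= A)%R ->
  (expR (A - m - 1))%:E <= P [set x | (lo < S x < hi)%R].
Proof.
move=> mS u0 tlo thi HA HB1 HB2 A1 A2.
pose Q := [set x | (lo < S x < hi)%R].
have mQ : measurable Q by exact: measurable_set_oo.
have me th : measurable_fun setT (fun x => expR (th * S x)).
  by apply: measurableT_comp => //; exact: measurable_funM.
have mQ' : measurable_fun setT (\1_Q : T -> R) by exact: measurable_indic.
pose f1 x := (expR m * \1_Q x)%R.
pose f2 x := (expR (- (u * hi)) * expR ((t + u) * S x))%R.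
pose f3 x := (expR (u * lo) * expR ((t - u) * S x))%R.
have m1 : measurable_fun setT f1 by exact: measurable_funM.
have m2 : measurable_fun setT f2 by exact: measurable_funM.
have m3 : measurable_fun setT f3 by exact: measurable_funM.
have f10 x : (0 <= f1 x)%R by rewrite mulr_ge0 ?expR_ge0.
have f20 x : (0 <= f2 x)%R by rewrite mulr_ge0 ?expR_ge0.
have f30 x : (0 <= f3 x)%R by rewrite mulr_ge0 ?expR_ge0.
have H : (expR A)%:E <= (expR m)%:E * P Q + (expR (B1 - u * hi))%:E + (expR (B2 + u * lo))%:E.
  apply: (le_trans HA); apply: (@le_trans _ _ (\int[P]_x (f1 x + f2 x + f3 x)%:E)).
    apply: expectation_mono => //.
    - by apply: measurable_funD => //; exact: measurable_funD.
    - move=> x; rewrite /f1 /f2 /f3 -!expRD indicE.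
      have [Shi|Shi] := leP hi (S x).
        apply: (@le_trans _ _ (expR (- (u * hi) + (t + u) * S x))); last first.
          by rewrite -addrA [leRHS]addrC -addrA lerDl addr_ge0 ?expR_ge0// mulr_ge0 ?expR_ge0.
        by rewrite ler_expR; nra.
      have [Slo|Slo] := leP (S x) lo.
        apply: (@le_trans _ _ (expR (u * lo + (t - u) * S x))); last first.
          by rewrite lerDr addr_ge0 ?expR_ge0// mulr_ge0 ?expR_ge0.
        by rewrite ler_expR; nra.
      rewrite mem_set /Q/= ?Slo ?Shi// mulr1 -addrA ler_wpDr ?addr_ge0 ?expR_ge0//.
      by rewrite ler_expR; have [t0|t0] := leP 0%R t; nra.
  rewrite expectation_add//; [|exact: measurable_funD|by move=> x; rewrite addr_ge0].
  rewrite expectation_add// !expectation_scale ?expR_ge0//.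
  rewrite expectation_indic//; apply: leeD; first apply: leeD => //.
    rewrite [leRHS](_ : _ = (expR (- (u * hi)))%:E * (expR B1)%:E); last first.
      by rewrite -EFinM -expRD addrC.
    by apply: lee_wpmul2l; rewrite ?lee_fin ?expR_ge0.
  rewrite [leRHS](_ : _ = (expR (u * lo))%:E * (expR B2)%:E); last first.
    by rewrite -EFinM -expRD addrC.
  by apply: lee_wpmul2l; rewrite ?lee_fin ?expR_ge0.
have PQ : P Q = (fine (P Q))%:E by rewrite fineK// fin_num_measure.
rewrite -/Q PQ lee_fin; move: H; rewrite PQ -EFinM -!EFinD lee_fin => H.
(* The margin 2 makes each outer term at most a quarter of [exp A]. Half of [exp A] is left to the
   window, and [exp 1 >= 2] turns this half into the [- 1] of the conclusion. *)
have e2 : (4 <= expR 2 :> R)%R.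
  by have := @expR_ge2 R 2 (ler0n _ _); lra.
have e1 : (2 <= expR 1 :> R)%R by have := @expR_ge1Dx R 1; lra.
have h1 : (expR (B1 - u * hi) * 4 <= expR A)%R.
  apply: (@le_trans _ _ (expR (B1 - u * hi) * expR 2)%R); first by rewrite ler_wpM2l ?expR_ge0.
  by rewrite -expRD ler_expR.
have h2 : (expR (B2 + u * lo) * 4 <= expR A)%R.
  apply: (@le_trans _ _ (expR (B2 + u * lo) * expR 2)%R); first by rewrite ler_wpM2l ?expR_ge0.
  by rewrite -expRD ler_expR.
have em := expR_gt0 m.
rewrite -(ler_pM2l em) -expRD (_ : (m + (A - m - 1) = A - 1)%R); last by ring.
rewrite expRB ler_pdivrMr ?expR_gt0//.
have eA := expR_gt0 A.
have : (expR A <= 2 * (expR m * fine (P Q)))%R by lra.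
have : (0 <= expR m * fine (P Q))%R by rewrite mulr_ge0 ?fine_ge0 ?expR_ge0.
by move: (expR m * _)%R (expR 1) (expR A) e1 => x1 x2 x3 ? ? ?; nra.
Qed.

End tilting.

(* Parameters of [tilting_bound] for a sum of [m] terms with [r - 1 <= m <= r]; the
   last conclusion compares its lower bound with the target one. *)
Lemma cramer_choice (R : realFieldType) (k t r m s u C e del : R) :
  (0 <= m)%R -> (0 <= s)%R -> (0 <= u)%R -> (0 <= C)%R -> (0 <= e)%R ->
  (r - 1 <= m)%R -> (m <= r)%R -> (u * C <= e / 2)%R -> (`|t| * e <= del / 3)%R ->
  (2 * (u * s + 2) < r * (u * e))%R -> (`|k| + 1 < r * (del / 3))%R ->
  let M := (r * (t * s) + r * (`|t| * e))%R in
  [/\ (t * (r * (s - e)) <= M)%R, (t * (r * (s + e)) <= M)%R,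
      (m * (k + u * s + u ^+ 2 * C) - u * (r * (s + e)) + 2 <= m * k)%R,
      (m * (k - u * s + u ^+ 2 * C) + u * (r * (s - e)) + 2 <= m * k)%R &
      (- (r * (t * s - k + del)) <= m * k - M - 1)%R].
Proof.
move=> m0 s0 u0 C0 e0 rm mr uC te r1 r2 M.
have rr : (0 <= r)%R := le_trans m0 mr.
have us0 : (0 <= u * s)%R by rewrite mulr_ge0.
have uuC : (u * (u * C) <= u * (e / 2))%R by rewrite ler_wpM2l.
have muC := ler_pM m0 (mulr_ge0 u0 (mulr_ge0 u0 C0)) mr uuC.
have kk := ler_norm k; have kk' : (- `|k| <= k)%R by rewrite lerNl -normrN ler_norm.
have t1 : (- t * e <= `|t| * e)%R.
  by rewrite ler_wpM2r//; have := ler_norm (- t)%R; rewrite normrN.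
have t2 : (t * e <= `|t| * e)%R by rewrite ler_wpM2r// ler_norm.
have rt1 := ler_wpM2l rr t1; have rt2 := ler_wpM2l rr t2; have rte := ler_wpM2l rr te.
have h1 : (m * (u * s) <= r * (u * s))%R by rewrite ler_wpM2r.
have h2 : ((r - m) * (u * s) <= 1 * (u * s))%R by rewrite ler_wpM2r//; lra.
have h3 : ((r - m) * k <= 1 * `|k|)%R.
  apply: (@le_trans _ _ ((r - m) * `|k|))%R; first by rewrite ler_wpM2l// subr_ge0.
  by rewrite ler_wpM2r//; lra.
by rewrite /M expr2; split; lra.
Qed.

(** * Local lower bounds over one generation *)

Section local_bounds.
Context (R : realType) d (T : measurableType d) (P : probability T R).
Context (W : T -> R) (c : \bar R).
Hypothesis HW : cascade_weight P W c.

Let c0 := weight_gt0 HW.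
Let mW := weight_measurable HW.
Let W0 := weight_ge0 HW.

Local Notation M := (moment P W 0).
Local Notation K := (cumulant P W).
Local Notation tilt := (tilted_mean P W).
Local Notation rate := (cascade_rate P W c).
Local Notation Lst := (legendre (log_laplace P W)).

Lemma root_sum_mgf r (V : seq 'I_r -> T -> R) (l : seq 'I_r) t : iid_family P W V ->
  uniq l -> t%:E < c ->
  \int[P]_x (expR (t * \sum_(j <- l) V [:: j] x))%:E = (M t ^+ size l)%:E.
Proof.
move=> iidV ul tc.
pose f (i : 'I_r) (u : R * R) : R := expR (t * u.1).
have mf i : measurable_fun setT (f i).
  apply: (@measurableT_comp _ _ _ _ _ _ expR) => //.
  by apply: measurable_funM.
have f0 i u : (0 <= f i u)%R by exact: expR_ge0.
have := expectation_prod iidV 0 ul mf f0; rewrite /f /= => H.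
transitivity (\int[P]_x (\prod_(i <- l) expR (t * V [:: i] x))%:E).
  by apply: eq_integral => x _; rewrite mulr_sumr expR_sum.
rewrite H; under eq_bigr do rewrite (expectation_root_exp HW iidV) (momentE HW)//.
elim: l {H ul} => [|j l ih]; first by rewrite big_nil expr0.
by rewrite big_cons ih exprS EFinM.
Qed.

Lemma moment_second_order_exp t b u : (0 <= b)%R -> (t + b)%:E < c -> (`|u| <= b)%R ->
  (M (t + u) <= expR (K t + u * tilt t + u ^+ 2 * (moment P W 2 (t + b) / M t)))%R.
Proof.
move=> b0 tbc ub.
have tc : t%:E < c by apply: le_lt_trans tbc; rewrite lee_fin lerDl.
have Mt := moment_gt0 HW tc.
apply: (le_trans (moment_second_order HW b0 tbc ub)).
rewrite -[in leRHS]addrA [leRHS]expRD (expR_cumulant HW tc).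
apply: (@le_trans _ _ (M t * (1 + (u * tilt t + u ^+ 2 * (moment P W 2 (t + b) / M t)))))%R.
  rewrite /tilted_mean le_eqVlt; apply/orP; left; apply/eqP.
  move: (M t) (moment P W 1 t) (moment P W 2 _) Mt => x y z x0.
  by field; rewrite gt_eqF.
by rewrite ler_pM2l// expR_ge1Dx.
Qed.

(** Stated for at least [r - 1] letters, because the offspring that carries the big jump is left out
    of the sum. *)
Lemma cramer_local t e del : t%:E < c -> (0 < e)%R -> (0 < del)%R ->
  eventually_iid P W (fun r V => forall l : seq 'I_r, uniq l -> (r.-1 <= size l)%N ->
    (expR (- (r%:R * (t * tilt t - K t + del))))%:E <=
    P [set x | (r%:R * (tilt t - e) < \sum_(j <- l) V [:: j] x < r%:R * (tilt t + e))%R]).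
Proof.
move=> tc e0 d0; have [b' [tb bc]] := real_between tc.
pose b := (b' - t)%R.
have b0 : (0 < b)%R by rewrite subr_gt0.
have tbc : (t + b)%:E < c by rewrite /b subrKC.
pose C := (moment P W 2 (t + b) / M t)%R.
have Mt := moment_gt0 HW tc.
have C0 : (0 <= C)%R by rewrite divr_ge0 ?(moment_ge0 HW)// ltW.
have s0 := tilt_ge0 HW t.
have Kexp := expR_cumulant HW tc.
have upK u := @moment_second_order_exp t b u (ltW b0) tbc.
rewrite -/C in upK.
move: (K t) (tilt t) s0 Kexp upK {tbc} (tbc) => k s s0 Kexp upK tbc.
have t10 : (0 < `|t| + 1)%R by rewrite ltr_wpDl.
pose e1 := Num.min e (del / 3 / (`|t| + 1))%R.
have e10 : (0 < e1)%R by rewrite lt_min e0 !divr_gt0.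
have e1e : (e1 <= e)%R by rewrite ge_min lexx.
have te1 : (`|t| * e1 <= del / 3)%R.
  apply: (@le_trans _ _ ((`|t| + 1) * e1))%R; first by rewrite ler_wpM2r ?lerDl// ltW.
  by rewrite mulrC -ler_pdivlMr// ge_min lexx orbT.
(* The second order cost [u ^+ 2 * C] of perturbing the tilt stays below half of the first order
   gain [u * e1]. *)
pose u := Num.min b (e1 / 2 / (C + 1))%R.
have C10 : (0 < C + 1)%R by rewrite ltr_wpDl.
have u0 : (0 < u)%R by rewrite lt_min b0 !divr_gt0.
have ub : (u <= b)%R by rewrite ge_min lexx.
have uC : (u * C <= e1 / 2)%R.
  apply: (@le_trans _ _ (u * (C + 1)))%R; first by rewrite ler_wpM2l ?lerDl// ltW.
  by rewrite -ler_pdivlMr// ge_min lexx orbT.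
have ue : (0 < u * e1)%R by rewrite mulr_gt0.
clearbody u e1 C.
near=> r; have r0 : (0 < r)%N by near: r; exact: nbhs_infty_gt.
split => // V iidV l ul rl.
have lr : (size l <= r)%N by rewrite -[leqRHS](card_ord r) -(card_uniqP ul) max_card.
have rm : (r%:R - 1 <= (size l)%:R :> R)%R.
  by rewrite lerBlDr natr1 ler_nat; move: rl; rewrite -ltnS prednK.
have mr : ((size l)%:R <= r%:R :> R)%R by rewrite ler_nat.
set m : R := (size l)%:R in rm mr.
have m0 : (0 <= m)%R by rewrite /m.
have r1 : (2 * (u * s + 2) / (u * e1) < r%:R)%R by near: r; exact: near_natr_gt.
rewrite ltr_pdivrMr// in r1.
have r2 : ((`|k| + 1) / (del / 3) < r%:R)%R by near: r; exact: near_natr_gt.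
rewrite ltr_pdivrMr ?divr_gt0// in r2.
have mS : measurable_fun setT (fun x => \sum_(j <- l) V [:: j] x)%R.
  by apply: measurable_sum => j; case: iidV.
have [C1 C2 C3 C4 C5] := cramer_choice m0 s0 (ltW u0) C0 (ltW e10) rm mr uC te1 r1 r2.
have powE (x : R) i : (expR x ^+ i = expR (i%:R * x))%R by rewrite expRM_natl.
have H := @tilting_bound _ _ _ P _ t u _ _ _ _ _ _ mS (ltW u0) C1 C2 _ _ _ C3 C4.
apply: (le_trans _ (le_trans (H _ _ _) _)).
- by rewrite lee_fin ler_expR.
- by rewrite root_sum_mgf// -Kexp powE.
- rewrite root_sum_mgf//; last by apply: le_lt_trans tbc; rewrite lee_fin lerD2l.
  rewrite lee_fin -powE lerXn2r ?nnegrE ?(moment_ge0 HW) ?expR_ge0//.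
  by apply: upK; rewrite gtr0_norm.
- rewrite root_sum_mgf//; last by apply: le_lt_trans tc; rewrite lee_fin gerBl ltW.
  rewrite lee_fin -powE lerXn2r ?nnegrE ?(moment_ge0 HW) ?expR_ge0//.
  have := upK (- u)%R.
  by rewrite normrN gtr0_norm// sqrrN mulNr => /(_ ub).
apply: le_measure; rewrite ?inE.
- exact: measurable_set_oo.
- exact: measurable_set_oo.
- move=> x /= /andP[h1 h2]; apply/andP; split.
    by apply: le_lt_trans h1; rewrite ler_wpM2l// lerD2l lerN2.
  by apply: (lt_le_trans h2); rewrite ler_wpM2l// lerD2l.
Unshelve. all: by end_near.
Qed.

Lemma one_half_le (y : R) : (0 <= y)%R -> (y <= 2^-1)%R -> (expR (- (2 * y)) <= 1 - y)%R.
Proof.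
move=> y0 y1; rewrite expRN.
have := expR_ge1Dx (2 * y)%R => h.
have e0 := expR_gt0 (2 * y)%R.
by rewrite -[leLHS]mul1r ler_pdivrMr//; nra.
Qed.

(** With [y = C / r] the bound is the constant [exp (- 2 * C)]: Chebyshev's rate [1 / r] is enough
    to keep all the other masses near 1 at once. *)
Lemma prod_lower (J : Type) (l : seq J) (a : J -> \bar R) (y : R) (r : nat) :
  (0 <= y)%R -> (y <= 2^-1)%R -> (size l <= r)%N ->
  (forall j, (1 - y)%:E <= a j) -> (expR (- (2 * (r%:R * y))))%:E <= \prod_(j <- l) a j.
Proof.
move=> y0 y1 lr H.
have y10 : (0 <= 1 - y)%R by lra.
apply: (@le_trans _ _ ((1 - y) ^+ size l)%:E).
  rewrite lee_fin (_ : (- (2 * (r%:R * y)) = r%:R * (- (2 * y)))%R); last by ring.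
  rewrite expRM_natl; apply: (@le_trans _ _ ((1 - y) ^+ r)%R).
    by apply: lerXn2r; rewrite ?nnegrE ?expR_ge0//; exact: one_half_le.
  by apply: ler_wiXn2l => //; lra.
elim: l {lr} => [|j l ih]; first by rewrite big_nil expr0.
rewrite big_cons exprS EFinM; apply: lee_pmul => //.
by rewrite lee_fin exprn_ge0.
Qed.

(** The window is a difference of two tails, so the exponents at its ends must be separated. The
    value [w = 0] is treated apart; it is the only possible one when [c] is infinite. *)
Lemma weight_above w y e : (0 <= w)%R -> (0 < e)%R -> c * w%:E < y%:E ->
  \forall k \near +oo%R, (expR (- (k * y)))%:E <=
    P (W @^-1` `[(k * w)%R, (k * (w + e))%R]).
Proof.
move=> w0 e0 cwy.
have y0 : (0 < y)%R.
  by rewrite -lte_fin; apply: le_lt_trans cwy; rewrite mule_ge0 ?lee_fin// ltW.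
have mtail (a : R) : measurable [set x | (a <= W x)%R] by exact: (measurable_tail HW).
have split_ge (k q1 q2 : R) : (q2 <= q1)%R ->
    (expR (- q2))%:E <= P [set x | (k * w <= W x)%R] ->
    P [set x | (k * (w + e) <= W x)%R] <= (expR (- q1))%:E ->
    (expR (- q2) - expR (- q1))%:E <= P (W @^-1` `[(k * w)%R, (k * (w + e))%R]).
  move=> q12 h1 h2; rewrite EFinB leeBlDr//.
  apply: (le_trans h1); apply: (@le_trans _ _ (P (W @^-1` `[(k * w)%R, (k * (w + e))%R]) +
      P [set x | (k * (w + e) <= W x)%R])); last by rewrite leeD2l.
  apply: le_trans (measureU2 _ _ _); last 2 first.
  - exact: measurable_preimage_fun.
  - exact: mtail.
  apply: le_measure; rewrite ?inE.
  - exact: mtail.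
  - by apply: measurableU; [exact: measurable_preimage_fun|exact: mtail].
  - move=> x /= h; rewrite in_itv/= h /=.
    by case: (leP (W x) (k * (w + e))%R) => [h'|/ltW h']; [left|right].
have half (x : R) : (1 <= x)%R -> (expR (- x) <= 2^-1)%R.
  move=> x1; rewrite expRN lef_pV2 ?posrE ?expR_gt0//.
  by have := expR_ge1Dx x; lra.
have [w00|wn0] := eqVneq w 0%R.
  rewrite w00 in split_ge *.
  have [b [b0 bc]] := weight_between HW.
  have [N [_ HN]] := tail_le HW bc.
  near=> k; have k0 : (0 < k)%R by near: k; apply: nbhs_pinfty_gt; exact: num_real.
  have kN : (N / e < k)%R by near: k; apply: nbhs_pinfty_gt; exact: num_real.
  rewrite ltr_pdivrMr// in kN.
  have kb : (1 / (b * e) < k)%R by near: k; apply: nbhs_pinfty_gt; exact: num_real.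
  rewrite ltr_pdivrMr ?mulr_gt0// in kb.
  have ky : (1 / y < k)%R by near: k; apply: nbhs_pinfty_gt; exact: num_real.
  rewrite ltr_pdivrMr// in ky.
  have := @split_ge k (b * (k * e))%R 0%R; rewrite mulr0 add0r oppr0 expR0 => H.
  apply: le_trans (H _ _ (HN _ kN)).
  - have h1 := half _ (ltW ky); have h2 := half (b * (k * e))%R.
    by rewrite lee_fin; have := h2 _; lra.
  - by rewrite mulr_ge0 ?mulr_ge0// ltW.
  - rewrite (_ : [set x | _] = setT); first by rewrite (@probability_setT _ _ _ P).
    by apply/seteqP; split => x //= _; exact: W0.
have {wn0} w0' : (0 < w)%R by rewrite lt_neqAle eq_sym wn0.
have [r0 cr] : exists r0 : R, c = r0%:E.
  case: (c) c0 cwy => [r0| |]// _; first by exists r0.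
  by rewrite gt0_mulye ?lte_fin.
have r00 : (0 < r0)%R by rewrite -lte_fin -cr.
rewrite cr -EFinM lte_fin in cwy.
(* The first bound keeps [(r0 + eps) * w] below [y]; the second separates it from
   [(r0 - eps) * (w + e)], the exponent at the other end. *)
pose eps := Num.min ((y - r0 * w) / (2 * w))%R (r0 * e / (2 * (2 * w + e)))%R.
have we0 : (0 < 2 * w + e)%R by rewrite addr_gt0// mulr_gt0.
have eps0 : (0 < eps)%R.
  by rewrite lt_min !divr_gt0 ?mulr_gt0// subr_gt0.
have eps1 : (eps * (2 * w) <= y - r0 * w)%R.
  by rewrite -ler_pdivlMr ?mulr_gt0// ge_min lexx.
have eps2 : (eps * (2 * (2 * w + e)) <= r0 * e)%R.
  by rewrite -ler_pdivlMr ?mulr_gt0// ge_min lexx orbT.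
have c1 : c < (r0 + eps)%:E by rewrite cr lte_fin ltrDl.
have c2 : (r0 - eps)%:E < c by rewrite cr lte_fin gtrBl.
have [N1 [_ HN1]] := tail_ge HW c1.
have [N2 [_ HN2]] := tail_le HW c2.
have re0 : (0 < r0 * e)%R by rewrite mulr_gt0.
have yw0 : (0 < y - r0 * w)%R by rewrite subr_gt0.
near=> k; have k0 : (0 < k)%R by near: k; apply: nbhs_pinfty_gt; exact: num_real.
have kN1 : (N1 / w < k)%R by near: k; apply: nbhs_pinfty_gt; exact: num_real.
rewrite ltr_pdivrMr// in kN1.
have kN2 : (N2 / (w + e) < k)%R by near: k; apply: nbhs_pinfty_gt; exact: num_real.
rewrite ltr_pdivrMr ?addr_gt0// in kN2.
have k1 : (2 / (r0 * e) < k)%R by near: k; apply: nbhs_pinfty_gt; exact: num_real.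
rewrite ltr_pdivrMr// in k1.
have k2 : (2 / (y - r0 * w) < k)%R by near: k; apply: nbhs_pinfty_gt; exact: num_real.
rewrite ltr_pdivrMr// in k2.
pose q2 := ((r0 + eps) * (k * w))%R; pose q1 := ((r0 - eps) * (k * (w + e)))%R.
have q12 : (1 <= q1 - q2)%R.
  have := ler_wpM2l (ltW k0) eps2; rewrite /q1 /q2; lra.
have q2y : (q2 <= k * y - 1)%R.
  have := ler_wpM2l (ltW k0) eps1; rewrite /q2; lra.
apply: le_trans (split_ge k q1 q2 _ (HN1 _ kN1) (HN2 _ kN2)); last by lra.
have e2 := expR_gt0 (- q2)%R.
rewrite lee_fin; have -> : expR (- q1) = (expR (- q2) * expR (- (q1 - q2)))%R.
  by rewrite -expRD; congr expR; ring.
have h1 := half _ q12.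
have h2 : (expR (- (k * y)) <= expR (- q2) * 2^-1)%R.
  apply: (@le_trans _ _ (expR (- q2) * expR (- 1))%R).
    by rewrite -expRD ler_expR; lra.
  by rewrite ler_pM2l// half.
by apply: (le_trans h2); nra.
Unshelve. all: by end_near.
Qed.

Lemma mass_close_bound n h : (0 < h)%R -> exists C, (0 <= C)%R /\
  eventually_iid P W (fun r V => (C / r%:R <= 2^-1)%R /\
    (1 - C / r%:R)%:E <= P (mass V n @^-1` `[(1 - h)%R, (1 + h)%R])).
Proof.
move=> h0; have [C [C0 H]] := chebyshev_mass HW n.
pose C' := (C / h ^+ 2)%R.
have C'0 : (0 <= C')%R by rewrite divr_ge0// exprn_ge0// ltW.
exists C'; split => //.
near=> r; have r0 : (0 < r)%N by near: r; exact: nbhs_infty_gt.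
have r0' : (0 < r%:R :> R)%R by rewrite ltr0n.
split => // V iidV; split.
  rewrite ler_pdivrMr//; have : (2 * C' < r%:R)%R by near: r; exact: near_natr_gt.
  by move=> ?; lra.
have mZ := measurable_mass n iidV.
have mB := measurable_far_set 1%R h mZ.
apply: (@le_trans _ _ (P (~` [set x | (h <= `|mass V n x - 1|)%R]))).
  rewrite probability_setC// EFinB leeB//.
  by apply: le_trans (H r V h r0 iidV h0) _; rewrite /C' invfM mulrA mulrAC.
apply: le_measure; rewrite ?inE.
- exact: measurableC.
- exact: measurable_preimage_fun.
- move=> x /= /negP; rewrite -ltNge ltr_norml in_itv/= => /andP[h1 h2].
  by apply/andP; split; lra.
Unshelve. all: by end_near.
Qed.

Definition others r (i0 : 'I_r) : seq 'I_r := [seq j <- enum 'I_r | j != i0].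

Lemma uniq_others r (i0 : 'I_r) : uniq (others i0).
Proof. by rewrite filter_uniq// enum_uniq. Qed.

Lemma size_others r (i0 : 'I_r) : size (others i0) = r.-1.
Proof.
rewrite -(card_uniqP (uniq_others i0)) -[in RHS](card_ord r) -(cardC1 i0).
by apply: eq_card => j; rewrite mem_filter mem_enum andbT.
Qed.

Lemma mem_others r (i0 j : 'I_r) : (j \in others i0) = (j != i0).
Proof. by rewrite mem_filter mem_enum andbT. Qed.

Lemma massS_others n r (V : seq 'I_r -> T -> R) (i0 : 'I_r) x : mass V n.+1 x =
  (r%:R^-1 * (V [:: i0] x * mass (shift V i0) n x +
   \sum_(j <- others i0) V [:: j] x * mass (shift V j) n x))%R.
Proof.
rewrite massS (bigD1 i0)//=; congr (_ * (_ + _))%R.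
by rewrite big_filter big_enum_cond.
Qed.

Lemma sigma_sum_good n r (V : seq 'I_r -> T -> R) (i0 : 'I_r) C G : iid_family P W V ->
  measurable C -> measurable G ->
  <<s cylinders V (first_letter [set j | j != i0]) >>
    ((fun x => \sum_(j <- others i0) V [:: j] x)%R @^-1` C `&`
     [set x | forall j, j \in others i0 -> G (mass (shift V j) n x)]).
Proof.
move=> iidV mC mG; apply: sigma_setI.
  apply: sigma_preimage => //.
  have : {subset others i0 <= [pred j | j != i0]} by move=> j; rewrite mem_others.
  elim: (others i0) => [_|j l ih sub].
    rewrite (_ : (fun x => _) = cst 0%R); first exact: measurable_cst.
    by apply/funext => x; rewrite big_nil.
  rewrite (_ : (fun x => _) = (fun x => V [:: j] x + \sum_(j <- l) V [:: j] x)%R); last first.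
    by apply/funext => x; rewrite big_cons.
  apply: measurable_funD; last by apply: ih => k kl; apply: sub; rewrite inE kl orbT.
  apply: gen_measurable_coord; exists j, [::]; split => //.
  by apply: (sub j); rewrite mem_head.
have [_] := sub_words_prod iidV n (uniq_others i0) mG.
apply: sigmaW => w [j [u [jl _ ->]]]; exists j, u; split => //.
by move: jl; rewrite mem_others.
Qed.

Lemma jump_deviation (w z s e1 x1 z1 S y : R) : (0 <= w)%R -> (0 <= z)%R -> (0 <= s)%R ->
  (0 < e1)%R -> (e1 <= 1)%R -> (w <= x1 <= w + e1)%R -> (`|z1 - z| < e1)%R ->
  (0 <= z1)%R -> (s - e1 < S < s + e1)%R -> ((1 - e1) * S <= y <= (1 + e1) * S)%R ->
  (`|x1 * z1 + y - (w * z + s)| <= e1 * (w + z + s + 4))%R.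
Proof.
move=> w0 z0 s0 e10 e11 /andP[x1w x1w'] hz z10 /andP[S1 S2] /andP[y1 y2].
move: hz; rewrite ltr_norml => /andP[hz1 hz2].
have a1 : (w * z - e1 * w <= x1 * z1)%R.
  by apply: (@le_trans _ _ (w * z1))%R; nra.
have a2 : (x1 * z1 <= w * z + e1 * (w + z + 1))%R.
  apply: (@le_trans _ _ ((w + e1) * z1))%R; nra.
have b1 : (s - e1 * (s + 2) <= y)%R by nra.
have b2 : (y <= s + e1 * (s + 2))%R by nra.
by rewrite ler_norml; apply/andP; split; nra.
Qed.

Lemma one_step_local n w z t y1 y2 del e : (0 <= w)%R -> (0 <= z)%R -> t%:E < c ->
  (0 < e)%R -> (0 < del)%R -> c * w%:E < y1%:E ->
  (forall e', (0 < e')%R -> eventually_iid P W (fun r V =>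
     (expR (- (r%:R * y2)))%:E <= P [set x | (`|mass V n x - z| < e')%R])) ->
  eventually_iid P W (fun r V =>
     (expR (- (r%:R * (y1 + y2 + (t * tilt t - K t) + del))))%:E <=
     P [set x | (`|mass V n.+1 x - (w * z + tilt t)| < e)%R]).
Proof.
move=> w0 z0 tc e0 d0 wy1 Hz.
have s0 := tilt_ge0 HW t.
set s := tilt t in s0 *.
have den : (0 < w + z + s + 4)%R by lra.
(* The denominator is the sensitivity computed in [jump_deviation]. *)
pose e1 := Num.min 1%R (e / 2 / (w + z + s + 4))%R.
have e10 : (0 < e1)%R by rewrite lt_min ltr01 !divr_gt0.
have e11 : (e1 <= 1)%R by rewrite ge_min lexx.
have e1e : (e1 * (w + z + s + 4) <= e / 2)%R.
  by rewrite -ler_pdivlMr// ge_min lexx orbT.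
have [C [C0 HC]] := mass_close_bound n e10.
have del2 : (0 < del / 2)%R by rewrite divr_gt0.
have HW1 := weight_above w0 e10 wy1.
have HS := cramer_local tc e10 del2.
have Hz1 := Hz e1 e10.
have HW1' : \forall r \near \oo, (expR (- (r%:R * y1)))%:E <=
    P (W @^-1` `[(r%:R * w)%R, (r%:R * (w + e1))%R]).
  have [N [_ HN]] := HW1.
  near=> r; apply: HN; near: r; exact: near_natr_gt.
near=> r; have r0 : (0 < r)%N by near: r; exact: nbhs_infty_gt.
split => // V iidV.
have r0' : (0 < r%:R :> R)%R by rewrite ltr0n.
pose i0 := Ordinal r0.
have hW : (expR (- (r%:R * y1)))%:E <= P (W @^-1` `[(r%:R * w)%R, (r%:R * (w + e1))%R]).
  by near: r; exact: HW1'.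
have [_ /= hz] : holds_at Hz1 r by near: r; exact: Hz1.
have [_ /= hS] : holds_at HS r by near: r; exact: HS.
have [_ /= hC] : holds_at HC r by near: r; exact: HC.
(* The constant [2 * C] is the total cost of keeping the other masses near 1; it must fit in half of
   the slack [r * del]. *)
have rC : (2 * C / (del / 2) < r%:R)%R by near: r; exact: near_natr_gt.
rewrite ltr_pdivrMr// in rC.
pose G : set R := `[(1 - e1)%R, (1 + e1)%R]%classic.
pose A := `[(r%:R * w)%R, (r%:R * (w + e1))%R]%classic.
pose B := [set y : R | (`|y - z| < e1)%R].
pose C1 := [set y : R | (r%:R * (s - e1) < y < r%:R * (s + e1))%R].
have mG : measurable G by exact: measurable_itv.
have mA : measurable A by exact: measurable_itv.
have mB : measurable B by exact: (measurable_ball_set _ _ (@measurable_id _ R setT)).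
have mC1 : measurable C1.
  rewrite (_ : C1 = `](r%:R * (s - e1))%R, (r%:R * (s + e1))%R[%classic) //.
pose E := ((fun x => \sum_(j <- others i0) V [:: j] x)%R @^-1` C1 `&`
     [set x | forall j, j \in others i0 -> G (mass (shift V j) n x)]).
have sE := @sigma_sum_good n r V i0 C1 G iidV mC1 mG.
have mE : measurable E by exact: (sigma_cylinders_measurable (let: And4 m _ _ _ := iidV in m) sE).
have PE : (expR (- (r%:R * (t * s - K t + del))))%:E <= P E.
  rewrite /E (sum_good iidV n (uniq_others i0) mG mC1).
  apply: (@le_trans _ _ ((expR (- (r%:R * (t * s - K t + del / 2))))%:E *
      (expR (- (2 * (r%:R * (C / r%:R)))))%:E)).
    rewrite -EFinM -expRD lee_fin ler_expR.
    by rewrite (_ : (r%:R * (C / r%:R) = C)%R); [lra|field; rewrite gt_eqF].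
  apply: lee_pmul; rewrite ?lee_fin ?expR_ge0//.
    by apply: hS => //; [exact: uniq_others|rewrite size_others].
  apply: prod_lower.
  - by rewrite divr_ge0.
  - exact: (hC V iidV).1.
  - by rewrite size_others leq_pred.
  - by move=> j; apply: (hC _ (iid_shift j iidV)).2.
have -> : (- (r%:R * (y1 + y2 + (t * s - K t) + del)) =
    - (r%:R * y1) + (- (r%:R * y2) + - (r%:R * (t * s - K t + del))))%R by ring.
rewrite expRD expRD !EFinM.
apply: (@le_trans _ _ (P (W @^-1` A) * (P (mass (shift V i0) n @^-1` B) * P E))).
  apply: lee_pmul; rewrite ?mule_ge0 ?lee_fin ?expR_ge0//.
  apply: lee_pmul; rewrite ?lee_fin ?expR_ge0//.
  by apply: hz; exact: iid_shift.
rewrite -(one_jump iidV n mA mB sE).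
have mZ := measurable_mass n (iid_shift i0 iidV).
have mV0 : measurable_fun setT (V [:: i0]) by case: iidV.
have mZ1 := measurable_mass n.+1 iidV.
apply: le_measure; rewrite ?inE.
- apply: measurableI; first exact: measurable_preimage_fun.
  by apply: measurableI => //; exact: measurable_preimage_fun.
- exact: measurable_ball_set.
move=> x [/= xA [xB [xC xG]]].
rewrite /A /= in_itv/= in xA; rewrite /B /= in xB; rewrite /C1 /= in xC.
have V0 j : (0 <= V [:: j] x)%R by case: iidV.
set S := (\sum_(j <- others i0) V [:: j] x)%R in xC.
set y := (\sum_(j <- others i0) V [:: j] x * mass (shift V j) n x)%R.
have Gj j : j \in others i0 -> (1 - e1 <= mass (shift V j) n x <= 1 + e1)%R.
  by move=> /xG; rewrite /G /= in_itv.
have y1' : ((1 - e1) * S <= y)%R.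
  rewrite /S /y mulr_sumr !big_seq; apply: ler_sum => j /Gj /andP[h _].
  by rewrite mulrC ler_wpM2l.
have y2' : (y <= (1 + e1) * S)%R.
  rewrite /S /y mulr_sumr !big_seq; apply: ler_sum => j /Gj /andP[_ h].
  by rewrite (mulrC (1 + e1)%R) ler_wpM2l.
rewrite (massS_others n V i0) -/y.
have -> : (r%:R^-1 * (V [:: i0] x * mass (shift V i0) n x + y) =
   (V [:: i0] x / r%:R) * mass (shift V i0) n x + y / r%:R)%R by ring.
have /andP[xA1 xA2] := xA; have /andP[xC1 xC2] := xC.
apply: (@le_lt_trans _ _ (e1 * (w + z + s + 4))%R); last first.
  by apply: (le_lt_trans e1e); rewrite ltr_pdivrMr// ltr_pMr// ltr1n.
apply: (@jump_deviation _ _ _ _ _ _ (S / r%:R)%R) => //.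
- by rewrite ler_pdivlMr// ler_pdivrMr// mulrC xA1 mulrC.
- exact: (mass_ge0 _ _ (iid_shift i0 iidV)).
- by rewrite ltr_pdivlMr// ltr_pdivrMr// mulrC xC1 mulrC.
- by rewrite !mulrA !ler_pM2r ?invr_gt0// y1' y2'.
Unshelve. all: by end_near.
Qed.

End local_bounds.

(** * Local lower bounds at all heights, and the large deviations *)

Section part2.
Context (R : realType) d (T : measurableType d) (P : probability T R).
Context (W : T -> R) (c : \bar R).
Hypothesis HW : cascade_weight P W c.

Let c0 := weight_gt0 HW.

Local Notation M := (moment P W 0).
Local Notation K := (cumulant P W).
Local Notation tilt := (tilted_mean P W).
Local Notation rate := (cascade_rate P W c).
Local Notation Lst := (legendre (log_laplace P W)).

(* Offsprings with a tilted mean [tilt t] only reach part of the range of [s];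
   when [s] is above it, the missing mass is provided by the big jump. *)
Lemma local_target (w z s y e : R) : (0 <= w)%R -> (0 <= z)%R -> (0 <= s)%R ->
  (0 < e)%R -> c * w%:E + Lst s < y%:E ->
  exists w' z' t, [/\ (0 <= w')%R, z' = z \/ z' = Num.max z 1%R, t%:E < c,
    (`|w' * z' + tilt t - (w * z + s)| < e)%R &
    c * w'%:E < (y - (t * tilt t - K t))%:E].
Proof.
move=> w0 z0 s0 e0 H.
have cw0 : 0 <= c * w%:E by rewrite mule_ge0 ?lee_fin// ltW.
have l0 := legendre_ge0 HW s.
have [cw cwE] : exists cw : R, c * w%:E = cw%:E.
  case: (c * w%:E) cw0 H => [x| |]//=; first by exists x.
  by case: (Lst s) l0.
have [l lE] : exists l : R, Lst s = l%:E.
  rewrite cwE in H; case: (Lst s) l0 H => [x| |]//=; by exists x.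
rewrite cwE lE -EFinD lte_fin in H; rewrite lE lee_fin in l0.
have Lge t : t%:E < c -> (t * s - K t <= l)%R.
  by move=> tc; rewrite -lee_fin -lE; exact: (legendre_ge_cumulant HW).
have tan t u : t%:E < c -> u%:E < c -> (K t + (u - t) * tilt t <= K u)%R.
  exact: (cumulant_tangent HW).
have K0 : K 0 = 0%R by exact: cumulant0.
have g0 := tilt_ge0 HW; have ivt := tilt_ivt HW.
move: {lE} (cumulant P W) (tilted_mean P W) K0 Lge tan g0 ivt => k g k0 Lge tan g0 ivt.
have tan0 t : t%:E < c -> (k t <= t * g t)%R.
  by move=> tc; have := tan t 0%R tc c0; rewrite k0; lra.
have mono t u : t%:E < c -> u%:E < c -> (t <= u)%R -> (g t <= g u)%R.
  move=> tc uc; rewrite le_eqVlt => /orP[/eqP->//|tu].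
  have h1 := tan t u tc uc; have h2 := tan u t uc tc.
  by rewrite -(ler_pM2l (_ : 0 < u - t)%R) ?subr_gt0//; clear -h1 h2; lra.
(* A tilt whose mean is within [e] of [s], with [t * g t <= t * s], needs no change of the jump: it
   costs at most [t * s - k t <= l]. *)
have keep t : t%:E < c -> (`|g t - s| < e)%R -> (t * g t <= t * s)%R ->
    exists w' z' t, [/\ (0 <= w')%R, z' = z \/ z' = Num.max z 1%R, t%:E < c,
    (`|w' * z' + g t - (w * z + s)| < e)%R &
    c * w'%:E < (y - (t * g t - k t))%:E].
  move=> tc te ts; exists w, z, t; split => //; first by left.
    by rewrite opprD addrACA subrr add0r.
  by rewrite cwE lte_fin; have := Lge t tc; lra.
have A0 : (0 < y - cw)%R by lra.
have [[t [tc ts]]|nex] := pselect (exists t, t%:E < c /\ g t = s).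
  by apply: (keep t) => //; rewrite ts// subrr normr0.
(* As [s] is not a tilted mean, the intermediate value property puts all tilted means on the same
   side of it. *)
have [above|] := pselect (forall t, t%:E < c -> (g t < s)%R); last first.
  move=> /existsNP[t1 /not_implyP[t1c /negP]]; rewrite -leNgt => st1.
  have below t : t%:E < c -> (s < g t)%R.
    move=> tc; rewrite ltNge; apply/negP => ts; apply: nex.
    have [tt1|tt1] := leP t t1.
      have [u [/andP[_ uu] uE]] := ivt _ _ _ tt1 t1c ts st1.
      by exists u; split => //; apply: le_lt_trans t1c; rewrite lee_fin.
    exists t; split => //; apply/eqP; rewrite eq_le ts/=.
    by apply: (le_trans st1); apply: mono => //; exact: ltW.
  (* At this strength, a mean still at distance [e] from [s] would force [l >= y - cw], against the
     hypothesis. The case [c = +oo] below is symmetric. *)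
  pose t := (- ((y - cw) / e))%R.
  have t0 : (t < 0)%R by rewrite oppr_lt0 divr_gt0.
  have tc : t%:E < c by apply: lt_trans c0; rewrite lte_fin.
  have hb := below t tc.
  have [h|h] := ltP (g t - s)%R e.
    by apply: (keep t) => //; [rewrite gtr0_norm ?subr_gt0|rewrite ler_wnM2l// ltW].
  have h1 := Lge t tc; have h2 := tan0 t tc.
  have : (- t * e <= - t * (g t - s))%R by rewrite ler_wpM2l// oppr_ge0 ltW.
  have : (- t * e = y - cw)%R by rewrite /t opprK divfK ?gt_eqF.
  move: t h1 h2 {tc t0 hb h} => t h1 h2 -> h3; exfalso; clear -h1 h2 h3 H; lra.
have [cy|[r0 cr]] : c = +oo \/ exists r : R, c = r%:E.
  by case: (c) c0 => [r| |]//; [right; exists r|left].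
  pose t := ((y - cw) / e)%R.
  have t0 : (0 < t)%R by rewrite divr_gt0.
  have tc : t%:E < c by rewrite cy ltry.
  have hb := above t tc.
  have [h|h] := ltP (s - g t)%R e.
    by apply: (keep t) => //; [rewrite distrC gtr0_norm ?subr_gt0|rewrite ler_wpM2l// ltW].
  have h1 := Lge t tc; have h2 := tan0 t tc.
  have : (t * e <= t * (s - g t))%R by rewrite ler_wpM2l// ltW.
  have : (t * e = y - cw)%R by rewrite /t divfK ?gt_eqF.
  move: t h1 h2 {tc t0 hb h} => t h1 h2 -> h3; exfalso; clear -h1 h2 h3 H; lra.
have r00 : (0 < r0)%R by rewrite -lte_fin -cr.
move: cwE; rewrite cr -EFinM => -[cwE].
have s10 : (0 < s + 1)%R by lra.
pose h := Num.min r0 ((y - cw - l) / 2 / (s + 1))%R.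
have h0 : (0 < h)%R by rewrite lt_min r00 !divr_gt0//; lra.
have hr : (h <= r0)%R by rewrite ge_min lexx.
have hs : (h * (s + 1) <= (y - cw - l) / 2)%R by rewrite -ler_pdivlMr// ge_min lexx orbT.
pose t := (r0 - h)%R.
have tc : t%:E < c by rewrite cr lte_fin gtrBl.
have z1 : (1 <= Num.max z 1)%R by rewrite le_max lexx orbT.
have zz : (z <= Num.max z 1)%R by rewrite le_max lexx.
have hb := above t tc; have tt0 := g0 t.
set z' := Num.max z 1%R in z1 zz.
have z'0 : (0 < z')%R by apply: lt_le_trans z1.
(* The missing mass [s - g t] goes to the jump. As [z' >= 1] this costs at most [r0 * (s - g t)],
   while lowering [s] to [g t] saves at least [t * (s - g t)], and [t] is within [h] of [r0]. *)
exists ((w * z + (s - g t)) / z')%R, z', t; split => //.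
- by apply: divr_ge0; [rewrite addr_ge0 ?mulr_ge0 ?subr_ge0// ltW|exact: ltW].
- by right.
- by rewrite -cr.
- by rewrite divfK ?gt_eqF// (_ : _ - _ = 0)%R ?normr0//; ring.
rewrite -EFinM lte_fin.
have h1 := Lge t tc.
have : ((w * z + (s - g t)) / z' <= w + (s - g t))%R.
  rewrite ler_pdivrMr// mulrDl lerD//; first by rewrite ler_wpM2l.
  by rewrite -[leLHS]mulr1 ler_wpM2l// subr_ge0 ltW.
move=> /(ler_wpM2l (ltW r00)); rewrite mulrDr cwE => h2.
have h3 : (h * (s - g t) <= h * (s + 1))%R by rewrite ler_pM2l//; lra.
rewrite /t in h1 h2 h3 *; clear -h1 h2 h3 H hs s10 h0; lra.
Qed.

Lemma local_lower n a x e : (0 < e)%R -> rate n a < x%:E ->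
  eventually_iid P W (fun r V =>
    (expR (- (r%:R * x)))%:E <= P [set u | (`|mass V n u - a| < e)%R]).
Proof.
elim: n a x e => [|n ih] a x e e0 H.
  move: H; rewrite /=; case: eqP => // ->; rewrite lte_fin => x0.
  near=> r; split; first by near: r; exact: nbhs_infty_gt.
  move=> V iidV; rewrite (_ : [set u | _] = setT) ?(@probability_setT _ _ _ P).
    by rewrite lee_fin -expR0 ler_expR oppr_le0 mulr_ge0// ltW.
  by apply/seteqP; split => u //= _; rewrite mass0 subrr normr0.
move: H => /ereal_inf_lt[_ [w [z [s [w0 z0 s0 wzs ->]]]] H].
have cw0 : 0 <= c * w%:E by rewrite mule_ge0 ?lee_fin// ltW.
have l0 := legendre_ge0 HW s.
have i0 := cascade_rate_ge0 HW n z.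
have {}H : c * w%:E + rate n z + Lst s < x%:E := H.
have [i iE] : exists i : R, rate n z = i%:E.
  move: (rate n z) i0 H => [i| |]//=; first by exists i.
  by case: (c * w%:E) cw0 => [?| |]//=; case: (Lst s) l0.
rewrite iE in H.
have H' : c * w%:E + Lst s < (x - i)%:E by rewrite EFinB lteBrDr// addeAC.
have [y [y1 y2]] := ereal_between H'; rewrite lte_fin in y2.
pose del := ((x - i - y) / 2)%R.
have d0 : (0 < del)%R by rewrite divr_gt0//; lra.
have e20 : (0 < e / 2)%R by rewrite divr_gt0.
have [w' [z' [t [w'0 hz' tc dev cost]]]] := local_target w0 z0 s0 e20 y1.
have [q [q1 q2]] := ereal_between cost; rewrite lte_fin in q2.
have z'0 : (0 <= z')%R by case: hz' => ->//; rewrite le_max z0.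
have rz' : rate n z' <= i%:E.
  by rewrite -iE; case: hz' => ->//; exact: cascade_rate_max1.
have Hz e' : (0 < e')%R -> eventually_iid P W (fun r V =>
     (expR (- (r%:R * (i + del))))%:E <= P [set u | (`|mass V n u - z'| < e')%R]).
  by move=> e'0; apply: ih => //; apply: le_lt_trans rz' _; rewrite lte_fin ltrDl.
have := one_step_local HW w'0 z'0 tc e20 d0 q1 Hz.
apply: filterS => r [r0 Hr]; split => // V iidV.
have mZ := measurable_mass n.+1 iidV.
apply: (@le_trans _ _ (P [set u | (`|mass V n.+1 u - (w' * z' + tilt t)| < e / 2)%R])).
  apply: le_trans (Hr V iidV).
  rewrite lee_fin ler_expR lerN2 ler_wpM2l// /del; lra.
apply: le_measure; rewrite ?inE; [exact: measurable_ball_set..|].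
move=> u /= hu; rewrite -wzs.
rewrite (_ : mass V n.+1 u - _ = (mass V n.+1 u - (w' * z' + tilt t)) +
  (w' * z' + tilt t - (w * z + s)))%R; last by ring.
by apply: (le_lt_trans (ler_normD _ _)); lra.
Unshelve. all: by end_near.
Qed.

Lemma eventually_family (V : forall r : nat, seq 'I_r -> T -> R)
  (Q : forall r, (seq 'I_r -> T -> R) -> Prop) :
  (forall r, (2 <= r)%N -> iid_family P W (@V r)) -> eventually_iid P W Q ->
  \forall r \near \oo, Q r (@V r).
Proof.
move=> iidV HQ; near=> r.
have [_ h] : holds_at HQ r by near: r.
by apply: h; apply: iidV; near: r; exact: nbhs_infty_ge.
Unshelve. all: by end_near.
Qed.

Lemma large_deviations (V : forall r : nat, seq 'I_r -> T -> R) n :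
  (forall r, (2 <= r)%N -> iid_family P W (@V r)) ->
  large_deviation_principle P (fun r => mass (@V r) n.+1) (fun r => r%:R) (rate n.+1).
Proof.
move=> iidV; apply: (@ldp_of_tails _ _ _ _ _ _ _ 1%R).
- by move=> r r2; exact: (measurable_mass n.+1 (iidV r r2)).
- exact: cvgr_idn.
- exact: (cascade_rate_ge0 HW).
- exact: (cascade_rate1 HW).
- by move=> a b a1 ab; exact: (cascade_rate_nondecreasing HW).
- move=> a b ab b1; rewrite !(cascade_rate_le1 HW)//; last exact: le_trans b1.
  exact: (legendre_nonincreasing HW).
- by move=> a x a1 xa; exact: (cascade_rate_lsc HW).
- move=> a x a1; rewrite (cascade_rate_le1 HW) ?ltW// => /(legendre_lsc HW)[e [e0 he]].
  exists (Num.min 1%R (a + e / 2)%R); split.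
  + by rewrite ge_min lexx.
  + by rewrite lt_min a1 ltrDl divr_gt0.
  rewrite (cascade_rate_le1 HW) ?ge_min ?lexx//; apply: he.
  have : (a < Num.min 1 (a + e / 2))%R by rewrite lt_min a1 ltrDl divr_gt0.
  have : (Num.min 1 (a + e / 2) <= a + e / 2)%R by rewrite ge_min lexx orbT.
  by move=> h1 h2; rewrite gtr0_norm ?subr_gt0//; lra.
- move=> a x a1 xa; apply: (eventually_family (Q := fun r V =>
    P [set x | (a <= mass V n.+1 x)%R] <= (expR (- (r%:R * x)))%:E) iidV).
  by apply: (upper_tail_holds HW) => //; exact: ltW.
- move=> a x a1; rewrite (cascade_rate_le1 HW) ?ltW// => xa.
  apply: (eventually_family (Q := fun r V =>
    P [set x | (mass V n.+1 x <= a)%R] <= (expR (- (r%:R * x)))%:E) iidV).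
  by apply: (lower_tail_holds HW) => //; exact: ltW.
- move=> a x e e0 H; apply: (eventually_family (Q := fun r V =>
    (expR (- (r%:R * x)))%:E <= P [set u | (`|mass V n.+1 u - a| < e)%R]) iidV).
  exact: local_lower.
Qed.

End part2.

(** Rescaled Bernoulli inequality, with equality at [B = b]. When the total mass is [b ^+ n.+1] and
    one offspring has mass [B ^+ n], in units of [s r], the first term is the jump of its weight and
    [n%:R * B] the cost of its mass. *)
Lemma bernoulli_sum (R : realFieldType) (n : nat) (b B : R) : (0 < b)%R -> (0 < B)%R ->
  (n.+1%:R * b <= b ^+ n.+1 / B ^+ n + n%:R * B)%R.
Proof.
move=> b0 B0; have bern k (u : R) : (0 <= u)%R -> (k.+1%:R * u <= u ^+ k.+1 + k%:R)%R.
  move=> u0; elim: k => [|k ih]; first by rewrite expr1 mul1r addr0.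
  have := ler_wpM2l u0 ih; rewrite mulrDr -exprS => h.
  have h2 : (0 <= k.+1%:R * (u - 1) ^+ 2)%R by rewrite mulr_ge0// sqr_ge0.
  rewrite expr2 in h2; move: h h2; rewrite -![in k.+2%:R]natr1 -!natr1.
  by move: (u ^+ k.+2)%R (k%:R)%R => v k'; nra.
have := bern n (b / B)%R (divr_ge0 (ltW b0) (ltW B0)).
move=> /(ler_wpM2r (ltW B0)).
have Bn : (B ^+ n != 0)%R by rewrite expf_neq0// gt_eqF.
rewrite mulrDl (_ : n.+1%:R * (b / B) * B = n.+1%:R * b)%R; last by field; rewrite gt_eqF.
rewrite (_ : (b / B) ^+ n.+1 * B = b ^+ n.+1 / B ^+ n)%R//.
by rewrite expr_div_n [in X in (_ / X)%R]exprS; field; rewrite Bn gt_eqF.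
Qed.

Lemma power_deviation (R : realFieldType) (e e1 b bn q v z : R) : (`|z - bn| < e1)%R ->
  (q < e / 2)%R -> (0 <= q)%R -> (b <= v)%R -> (v <= b + e1)%R -> (0 <= z)%R ->
  (e1 * (b + bn + 2) <= e / 2)%R -> (0 < e1)%R -> (e1 <= 1)%R -> (0 <= b)%R -> (0 < e)%R ->
  (0 <= bn)%R -> (`|v * z + q - b * bn| < e)%R.
Proof.
rewrite ltr_norml => /andP[z1 z2] q1 q0 v1 v2 z0 He e10 e11 b0 e0 bn0.
have h1 : (b * bn - e1 * b <= v * z)%R by apply: (@le_trans _ _ (b * z))%R; nra.
have h2 : (v * z <= b * bn + e1 * (b + bn + 1))%R.
  by apply: (@le_trans _ _ ((b + e1) * z))%R; nra.
by rewrite ltr_norml; apply/andP; split; nra.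
Qed.

(** * Very large deviations at an abstract scale [s] *)

Section very_large.
Context (R : realType) d (T : measurableType d) (P : probability T R).
Context (W : T -> R) (c : \bar R).
Hypothesis HW : cascade_weight P W c.

Let c0 := weight_gt0 HW.
Let W0 := weight_ge0 HW.

Local Notation M := (moment P W 0).
Local Notation K := (cumulant P W).

Variable s : nat -> R.
Hypothesis sy : s r @[r --> \oo] --> +oo%R.

Let s_gt A : \forall r \near \oo, (A < s r)%R.
Proof. by move: sy => /cvgryPgt; exact. Qed.

(* All masses are compared with [s r ^+ n], and probabilities with powers of
   [expR (- (r * s r))]: both are compatible with the recursion on [n]. *)
Definition power_tail th n := forall b x, (0 < b)%R -> (x < th * (n%:R * b))%R ->
  eventually_iid P W (fun r V => P (mass V n @^-1` `]((s r * b) ^+ n)%R, +oo[) <=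
    (expR (- (r%:R * s r * x)))%:E).

(** A crude bound, used for every offspring: its total cost [M ^+ r] is negligible at the speed
    [r * s r]. *)
Lemma truncated_exponential_le r (V : seq 'I_r -> T -> R) n i t z : iid_family P W V ->
  (0 <= t)%R -> (t * z)%:E < c ->
  \int[P]_x (expR (t * (V [:: i] x * mass (shift V i) n x)) *
    \1_(`]-oo, z]) (mass (shift V i) n x))%:E <= (M (t * z))%:E.
Proof.
move=> iidV t0 tz; apply: le_trans (expectation_exp_on HW iidV n i _ t0 (z := z) _) _ => //.
rewrite (momentE HW)// -[leRHS]mule1; apply: lee_wpmul2l.
  by rewrite lee_fin (moment_ge0 HW).
apply: probability_le1; apply: measurable_preimage_fun => //.
exact: (measurable_mass n (iid_shift i iidV)).
Qed.

Lemma power_cell n b B th x y (q : nat -> R) : (0 < th)%R -> th%:E < c -> (0 < B)%R ->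
  (x <= y + th * (b ^+ n.+1 / B ^+ n))%R ->
  eventually_iid P W (fun r V => P (mass V n @^-1` `]q r, +oo[) <=
    (expR (- (r%:R * s r * y)))%:E) ->
  eventually_iid P W (fun r V =>
    P [set u | [/\ (r%:R * (s r * b) ^+ n.+1 <= offspring_sum V n u)%R,
      (forall i, mass (shift V i) n u <= (s r * B) ^+ n)%R &
      exists i, (q r < mass (shift V i) n u)%R]] <=
    (r%:R * (M th ^+ r * expR (- (r%:R * s r * x))))%:E).
Proof.
move=> th0 thc B0 xy H; near=> r.
have [r0 /= H1] : holds_at H r by near: r; exact: H.
split => // V iidV.
have s0 : (0 < s r)%R by near: r; exact: s_gt.
have sB : (0 < (s r * B) ^+ n)%R by rewrite exprn_gt0// mulr_gt0.
(* Chosen so that [t] times the truncation level is exactly [th < c]. *)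
pose t := (th / (s r * B) ^+ n)%R.
have tB : (t * (s r * B) ^+ n = th)%R by rewrite /t divfK// gt_eqF.
have t0 : (0 <= t)%R by rewrite divr_ge0// ltW.
have tBc : (t * (s r * B) ^+ n)%:E < c by rewrite tB.
have h i : P (mass (shift V i) n @^-1` `]q r, +oo[) <= (expR (- (r%:R * s r * y)))%:E.
  by apply: H1; exact: iid_shift.
have hE i := truncated_exponential_le n i iidV t0 tBc.
rewrite tB in hE.
apply: le_trans (upper_tail_cell HW iidV (r%:R * (s r * b) ^+ n.+1)%R t0 tBc
  (expR_ge0 _) (moment_ge0 HW _ _) h hE) _.
have Mr : (M th * M th ^+ r.-1 = M th ^+ r)%R by rewrite -exprS prednK.
rewrite tB lee_fin ler_wpM2l// -Mr.
set ea := expR (- (r%:R * s r * y)); set eb := expR (- (t * _)).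
rewrite (_ : (ea * M th * M th ^+ r.-1 * eb = M th * M th ^+ r.-1 * (ea * eb))%R); last by ring.
rewrite ler_wpM2l ?mulr_ge0 ?exprn_ge0 ?(moment_ge0 HW)// /ea /eb -expRD ler_expR.
have -> : (t * (r%:R * (s r * b) ^+ n.+1) = r%:R * s r * (th * (b ^+ n.+1 / B ^+ n)))%R.
  rewrite /t !exprMn [(s r ^+ n.+1)%R]exprS; field.
  by rewrite !expf_neq0// gt_eqF.
have := ler_wpM2l (mulr_ge0 (ler0n R r) (ltW s0)) xy; lra.
Unshelve. all: by end_near.
Qed.

Lemma power_tail_holds th n : (0 < th)%R -> th%:E < c -> power_tail th n.
Proof.
move=> th0 thc; elim: n => [|n U] b x b0 xb.
  near=> r; split; first by near: r; exact: nbhs_infty_gt.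
  move=> V iidV; rewrite (_ : _ @^-1` _ = set0) ?measure0 ?lee_fin ?expR_ge0//.
  by apply/seteqP; split => // u /=; rewrite mass0 expr0 in_itv/= ltxx.
pose x1 := ((x + th * (n.+1%:R * b)) / 2)%R.
have xx1 : (x < x1)%R by rewrite /x1; lra.
have x1b : (x1 < th * (n.+1%:R * b))%R by rewrite /x1; lra.
pose Q := (th * (n.+1%:R * b))%R.
have Q0 : (0 < Q)%R by rewrite !mulr_gt0.
have [p [p1 px]] : exists p, (1 < p)%R /\ (p * x1 < Q)%R.
  have [x10|x10] := leP x1 0%R.
    by exists 2%R; split; [rewrite ltr1n|apply: le_lt_trans Q0; rewrite mulr_ge0_le0].
  have : (1 < Q / x1)%R by rewrite ltr_pdivlMr// mul1r.
  move=> h; exists ((1 + Q / x1) / 2)%R; split; first by lra.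
  by rewrite -ltr_pdivlMr//; lra.
have p0 : (0 < p)%R by apply: lt_trans p1.
(* The grid for the [n]-th root of the maximal offspring mass, in units of [s r]. *)
pose bb j := (b / n.+1%:R * p ^+ j)%R.
have bb0 j : (0 < bb j)%R by rewrite mulr_gt0 ?divr_gt0// exprn_gt0.
(* At [B = b / (n + 1)] the jump alone costs [(n + 1) ^ n * b >= (n + 1) * b], so the first cell
   needs no estimate on the masses. *)
have first_cell : (x1 <= 0 + th * (b ^+ n.+1 / bb 0%N ^+ n))%R.
  rewrite add0r; apply: (le_trans (ltW x1b)); rewrite ler_pM2l// /bb expr0 mulr1.
  rewrite expr_div_n invf_div mulrA [in leRHS]exprSr (mulrC (_ ^+ n)%R) -!mulrA.
  rewrite (mulrCA (b ^+ n)%R) [X in (b * (_ * X))%R]divff ?mulr1 1?mulrC; last first.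
    by rewrite expf_neq0// gt_eqF.
  rewrite ler_pM2l//; case: (n) => [|k]; first by rewrite expr0.
  by rewrite -[leLHS]expr1 ler_weXn2l// ler1n.
(* The Bernoulli inequality at the upper end of the cell, while the mass is only known to exceed the
   lower end; the ratio [p] between the two is paid by [p * x1 < Q]. *)
have next_cell j : (x1 - th * (b ^+ n.+1 / bb j.+1 ^+ n) < th * (n%:R * bb j))%R.
  have Bj : bb j.+1 = (p * bb j)%R by rewrite /bb exprS; ring.
  have := bernoulli_sum n b0 (bb0 j.+1).
  move=> /(ler_wpM2l (ltW th0)); rewrite -/Q => h.
  have h2 : (0 <= th * (b ^+ n.+1 / bb j.+1 ^+ n))%R.
    by rewrite mulr_ge0 ?divr_ge0 ?exprn_ge0// ltW.
  rewrite ltrBlDr -(ltr_pM2l p0); apply: (lt_le_trans px); apply: (le_trans h).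
  rewrite mulrDr addrC [in leRHS]mulrDr Bj.
  have -> : (th * (n%:R * (p * bb j)) = p * (th * (n%:R * bb j)))%R by ring.
  rewrite lerD2l -Bj; apply: ler_peMl => //; exact: ltW.
pose A r := (r%:R * (s r * b) ^+ n.+1)%R.
pose bound r := (r%:R * (M th ^+ r * expR (- (r%:R * s r * x1))))%R.
have cells j : eventually_iid P W (fun r V =>
    P [set u | [/\ (A r <= offspring_sum V n u)%R,
      (forall i, mass (shift V i) n u <= (s r * bb j) ^+ n)%R &
      exists i, (-1 < mass (shift V i) n u)%R]] <= (j.+1%:R * bound r)%:E).
  elim: j => [|j ih].
    have H := @power_cell n b (bb 0%N) th x1 0%R (fun=> (-1)%R) th0 thc (bb0 _) first_cell.
    apply: filterS (H _) => [r [r0 h]|].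
      by split => // V iidV; rewrite mul1r; exact: h.
    near=> r; split; first by near: r; exact: nbhs_infty_gt.
    move=> V iidV; rewrite mulr0 oppr0 expR0; apply: probability_le1.
    by apply: measurable_preimage_fun => //; exact: (measurable_mass n iidV).
  have H := @power_cell n b (bb j.+1) th x1 _ (fun r => (s r * bb j) ^+ n)%R th0 thc (bb0 _) _
    (U _ _ (bb0 j) (next_cell j)).
  have {}H := H (ltac:(by rewrite subrK)).
  apply: filterS (eventually_iidI ih H) => r [r0 h]; split => // V iidV.
  have [h1 h2] := h V iidV.
  rewrite -natr1 mulrDl mul1r EFinD; apply: le_trans (leeD h1 h2).
  apply: le_trans (measureU2 _ _ _); [|exact: (measurable_cell iidV)..].
  apply: le_measure; rewrite ?inE.
  - exact: (measurable_cell iidV).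
  - by apply: measurableU; exact: (measurable_cell iidV).
  - move=> u /= [g1 g2 g3].
    have [g4|g4] := pselect (forall i, mass (shift V i) n u <= (s r * bb j) ^+ n)%R.
      by left.
    right; split => //.
    by move/existsNP: g4 => [i g]; exists i; rewrite ltNge; apply/negP.
have [j Hj] : exists j, eventually_iid P W (fun r V =>
    P (mass V n @^-1` `]((s r * bb j) ^+ n)%R, +oo[) <= (expR (- (r%:R * s r * x1)))%:E).
  (* At height 0 the levels do not grow with [j], but the masses are the constant 1 and the event is
     empty. *)
  have [n0|n0] := eqVneq n 0%N.
    exists 0%N; near=> r; split; first by near: r; exact: nbhs_infty_gt.
    move=> V iidV; rewrite (_ : _ @^-1` _ = set0) ?measure0 ?lee_fin ?expR_ge0//.
    by apply/seteqP; split => // u /=; rewrite n0 mass0 expr0 in_itv/= ltxx.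
  have n0' : (0 < n%:R :> R)%R by rewrite ltr0n lt0n.
  have [j hj] := exists_power_gt (x1 / (th * n%:R * (b / n.+1%:R))) p1.
  exists j.+1; apply: U => //; rewrite ltr_pdivrMr in hj; last by rewrite !mulr_gt0// divr_gt0.
  by apply: (lt_le_trans hj); rewrite /bb le_eqVlt; apply/orP; left; apply/eqP; ring.
have Hc := cells j.
near=> r; have [r0 /= h3] : holds_at Hc r by near: r; exact: Hc.
have [_ /= h4] : holds_at Hj r by near: r; exact: Hj.
split => // V iidV.
apply: (@le_trans _ _ ((j.+1%:R * bound r)%:E + (r%:R * expR (- (r%:R * s r * x1)))%:E)).
  have h4' i : P (mass (shift V i) n @^-1` `]((s r * bb j) ^+ n)%R, +oo[) <=
     (expR (- (r%:R * s r * x1)))%:E by apply: h4; exact: iid_shift.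
  apply: le_trans (leeD (h3 V iidV) (exists_gt_bound iidV h4')).
  apply: le_trans (measureU2 _ _ _); last 2 first.
  - exact: (measurable_cell iidV).
  - exact: (measurable_exists_gt iidV).
  apply: le_measure; rewrite ?inE.
  - by apply: measurable_preimage_fun => //; exact: (measurable_mass n.+1 iidV).
  - by apply: measurableU; [exact: (measurable_cell iidV)|exact: (measurable_exists_gt iidV)].
  - move=> u /=; rewrite in_itv/= andbT => /ltW; rewrite massS_ge// => ha.
    have [h5|h5] := pselect (forall i, mass (shift V i) n u <= (s r * bb j) ^+ n)%R; [left|right].
      split => //; exists (Ordinal r0); apply: (@lt_le_trans _ _ 0%R) => //.
      exact: mass_ge0 (iid_shift _ iidV).
    by move/existsNP: h5 => [i h5]; exists i; rewrite ltNge; apply/negP.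
have M1 : (1 <= M th)%R.
  by apply: le_trans (expR_le_moment HW thc); rewrite -[leLHS]expR0 ler_expR ltW.
have hr : (j.+2%:R * r%:R <= expR (r%:R * 1) :> R)%R.
  by near: r; exact: near_polynomial_exp.
(* The factors [exp r] and [M th ^+ r] are absorbed by the gap [x1 - x] because [s r] tends to
   infinity. *)
have hs : ((1 + K th) / (x1 - x) < s r)%R by near: r; exact: s_gt.
rewrite ltr_pdivrMr ?subr_gt0// in hs.
rewrite -EFinD lee_fin /bound.
set y := expR (- (r%:R * s r * x1)).
have y0 : (0 <= y)%R by exact: expR_ge0.
have Mr : (1 <= M th ^+ r)%R by rewrite exprn_ege1.
apply: (@le_trans _ _ (j.+2%:R * r%:R * (M th ^+ r * y)))%R.
  rewrite -[in leRHS]natr1 mulrDl mulrDl mul1r mulrA lerD2l ler_wpM2l//.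
  by rewrite -[leLHS]mul1r ler_wpM2r.
apply: (le_trans (ler_wpM2r _ hr)); first by rewrite mulr_ge0// (le_trans ler01).
rewrite -(expR_cumulant HW thc) -expRM_natl -!expRD ler_expR mulr1.
have := ler_wpM2l (ler0n R r) (ltW hs); lra.
Unshelve. all: by end_near.
Qed.

(** Markov's inequality: the sum over all offsprings has mean [r]. No concentration of the other
    offsprings is needed at very large scales. *)
Lemma others_sum_le n r (V : seq 'I_r -> T -> R) (i0 : 'I_r) (b : R) :
  iid_family P W V -> (0 < b)%R ->
  let S x := (\sum_(j <- others i0) V [:: j] x * mass (shift V j) n x)%R in
  (1 - r%:R / b)%:E <= P [set x | (S x < b)%R] /\
  <<s cylinders V (first_letter [set j | j != i0]) >> [set x | (S x < b)%R].
Proof.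
move=> iidV b0 S.
have r0 : (0 < r)%N by apply: leq_ltn_trans (ltn_ord i0).
have r0' : (0 < r%:R :> R)%R by rewrite ltr0n.
have E : [set x | (S x < b)%R] = S @^-1` `]-oo, b[.
  by apply/seteqP; split => x /=; rewrite in_itv.
have mS : measurable_fun setT S.
  apply: measurable_sum => j; apply: measurable_funM; first by case: iidV.
  exact: (measurable_mass n (iid_shift j iidV)).
have X0 j x : (0 <= V [:: j] x * mass (shift V j) n x)%R.
  by rewrite mulr_ge0//; [case: iidV|exact: mass_ge0 (iid_shift _ iidV)].
have S0 x : (0 <= S x)%R by apply: sumr_ge0.
split; last first.
  have h : i0 \notin others i0 by rewrite mem_others eqxx.
  by rewrite E; apply: (sigma_rest iidV n h); exact: measurable_itv.
have mE : measurable [set x | (S x < b)%R] by rewrite E; exact: measurable_preimage_fun.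
have mm := measurable_mass n.+1 iidV.
rewrite -[X in _ <= P X]setCK probability_setC; last exact: measurableC.
rewrite EFinB leeB//.
apply: (@le_trans _ _ (\int[P]_x (r%:R / b * mass V n.+1 x)%:E)); last first.
  rewrite expectation_scale ?divr_ge0 ?(ltW b0)//; last by move=> x; exact: mass_ge0 iidV.
  by rewrite (mean_mass HW)// mule1.
apply: probability_le_expectation.
- exact: measurableC.
- exact: measurable_funM.
- by move=> x; rewrite mulr_ge0 ?divr_ge0 ?(ltW b0)//; exact: mass_ge0 iidV.
move=> x /= /negP; rewrite -leNgt => bS.
have Er y : (r%:R / b * (r%:R^-1 * y) = y / b)%R by field; rewrite !gt_eqF.
rewrite (massS_others n V i0) Er ler_pdivlMr// mul1r.
by apply: (le_trans bS); rewrite lerDr.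
Qed.

(** One weight close to [r * s r * b] at each of [n] successive generations; equal jumps are the
    equality case of the Bernoulli inequality. *)
Lemma power_lower n b x e : (0 <= b)%R -> (0 < e)%R -> c * (n%:R * b)%:E < x%:E ->
  eventually_iid P W (fun r V => (expR (- (r%:R * s r * x)))%:E <=
    P [set u | (`|(s r ^+ n)^-1 * mass V n u - b ^+ n| < e)%R]).
Proof.
move=> b0; elim: n x e => [|n ih] x e e0 H.
  have x0 : (0 < x)%R by move: H; rewrite mul0r mule0 lte_fin.
  near=> r; split; first by near: r; exact: nbhs_infty_gt.
  have s0 : (0 < s r)%R by near: r; exact: s_gt.
  move=> V iidV; rewrite (_ : [set u | _] = setT) ?(@probability_setT _ _ _ P).
    by rewrite lee_fin -expR0 ler_expR oppr_le0 !mulr_ge0// ltW.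
  by apply/seteqP; split => u //= _; rewrite mass0 !expr0 invr1 mulr1 subrr normr0.
(* Shares of [x] for the jump, the mass below it and the other offsprings. The case [b = 0] is apart
   because [c] may then be infinite. *)
have [y1 [y2 [y3 [Hy1 Hy2 y30 y123]]]] : exists y1 y2 y3 : R,
    [/\ c * b%:E < y1%:E, c * (n%:R * b)%:E < y2%:E, (0 < y3)%R & (y1 + y2 + y3 <= x)%R].
  have [b00|bn0] := eqVneq b 0%R.
    move: H; rewrite b00 !mulr0 !mule0 lte_fin => x0.
    by exists (x / 3)%R, (x / 3)%R, (x / 3)%R; rewrite !lte_fin !divr_gt0//; split => //; lra.
  have b0' : (0 < b)%R by rewrite lt_neqAle eq_sym bn0.
  have [r0 cr] : exists r0 : R, c = r0%:E.
    case: (c) c0 H => [r0| |]// _; first by exists r0.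
    by rewrite gt0_mulye ?lte_fin ?mulr_gt0.
  move: H; rewrite cr -!EFinM !lte_fin -natr1 => H.
  pose h := ((x - r0 * ((n%:R + 1) * b)) / 3)%R.
  have h0 : (0 < h)%R by rewrite divr_gt0// subr_gt0.
  exists (r0 * b + h)%R, (r0 * (n%:R * b) + h)%R, h.
  by rewrite !lte_fin !ltrDl; split => //; rewrite /h; lra.
have den : (0 < b + b ^+ n + 2)%R by have := exprn_ge0 n b0; lra.
pose e1 := Num.min 1%R (e / 2 / (b + b ^+ n + 2))%R.
have e10 : (0 < e1)%R by rewrite lt_min ltr01 !divr_gt0.
have e11 : (e1 <= 1)%R by rewrite ge_min lexx.
have e1e : (e1 * (b + b ^+ n + 2) <= e / 2)%R.
  by rewrite -ler_pdivlMr// ge_min lexx orbT.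
have HW1 := weight_above HW b0 e10 Hy1.
have Hz := ih y2 e1 e10 Hy2.
have HW1' : \forall r \near \oo, (expR (- (r%:R * s r * y1)))%:E <=
    P (W @^-1` `[(r%:R * s r * b)%R, (r%:R * s r * (b + e1))%R]).
  have [N [_ HN]] := HW1.
  near=> r; apply: HN; have s1 : (1 < s r)%R by near: r; exact: s_gt.
  apply: (@lt_trans _ _ (r%:R * 1)%R); last first.
    by rewrite ltr_pM2l// ltr0n; near: r; exact: nbhs_infty_gt.
  by rewrite mulr1; near: r; exact: near_natr_gt.
near=> r; have r0 : (0 < r)%N by near: r; exact: nbhs_infty_gt.
split => // V iidV.
have r0' : (0 < r%:R :> R)%R by rewrite ltr0n.
have s0 : (1 <= s r)%R by apply: ltW; near: r; exact: s_gt.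
have s00 : (0 < s r)%R by apply: lt_le_trans s0.
have rs0 : (0 < r%:R * s r)%R by rewrite mulr_gt0.
pose i0 := Ordinal r0.
have hW : (expR (- (r%:R * s r * y1)))%:E <=
    P (W @^-1` `[(r%:R * s r * b)%R, (r%:R * s r * (b + e1))%R]).
  by near: r; exact: HW1'.
have [_ /= hz] : holds_at Hz r by near: r; exact: Hz.
have hs : (4 / e < s r)%R by near: r; exact: s_gt.
rewrite ltr_pdivrMr// in hs.
have hr : (1 / y3 < r%:R)%R by near: r; exact: near_natr_gt.
rewrite ltr_pdivrMr// in hr.
(* At level [2 * r] the event has probability at least [1 / 2], and this bound divided by
   [r * s r ^+ n.+1] tends to 0. *)
have [PE sE] := others_sum_le n i0 iidV (mulr_gt0 (ltr0n _ 2) r0').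
set E := [set x | _] in PE sE.
have {}PE : (expR (- (r%:R * s r * y3)))%:E <= P E.
  apply: le_trans PE; rewrite lee_fin.
  have -> : (1 - r%:R / (2 * r%:R) = 2^-1 :> R)%R by field; rewrite gt_eqF.
  rewrite expRN lef_pV2 ?posrE ?expR_gt0//.
  have := expR_ge1Dx (r%:R * s r * y3)%R.
  have : (r%:R * y3 * 1 <= r%:R * y3 * s r)%R by rewrite ler_wpM2l// mulr_ge0// ltW.
  by move=> h1 h2; lra.
pose A := `[(r%:R * s r * b)%R, (r%:R * s r * (b + e1))%R]%classic.
pose B := [set y : R | (`|(s r ^+ n)^-1 * y - b ^+ n| < e1)%R].
have mA : measurable A by exact: measurable_itv.
have mB : measurable B.
  by apply: measurable_ball_set; exact: measurable_funM.
apply: (@le_trans _ _ ((expR (- (r%:R * s r * y1)))%:E * ((expR (- (r%:R * s r * y2)))%:E *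
    (expR (- (r%:R * s r * y3)))%:E))).
  rewrite -!EFinM -!expRD lee_fin ler_expR.
  have := ler_wpM2l (ltW rs0) y123; lra.
apply: (@le_trans _ _ (P (W @^-1` A) * (P (mass (shift V i0) n @^-1` B) * P E))).
  apply: lee_pmul; rewrite ?mule_ge0 ?lee_fin ?expR_ge0//.
  apply: lee_pmul; rewrite ?lee_fin ?expR_ge0//.
  by apply: hz; exact: iid_shift.
rewrite -(one_jump iidV n mA mB sE).
have mZ := measurable_mass n (iid_shift i0 iidV).
have mV0 : measurable_fun setT (V [:: i0]) by case: iidV.
have mZ1 := measurable_mass n.+1 iidV.
have mE := sigma_cylinders_measurable (let: And4 m _ _ _ := iidV in m) sE.
apply: le_measure; rewrite ?inE.
- apply: measurableI; first exact: measurable_preimage_fun.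
  by apply: measurableI => //; exact: measurable_preimage_fun.
- by apply: measurable_ball_set; exact: measurable_funM.
move=> u [/= uA [uB uE]].
rewrite /A /= in_itv/= in uA; rewrite /B /= in uB; rewrite /E /= in uE.
rewrite (massS_others n V i0); set S := (\sum_(j <- _) _)%R in uE *.
have S0 : (0 <= S)%R.
  apply: sumr_ge0 => j _; rewrite mulr_ge0//; first by case: iidV.
  exact: mass_ge0 (iid_shift _ iidV).
have Z0 : (0 <= mass (shift V i0) n u)%R by exact: mass_ge0 (iid_shift _ iidV).
have sn : (1 <= s r ^+ n)%R by rewrite exprn_ege1.
have sn0 : (0 < s r ^+ n)%R by apply: lt_le_trans sn.
have -> : ((s r ^+ n.+1)^-1 * (r%:R^-1 * (V [:: i0] u * mass (shift V i0) n u + S)) =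
    (V [:: i0] u / (r%:R * s r)) * ((s r ^+ n)^-1 * mass (shift V i0) n u) +
    S / (r%:R * s r ^+ n.+1))%R.
  by rewrite exprS; field; rewrite !gt_eqF.
have hS : (S / (r%:R * s r ^+ n.+1) < e / 2)%R.
  rewrite ltr_pdivrMr ?mulr_gt0 ?exprn_gt0//; apply: (lt_le_trans uE).
  rewrite exprS; have : (4 * r%:R <= e * s r * r%:R)%R by rewrite ler_wpM2r// mulrC ltW.
  have : (e * s r * r%:R * 1 <= e * s r * r%:R * s r ^+ n)%R.
    by rewrite ler_wpM2l// !mulr_ge0// ltW.
  by move=> h1 h2; lra.
have hS0 : (0 <= S / (r%:R * s r ^+ n.+1))%R by rewrite divr_ge0// mulr_ge0// exprn_ge0// ltW.
have /andP[a1 a2] := uA.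
have a3 : (b <= V [:: i0] u / (r%:R * s r))%R by rewrite ler_pdivlMr// mulrC.
have a4 : (V [:: i0] u / (r%:R * s r) <= b + e1)%R by rewrite ler_pdivrMr// mulrC.
have a5 : (0 <= (s r ^+ n)^-1 * mass (shift V i0) n u)%R by rewrite mulr_ge0// invr_ge0 ltW.
rewrite [(b ^+ n.+1)%R]exprS.
exact: (power_deviation uB hS hS0 a3 a4 a5 e1e e10 e11 b0 e0 (exprn_ge0 n b0)).
Unshelve. all: by end_near.
Qed.

End very_large.

(** * The very large deviation principle *)

Section very_large_deviations.
Context (R : realType) d (T : measurableType d) (P : probability T R).
Context (W : T -> R) (c : \bar R).
Hypothesis HW : cascade_weight P W c.

Let c0 := weight_gt0 HW.

Lemma very_large_rateE n (b : R) : (0 <= b)%R ->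
  very_large_rate c n.+1 (b ^+ n.+1)%R = c * (n.+1%:R * b)%:E.
Proof.
move=> b0; rewrite /very_large_rate ltNge exprn_ge0//=.
by rewrite -powR_mulrn// -powRrM divff ?pnatr_eq0// powRr1.
Qed.

Lemma exists_root n (a : R) : (0 <= a)%R -> exists b : R, (0 <= b)%R /\ (b ^+ n.+1)%R = a.
Proof.
move=> a0; exists (a `^ n.+1%:R^-1)%R; split; first exact: powR_ge0.
by rewrite -powR_mulrn ?powR_ge0// -powRrM mulVf ?pnatr_eq0// powRr1.
Qed.

(** Room is made twice: [th < c] for finite moments, and [b' < b] for the semicontinuity of the rate
    and for passing from open to closed half-lines. *)
Lemma rate_between k (b x : R) : (0 < k)%R -> (0 < b)%R -> x%:E < c * (k * b)%:E ->
  exists th b' : R, [/\ (0 < th)%R, th%:E < c, (0 < b')%R, (b' < b)%R &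
    (x < th * (k * b'))%R].
Proof.
move=> k0 b0; have kb : (0 < k * b)%R by rewrite mulr_gt0.
move=> H; have [th [th0 thc xth]] : exists th : R,
    [/\ (0 < th)%R, th%:E < c & (x < th * (k * b))%R]; last first.
  have tk : (0 < th * k)%R by rewrite mulr_gt0.
  have h : (Num.max 0 (x / (th * k)) < b)%R by rewrite gt_max b0 ltr_pdivrMr//= mulrC -mulrA.
  have m0 : (0 <= Num.max 0 (x / (th * k)))%R by rewrite le_max lexx.
  have mx : (x / (th * k) <= Num.max 0 (x / (th * k)))%R by rewrite le_max lexx orbT.
  exists th, ((Num.max 0 (x / (th * k)) + b) / 2)%R.
  split=> //; [lra|lra|].
  by rewrite mulrA mulrC -ltr_pdivrMr//; lra.
move: H.
case: (c) c0 => [r0| |]//.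
  rewrite !lte_fin => r00 H.
  have h : (Num.max 0 (x / (k * b)) < r0)%R by rewrite gt_max r00 ltr_pdivrMr.
  exists ((Num.max 0 (x / (k * b)) + r0) / 2)%R.
  have m0 : (0 <= Num.max 0 (x / (k * b)))%R by rewrite le_max lexx.
  have mx : (x / (k * b) <= Num.max 0 (x / (k * b)))%R by rewrite le_max lexx orbT.
  by split; rewrite ?lte_fin -?ltr_pdivrMr//; lra.
move=> _ _; exists (Num.max 1 (x / (k * b) + 1))%R; split; last 1 first.
- by rewrite -ltr_pdivrMr// lt_max ltrDl ltr01 orbT.
- by rewrite lt_max ltr01.
- by rewrite ltry.
Qed.

Lemma very_large_deviations (V : forall r : nat, seq 'I_r -> T -> R) n alpha :
  (forall r, (2 <= r)%N -> iid_family P W (@V r)) -> (0 < alpha)%R ->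
  large_deviation_principle P (fun r x => r%:R `^ (- alpha) * mass (@V r) n.+1 x)%R
    (fun r => r%:R `^ (1 + alpha / n.+1%:R))%R (very_large_rate c n.+1).
Proof.
move=> iidV alpha0.
(* Then [s r ^+ n.+1] is the normalization [r ^ alpha], and the speed is [r * s r]. *)
pose s r : R := (r%:R `^ (alpha / n.+1%:R))%R.
have beta0 : (0 < alpha / n.+1%:R)%R by rewrite divr_gt0.
have sy : s r @[r --> \oo] --> +oo%R.
  apply/cvgryPgt => A; near=> r.
  have A1 : (0 < Num.max A 1)%R by rewrite lt_max ltr01 orbT.
  have : (Num.max A 1 `^ (alpha / n.+1%:R)^-1 < r%:R)%R by near: r; exact: near_natr_gt.
  move=> /(gt0_ltr_powR beta0); rewrite -powRrM mulVf ?gt_eqF// powRr1 ?(ltW A1)//.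
  rewrite !nnegrE powR_ge0 ler0n => /(_ isT isT); apply: le_lt_trans.
  by rewrite le_max lexx.
have vE r : (0 < r)%N -> (r%:R `^ (1 + alpha / n.+1%:R) = r%:R * s r)%R.
  by move=> r0; rewrite powRD ?powRr1//; rewrite pnatr_eq0 -lt0n r0 implybT.
have sE r : (s r ^+ n.+1 = r%:R `^ alpha)%R.
  by rewrite /s -powR_mulrn ?powR_ge0// -powRrM divfK// pnatr_eq0.
have YE r : (0 < r)%N -> (r%:R `^ (- alpha) = (s r ^+ n.+1)^-1 :> R)%R.
  by move=> r0; rewrite sE powRN.
have s0 r : (0 < r)%N -> (0 < s r)%R by move=> r0; rewrite powR_gt0// ltr0n.
have r0 : \forall r \near \oo, (0 < r)%N by exact: nbhs_infty_gt.
apply: (@ldp_of_tails _ _ _ _ _ _ _ 0%R).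
- move=> r r2; apply: measurable_funM => //; exact: (measurable_mass n.+1 (iidV r r2)).
- apply/cvgryPgt => A; near=> r.
  have rr : (0 < r)%N by near: r.
  rewrite vE//; have : (1 < s r)%R by near: r; move: (1%R : R); apply/cvgryPgt.
  have : (Num.max A 0 < r%:R)%R by near: r; exact: near_natr_gt.
  rewrite gt_max => /andP[h1 h2] h3; apply: (lt_trans h1).
  by rewrite -[ltLHS]mulr1 ltr_pM2l.
- move=> a; rewrite /very_large_rate; case: ifP => // _.
  by rewrite mule_ge0 ?(ltW c0)// lee_fin mulr_ge0// powR_ge0.
- have := @very_large_rateE n 0%R (lexx _); rewrite expr0n/= => ->.
  by rewrite mulr0 mule0.
- move=> a b a0 ab; have b0 := le_trans a0 ab.
  rewrite /very_large_rate !ltNge a0 b0/=; apply: lee_wpmul2l; first exact: ltW.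
  by rewrite lee_fin ler_wpM2l// ge0_ler_powR// invr_ge0.
- move=> a b ab b0; rewrite /very_large_rate; have [a0|a0] := ltP a 0%R; first by rewrite leey.
  have -> : a = b by apply: le_anti; rewrite ab (le_trans b0).
  by rewrite ltNge (le_trans a0).
- move=> a x a0; have [b [b0 E]] := exists_root n (ltW a0).
  have b0' : (0 < b)%R.
    rewrite lt_neqAle b0 andbT eq_sym; apply/eqP => b00.
    by move: a0; rewrite -E b00 expr0n ltxx.
  rewrite -E very_large_rateE// => H.
  have [th [b' [th0 thc b'0 b'b xth]]] := rate_between (ltr0n _ n.+1) b0' H.
  exists (b' ^+ n.+1)%R; split; first by rewrite exprn_ge0// ltW.
    by rewrite ltr_pXn2r// nnegrE ltW.
  rewrite very_large_rateE ?(ltW b'0)//; apply: (@lt_le_trans _ _ (th * (n.+1%:R * b'))%:E).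
    by rewrite lte_fin.
  by rewrite EFinM; apply: lee_wpmul2r; [rewrite lee_fin mulr_ge0// ltW|exact: ltW].
- move=> a x a0 _; exists (a / 2)%R; split; [lra|lra|].
  by rewrite /very_large_rate (_ : (a / 2 < 0)%R) ?ltry//; lra.
- move=> a x a0; have [b [b0 E]] := exists_root n (ltW a0).
  have b0' : (0 < b)%R.
    rewrite lt_neqAle b0 andbT eq_sym; apply/eqP => b00.
    by move: a0; rewrite -E b00 expr0n ltxx.
  rewrite -E very_large_rateE// => H.
  have [th [b' [th0 thc b'0 b'b xth]]] := rate_between (ltr0n _ n.+1) b0' H.
  have := eventually_family iidV (power_tail_holds HW sy (n := n.+1) th0 thc b'0 xth).
  move=> H'; near=> r; have rr : (0 < r)%N by near: r.
  have r2 : (2 <= r)%N by near: r; exact: nbhs_infty_ge.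
  have h : P (mass (@V r) n.+1 @^-1` `]((s r * b') ^+ n.+1)%R, +oo[) <=
    (expR (- (r%:R * s r * x)))%:E by near: r; exact: H'.
  rewrite vE// YE//; apply: le_trans h; have mm := measurable_mass n.+1 (iidV r r2).
  apply: le_measure; rewrite ?inE.
  + by apply: measurable_set_ge; exact: measurable_funM.
  + exact: measurable_preimage_fun.
  move=> u /=; rewrite in_itv/= andbT mulrC ler_pdivlMr ?exprn_gt0 ?s0//.
  apply: lt_le_trans; rewrite -exprMn mulrC ltr_pXn2r// ?nnegrE ?mulr_ge0 ?(ltW b'0) ?(ltW b0')
    ?(ltW (s0 _ rr))// ltr_pM2r// s0//.
- move=> a x a0 _; near=> r.
  have r2 : (2 <= r)%N by near: r; exact: nbhs_infty_ge.
  rewrite (_ : [set x | _] = set0) ?measure0 ?lee_fin ?expR_ge0//.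
  apply/seteqP; split => // u /=; apply/negP; rewrite -ltNge (lt_le_trans a0)//.
  by rewrite mulr_ge0 ?powR_ge0//; exact: mass_ge0 (iidV r r2).
- move=> a x e e0; have [a0|a0] := ltP a 0%R; first by rewrite /very_large_rate a0.
  have [b [b0 <-]] := exists_root n a0.
  rewrite very_large_rateE// => H.
  have := eventually_family iidV (power_lower HW sy b0 e0 H).
  apply: filterS2 r0 => r rr.
  by rewrite vE// YE.
Unshelve. all: by end_near.
Qed.

End very_large_deviations.

(** * Second order expansions in exponential form *)

Section gaussian_bounds.
Context (R : realType).
Implicit Types y F m k eps L w : R.

Lemma taylor_expRN y : (`|y| <= 1)%R ->
  (`|expR (- y) - (1 - y + y ^+ 2 / 2)| <= `|y| ^+ 3 * expR 1)%R.
Proof.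
move=> y1; have := expR_taylor3 (- y)%R; rewrite sqrrN normrN => h.
by apply: (le_trans h); rewrite ler_wpM2l ?exprn_ge0// ler_expR.
Qed.

(** Multiplying by the expansion of [exp (- y)] cancels the first order terms and turns the second
    moment [m] into the variance [m - 1]; the rest is of order [w ^+ 3], with [w] for the absolute
    value of [y]. *)
Lemma cubic_product_le y w m k L : (0 <= m)%R -> (0 <= k)%R -> (0 <= L)%R ->
  (0 <= w)%R -> (w <= 1)%R -> (y = w) \/ (y = - w)%R ->
  ((1 + y + (y ^+ 2 / 2 * m + w ^+ 3 * k)) * (1 - y + (y ^+ 2 / 2 + w ^+ 3 * L)) <=
   1 + w ^+ 2 * ((m - 1) / 2) + w ^+ 3 * (2 * k + m + 2 * L + 1 + (m + k) * (1 + L)))%R.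
Proof.
move=> m0 k0 L0 w0 w1 yw.
have w2 : (0 <= w ^+ 2)%R by rewrite exprn_ge0.
have w3 : (0 <= w ^+ 3)%R by rewrite exprn_ge0.
have w43 : (w * w ^+ 3 <= w ^+ 3)%R by rewrite ler_piMl.
have w32 : (w ^+ 3 <= w ^+ 2)%R by rewrite exprS ler_piMl.
have y2 : (y ^+ 2 = w ^+ 2)%R by case: yw => ->; rewrite ?sqrrN.
rewrite y2; set a := (w ^+ 2 / 2 * m + w ^+ 3 * k)%R; set b := (w ^+ 2 / 2 + w ^+ 3 * L)%R.
have a0 : (0 <= a)%R by rewrite addr_ge0 ?mulr_ge0 ?divr_ge0.
have b0 : (0 <= b)%R by rewrite addr_ge0 ?mulr_ge0 ?divr_ge0.
have aw : (a * w <= w ^+ 3 * (m / 2 + k))%R.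
  rewrite /a; have := ler_wpM2l k0 w43.
  rewrite mulrDl (_ : w ^+ 2 / 2 * m * w = w ^+ 3 * (m / 2))%R; last by ring.
  by move=> ?; lra.
have bw : (b * w <= w ^+ 3 * (1 / 2 + L))%R.
  rewrite /b; have := ler_wpM2l L0 w43.
  rewrite mulrDl (_ : w ^+ 2 / 2 * w = w ^+ 3 * (1 / 2))%R; last by ring.
  by move=> ?; lra.
have aw2 : (a <= w ^+ 2 * (m / 2 + k))%R by rewrite /a; have := ler_wpM2l k0 w32; lra.
have bw1 : (b <= w * (1 / 2 + L))%R.
  rewrite /b; have h : (w ^+ 2 <= w)%R by rewrite expr2 ler_piMl.
  by have := ler_wpM2l L0 (le_trans w32 h); lra.
have ab : (a * b <= w ^+ 3 * ((m + k) * (1 + L)))%R.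
  apply: (@le_trans _ _ ((w ^+ 2 * (m / 2 + k)) * (w * (1 / 2 + L))))%R.
    by apply: ler_pM.
  rewrite (_ : _ * _ = w ^+ 3 * ((m / 2 + k) * (1 / 2 + L)))%R; last by ring.
  by rewrite ler_wpM2l//; apply: ler_pM; lra.
have e1 : ((1 + y + a) * (1 - y + b) = 1 - w ^+ 2 + a + b - y * a + y * b + a * b)%R.
  by rewrite -y2; ring.
have h1 : (- y * a <= a * w)%R by case: yw => ->; nra.
have h2 : (y * b <= b * w)%R by case: yw => ->; nra.
have r3 : (0 <= w ^+ 3 * m)%R by rewrite !mulr_ge0.
have aE : a = (w ^+ 2 / 2 * m + w ^+ 3 * k)%R by [].
have bE : b = (w ^+ 2 / 2 + w ^+ 3 * L)%R by [].
by rewrite e1; clearbody a b; lra.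
Qed.

Lemma cubic_product_ge y w m k L : (0 <= m)%R -> (0 <= k)%R -> (0 <= L)%R ->
  (0 <= w)%R -> (w <= 1)%R -> (y = w) \/ (y = - w)%R ->
  (1 + w ^+ 2 * ((m - 1) / 2) - w ^+ 3 * (2 * k + m + 2 * L + 1 + (m + k) * (1 + L)) <=
   (1 + y + (y ^+ 2 / 2 * m - w ^+ 3 * k)) * (1 - y + (y ^+ 2 / 2 - w ^+ 3 * L)))%R.
Proof.
move=> m0 k0 L0 w0 w1 yw.
have w2 : (0 <= w ^+ 2)%R by rewrite exprn_ge0.
have w3 : (0 <= w ^+ 3)%R by rewrite exprn_ge0.
have w43 : (w * w ^+ 3 <= w ^+ 3)%R by rewrite ler_piMl.
have w53 : (w ^+ 2 * w ^+ 3 <= w ^+ 3)%R by rewrite ler_piMl// exprn_ile1.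
have y2 : (y ^+ 2 = w ^+ 2)%R by case: yw => ->; rewrite ?sqrrN.
have e1 : ((1 + y + (y ^+ 2 / 2 * m - w ^+ 3 * k)) * (1 - y + (y ^+ 2 / 2 - w ^+ 3 * L)) =
  1 - w ^+ 2 + w ^+ 2 / 2 * m + w ^+ 2 / 2 - w ^+ 3 * (k + L) +
  y * (w ^+ 2 * (1 / 2) - w ^+ 2 / 2 * m + w ^+ 3 * k - w ^+ 3 * L) +
  (w ^+ 2 / 2 * m * (w ^+ 2 / 2) - w ^+ 2 / 2 * m * (w ^+ 3 * L) - w ^+ 3 * k * (w ^+ 2 / 2)
   + w ^+ 3 * k * (w ^+ 3 * L)))%R.
  by rewrite -!y2; ring.
rewrite e1.
have q1 : (0 <= w ^+ 2 / 2 * m * (w ^+ 2 / 2))%R by rewrite !mulr_ge0.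
have q2 : (0 <= w ^+ 3 * k * (w ^+ 3 * L))%R by rewrite !mulr_ge0.
have q3 := ler_wpM2l (mulr_ge0 m0 L0) w53.
have q4 := ler_wpM2l k0 w53.
have q5 : (- (w ^+ 3 * (1 / 2 + m / 2 + k + L)) <=
    y * (w ^+ 2 * (1 / 2) - w ^+ 2 / 2 * m + w ^+ 3 * k - w ^+ 3 * L))%R.
  have p1 := ler_wpM2l k0 w43; have p2 := ler_wpM2l L0 w43.
  have p3 : (w * (w ^+ 2 * (1 / 2)) = w ^+ 3 * (1/2))%R by ring.
  have p4 : (w * (w ^+ 2 / 2 * m) = w ^+ 3 * (m/2))%R by ring.
  have p5 : (0 <= w ^+ 3 * m)%R by rewrite mulr_ge0.
  have p6 : (0 <= w * (w ^+ 3 * k))%R by rewrite !mulr_ge0.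
  have p7 : (0 <= w * (w ^+ 3 * L))%R by rewrite !mulr_ge0.
  by case: yw => ->; lra.
have r1 : (0 <= w ^+ 3 * (m * L))%R by rewrite !mulr_ge0.
have r2 : (0 <= w ^+ 3 * (k * L))%R by rewrite !mulr_ge0.
have r3 : (0 <= w ^+ 3 * m)%R by rewrite !mulr_ge0.
have r4 : (0 <= w ^+ 3 * k)%R by rewrite !mulr_ge0.
have r5 : (0 <= w ^+ 3 * L)%R by rewrite !mulr_ge0.
lra.
Qed.

Lemma norm_cases y : y = `|y|%R \/ y = (- `|y|)%R.
Proof. by have [y0|y0] := leP 0%R y; [left; rewrite ger0_norm|right; rewrite ltr0_norm ?opprK]. Qed.

Lemma gaussian_upper m k eps : (0 <= m)%R -> (0 <= k)%R -> (0 < eps)%R ->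
  exists y0, (0 < y0)%R /\ forall y F, (`|y| <= y0)%R ->
    (F <= 1 + y + y ^+ 2 / 2 * m + `|y| ^+ 3 * k)%R ->
    (F <= expR (y + y ^+ 2 * ((m - 1) / 2 + eps)))%R.
Proof.
move=> m0 k0 eps0; have L0 := expR_ge0 (1 : R).
set C := (2 * k + m + 2 * expR 1 + 1 + (m + k) * (1 + expR 1))%R.
have C0 : (0 < C)%R.
  by rewrite /C; have := mulr_ge0 (addr_ge0 m0 k0) (addr_ge0 ler01 L0); lra.
exists (Num.min 1%R (eps / C)%R); split; first by rewrite lt_min ltr01 divr_gt0.
move=> y F; rewrite le_min => /andP[y1]; rewrite ler_pdivlMr// => yC HF.
have w0 := normr_ge0 y; have T1 := taylor_expRN y1.
have H := cubic_product_le m0 k0 L0 w0 y1 (norm_cases y).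
have y2 : (y ^+ 2 = `|y| ^+ 2)%R by rewrite real_normK// num_real.
rewrite expRD -ler_pdivrMl ?expR_gt0// -expRN.
apply: (@le_trans _ _ (1 + y ^+ 2 * ((m - 1) / 2 + eps))%R); last exact: expR_ge1Dx.
have F0 : (0 <= 1 + y + (y ^+ 2 / 2 * m + `|y| ^+ 3 * k))%R.
  have h1 : (0 <= y ^+ 2 / 2 * m)%R by rewrite mulr_ge0 ?divr_ge0 ?sqr_ge0.
  have h2 : (0 <= `|y| ^+ 3 * k)%R by rewrite mulr_ge0 ?exprn_ge0.
  by move: y1; rewrite ler_norml => /andP[h3 _]; lra.
apply: (@le_trans _ _ ((1 + y + (y ^+ 2 / 2 * m + `|y| ^+ 3 * k)) *
   (1 - y + (y ^+ 2 / 2 + `|y| ^+ 3 * expR 1))))%R.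
  apply: (@le_trans _ _ ((1 + y + (y ^+ 2 / 2 * m + `|y| ^+ 3 * k)) * expR (- y)))%R.
    by rewrite mulrC ler_wpM2r ?expR_ge0//; move: HF; rewrite !addrA.
  rewrite ler_wpM2l//; move: T1; rewrite ler_norml => /andP[_ h]; lra.
apply: (le_trans H); rewrite -/C y2.
have := ler_wpM2l (exprn_ge0 2 w0) yC.
by rewrite (_ : `|y| ^+ 2 * (`|y| * C) = `|y| ^+ 3 * C)%R; [lra|ring].
Qed.

(** Here [1 + z <= exp z] goes the wrong way. It is replaced by an upper bound with the term
    [z ^+ 2 * exp |z|], of order 4 in [y], which adds [q ^+ 2 * expR 1] to the constant. *)
Lemma gaussian_lower m k eps : (0 <= m)%R -> (0 <= k)%R -> (0 < eps)%R ->
  exists y0, (0 < y0)%R /\ forall y F, (`|y| <= y0)%R -> (0 <= F)%R ->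
    (1 + y + y ^+ 2 / 2 * m - `|y| ^+ 3 * k <= F)%R ->
    (expR (y + y ^+ 2 * ((m - 1) / 2 - eps)) <= F)%R.
Proof.
move=> m0 k0 eps0; have L0 := expR_gt0 (1 : R).
set C := (2 * k + m + 2 * expR 1 + 1 + (m + k) * (1 + expR 1))%R.
have C0 : (0 < C)%R.
  by rewrite /C; have := mulr_ge0 (addr_ge0 m0 k0) (addr_ge0 ler01 (ltW L0)); lra.
pose q := ((m - 1) / 2 - eps)%R; pose G := (C + q ^+ 2 * expR 1)%R.
have G0 : (0 < G)%R by rewrite ltr_pwDl// mulr_ge0 ?sqr_ge0// ltW.
have L20 : (0 < 2 * expR 1 :> R)%R by rewrite mulr_gt0.
have q10 : (0 < `|q| + 1)%R by rewrite ltr_wpDl.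
(* In this order: the Taylor bound applies, the lower bound for [exp (- y)] stays nonnegative,
   [|z| <= 1], and the cubic error is below [eps * y ^+ 2]. *)
exists (Num.min (Num.min 1 ((2 * expR 1)^-1)) (Num.min ((`|q| + 1)^-1) (eps / G)))%R.
split; first by rewrite !lt_min ltr01 divr_gt0// !invr_gt0 q10 L20.
move=> y F; rewrite !le_min => /andP[/andP[y1 yL] /andP[yq]].
rewrite ler_pdivlMr// => yG F0 HF.
have w0 := normr_ge0 y; have T1 := taylor_expRN y1.
have H := cubic_product_ge m0 k0 (ltW L0) w0 y1 (norm_cases y).
have y2 : (y ^+ 2 = `|y| ^+ 2)%R by rewrite real_normK// num_real.
rewrite expRD -ler_pdivlMl ?expR_gt0// -expRN.
set z := (y ^+ 2 * _)%R.
have zE : z = (y ^+ 2 * q)%R by [].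
have w2 : (`|y| ^+ 2 <= `|y|)%R by rewrite expr2 ler_piMl.
have yL' : (`|y| * (2 * expR 1) <= 1)%R by rewrite -ler_pdivlMr// mul1r.
have yq' : (`|y| * (`|q| + 1) <= 1)%R by rewrite -ler_pdivlMr// mul1r.
have z1 : (`|z| <= 1)%R.
  rewrite zE normrM normrX; apply: le_trans yq'; apply: ler_pM => //.
  by rewrite lerDl.
apply: (le_trans (expR_le_sqr z)).
apply: (@le_trans _ _ (1 + z + z ^+ 2 * expR 1))%R.
  by rewrite lerD2l ler_wpM2l ?sqr_ge0// ler_expR.
apply: (@le_trans _ _ ((1 + y + (y ^+ 2 / 2 * m - `|y| ^+ 3 * k)) *
   (1 - y + (y ^+ 2 / 2 - `|y| ^+ 3 * expR 1))))%R.
  apply: le_trans H; rewrite -/C zE y2.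
  have h1 : ((`|y| ^+ 2 * q) ^+ 2 <= `|y| ^+ 3 * q ^+ 2)%R.
    by rewrite exprMn ler_wpM2r ?sqr_ge0// -exprM; apply: ler_wiXn2l.
  have h2 := ler_wpM2r (ltW L0) h1.
  have := ler_wpM2l (exprn_ge0 2 w0) yG.
  rewrite (_ : `|y| ^+ 2 * (`|y| * G) = `|y| ^+ 3 * C + `|y| ^+ 3 * q ^+ 2 * expR 1)%R; last first.
    by rewrite /G; ring.
  by rewrite [in X in (X <= _)%R]/q; move=> h3; rewrite /q in h2 h3 *; lra.
have pos : (0 <= 1 - y + (y ^+ 2 / 2 - `|y| ^+ 3 * expR 1))%R.
  have h1 : (`|y| ^+ 3 * expR 1 <= 1 / 2)%R.
    apply: (@le_trans _ _ (`|y| * expR 1))%R; last by lra.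
    rewrite ler_wpM2r ?(ltW L0)// exprS; apply: ler_piMr => //.
    by apply: (le_trans w2).
  by have := sqr_ge0 (1 - y)%R; rewrite sqrrB expr1n mul1r mulr2n; lra.
apply: (@le_trans _ _ (F * (1 - y + (y ^+ 2 / 2 - `|y| ^+ 3 * expR 1))))%R.
  by rewrite ler_wpM2r//; move: HF; rewrite !addrA.
rewrite mulrC ler_wpM2r//; move: T1; rewrite ler_norml => /andP[h _]; lra.
Qed.

End gaussian_bounds.

Lemma tilted_square (R : realFieldType) (th u q e1 eps : R) : (0 <= u)%R -> (u * q <= e1)%R ->
  (eps * ((th + u) ^+ 2 + th ^+ 2) <= u * e1 / 4)%R ->
  ((th + u) ^+ 2 * (q / 2 + eps) - (u * (th * q) + u * e1) - th ^+ 2 * (q / 2 - eps) <=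
   - (u * e1 / 4))%R.
Proof.
move=> u0 uq He; have uuq := ler_wpM2l u0 uq.
have ue : (u * (u * q) / 2 <= u * e1 / 2)%R by lra.
rewrite (_ : _ - _ = u * (u * q) / 2 - u * e1 + eps * ((th + u) ^+ 2 + th ^+ 2))%R; last by field.
lra.
Qed.

(* Parameters of the tilting inequality at scale [h]; the five conclusions are
   its hypotheses and the comparison of its conclusion with the target rate. *)
Lemma tilt_choice (R : realFieldType) (th q e del : R) : (0 <= q)%R -> (0 < e)%R -> (0 < del)%R ->
  exists u e1 eps : R, [/\ (0 < u)%R, [/\ (0 < e1)%R, (e1 <= e)%R & (0 < eps)%R] &
  forall r h : R, (0 < r)%R -> (0 < h)%R -> (8 / (u * e1) < r * h ^+ 2)%R ->
    (4 / del < r * h ^+ 2)%R ->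
    let lo := (r * (1 + h * (th * q - e1)))%R in
    let hi := (r * (1 + h * (th * q + e1)))%R in
    let m := (r * (th * h) + r * h ^+ 2 * (th ^+ 2 * q + `|th| * e1))%R in
    let A := (r * (th * h + (th * h) ^+ 2 * (q / 2 - eps)))%R in
    let B y := (r * (y * h + (y * h) ^+ 2 * (q / 2 + eps)))%R in
    [/\ (th * h * lo <= m)%R, (th * h * hi <= m)%R,
        (B (th + u) - u * h * hi + 2 <= A)%R,
        (B (th - u) + u * h * lo + 2 <= A)%R &
        (- (r * h ^+ 2 * (th ^+ 2 * (q / 2) + del)) <= A - m - 1)%R]].
Proof.
move=> q0 e0 d0; have t10 : (0 < `|th| + 1)%R by rewrite ltr_wpDl.
pose e1 := Num.min e (del / 4 / (`|th| + 1))%R.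
have e10 : (0 < e1)%R by rewrite lt_min e0 !divr_gt0.
have e1e : (e1 <= e)%R by rewrite ge_min lexx.
have te1 : (`|th| * e1 <= del / 4)%R.
  apply: (@le_trans _ _ ((`|th| + 1) * e1))%R; first by rewrite ler_wpM2r ?lerDl// ltW.
  by rewrite mulrC -ler_pdivlMr// ge_min lexx orbT.
pose u := (e1 / (q + 1))%R.
have q10 : (0 < q + 1)%R by rewrite ltr_wpDl.
have u0 : (0 < u)%R by rewrite divr_gt0.
have uq : (u * q <= e1)%R.
  rewrite /u mulrAC ler_pdivrMr// ler_wpM2l ?(ltW e10)//; lra.
pose D := ((th + u) ^+ 2 + (- th + u) ^+ 2 + th ^+ 2 + 1)%R.
have D0 : (0 < D)%R by rewrite ltr_wpDl// !addr_ge0// sqr_ge0.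
pose eps := Num.min (u * e1 / 4 / D)%R (del / 4 / D)%R.
have ue0 : (0 < u * e1)%R by rewrite mulr_gt0.
have eps0 : (0 < eps)%R by rewrite lt_min !divr_gt0.
have epsD1 : (eps * D <= u * e1 / 4)%R by rewrite -ler_pdivlMr// ge_min lexx.
have epsD2 : (eps * D <= del / 4)%R by rewrite -ler_pdivlMr// ge_min lexx orbT.
clearbody eps u e1; exists u, e1, eps; split => // r h r0 h0.
have := sqr_ge0 (th + u)%R; have := sqr_ge0 (- th + u)%R; have := sqr_ge0 th => s3 s2 s1.
have epsB : (eps * ((th + u) ^+ 2 + th ^+ 2) <= u * e1 / 4)%R.
  by apply: le_trans epsD1; rewrite ler_wpM2l ?(ltW eps0)// /D; lra.
have epsB' : (eps * ((- th + u) ^+ 2 + (- th) ^+ 2) <= u * e1 / 4)%R.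
  by apply: le_trans epsD1; rewrite ler_wpM2l ?(ltW eps0)// sqrrN /D; lra.
have epsC : (eps * th ^+ 2 <= del / 4)%R.
  by apply: le_trans epsD2; rewrite ler_wpM2l ?(ltW eps0)// /D; lra.
have sq1 := tilted_square (ltW u0) uq epsB.
have sq2 := tilted_square (ltW u0) uq epsB'.
clear epsD1 epsD2 epsB epsB'.
set N := (r * h ^+ 2)%R; have N0 : (0 < N)%R by rewrite mulr_gt0// exprn_gt0.
have NE : (r * (h * h) = N)%R by rewrite /N expr2.
rewrite !ltr_pdivrMr// => N1 N2 lo hi m A B.
have te : (th * e1 <= `|th| * e1)%R by rewrite ler_wpM2r ?ler_norm// ltW.
have te' : (- th * e1 <= `|th| * e1)%R.
  by rewrite ler_wpM2r ?(ltW e10)//; have := ler_norm (- th)%R; rewrite normrN.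
have Nte := ler_wpM2l (ltW N0) te; have Nte' := ler_wpM2l (ltW N0) te'.
have Nsq1 := ler_wpM2l (ltW N0) sq1; have Nsq2 := ler_wpM2l (ltW N0) sq2.
split.
- rewrite (_ : th * h * lo = r * (th * h) + N * (th ^+ 2 * q - th * e1))%R.
    by rewrite /m; lra.
  by rewrite /lo /N; ring.
- rewrite (_ : th * h * hi = r * (th * h) + N * (th ^+ 2 * q + th * e1))%R.
    by rewrite /m; lra.
  by rewrite /hi /N; ring.
- rewrite -subr_le0 (_ : _ - _ = N * ((th + u) ^+ 2 * (q / 2 + eps) -
    (u * (th * q) + u * e1) - th ^+ 2 * (q / 2 - eps)) + 2)%R; first by lra.
  by rewrite /B /hi /A /N; ring.
- rewrite -subr_le0 (_ : _ - _ = N * ((- th + u) ^+ 2 * (q / 2 + eps) -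
    (u * (- th * q) + u * e1) - (- th) ^+ 2 * (q / 2 - eps)) + 2)%R; first by lra.
  by rewrite /B /lo /A /N; ring.
rewrite (_ : A - m - 1 = N * (th ^+ 2 * (q / 2 - eps) - th ^+ 2 * q - `|th| * e1) - 1)%R; last first.
  by rewrite /A /m /N; ring.
have h1 : (N * (th ^+ 2 * (q / 2 - eps) - th ^+ 2 * q - `|th| * e1) >=
   N * (- (th ^+ 2 * (q / 2)) - del / 2))%R.
  by rewrite ler_wpM2l ?(ltW N0)//; lra.
lra.
Qed.

Lemma moderate_deviation (R : realFieldType) (r h e a S Y : R) : (0 < r)%R -> (0 < h)%R ->
  (0 < e)%R -> (`|(`|a| + e / 4) * h| <= 1)%R ->
  (r * (1 + h * (a - e / 4)) < S)%R -> (S < r * (1 + h * (a + e / 4)))%R ->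
  ((1 - h * (e / 4)) * S <= Y)%R -> (Y <= (1 + h * (e / 4)) * S)%R -> (0 <= S)%R ->
  (`|h^-1 * (r^-1 * Y - 1) - a| < e)%R.
Proof.
move=> r0 h0 e0 ha S1 S2 Y1 Y2 S0.
have hh : (h * (a + e / 4) <= 1)%R.
  apply: le_trans ha; rewrite mulrC; apply: le_trans (ler_norm _); rewrite ler_wpM2r ?(ltW h0)//.
  by rewrite lerD2r ler_norm.
have S3 : (S <= 2 * r)%R by apply: (le_trans (ltW S2)); rewrite mulrC ler_wpM2r ?(ltW r0)//; lra.
have hS := ler_wpM2l (ltW (mulr_gt0 h0 e0)) S3.
have Yl : (r * (h * (a - e)) < Y - r)%R.
  have : (0 < r * (h * e))%R by rewrite !mulr_gt0.
  by lra.
have Yu : (Y - r < r * (h * (a + e)))%R.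
  have : (0 < r * (h * e))%R by rewrite !mulr_gt0.
  by lra.
have l : (a - e < (Y - r) / (r * h))%R by rewrite ltr_pdivlMr ?mulr_gt0//; lra.
have u : ((Y - r) / (r * h) < a + e)%R by rewrite ltr_pdivrMr ?mulr_gt0//; lra.
rewrite (_ : h^-1 * (r^-1 * Y - 1) = (Y - r) / (r * h))%R; last first.
  by field; rewrite !gt_eqF.
by rewrite ltr_norml; apply/andP; split; lra.
Qed.

(** * Moderate deviations at an abstract scale [h] *)

Section moderate.
Context (R : realType) d (T : measurableType d) (P : probability T R).
Context (W : T -> R) (c : \bar R).
Hypothesis HW : cascade_weight P W c.

Let c0 := weight_gt0 HW.
Let mW := weight_measurable HW.
Let W0 := weight_ge0 HW.

Local Notation M := (moment P W 0).
Local Notation m2 := (moment P W 2 0).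

Variable h : nat -> R.
Hypothesis h_gt0 : \forall r \near \oo, (0 < h r)%R.
Hypothesis h_lt : forall e, (0 < e)%R -> \forall r \near \oo, (h r < e)%R.
Hypothesis h_exp : forall A e, (0 <= A)%R -> (0 < e)%R ->
  \forall r \near \oo, (A * r%:R <= expR (e * (r%:R * h r ^+ 2)))%R.

(** [h_exp] says that the speed [r * h r ^+ 2] beats every multiple of [ln r]; this is what makes
    union bounds over the offsprings free. *)
Lemma speed_gt A : \forall r \near \oo, (A < r%:R * h r ^+ 2)%R.
Proof.
near=> r; have r2 : (1 < r%:R :> R)%R by near: r; exact: near_natr_gt.
have : (expR A * r%:R <= expR (1 * (r%:R * h r ^+ 2)))%R.
  by near: r; exact: h_exp (expR_ge0 _) ltr01.
rewrite mul1r => H; rewrite -ltr_expR; apply: lt_le_trans H.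
by rewrite ltr_pMr// expR_gt0.
Unshelve. all: by end_near.
Qed.

Lemma second_moment_ge1 : (1 <= m2)%R.
Proof.
have m1 : measurable_fun setT (fun x => 2 * W x)%R by exact: measurable_funM.
have m3 : measurable_fun setT (fun x => W x ^+ 2)%R by exact: measurable_funX.
have : \int[P]_x (2 * W x)%:E <= \int[P]_x (W x ^+ 2 + 1)%:E.
  apply: expectation_mono => //; first exact: measurable_funD.
  - by move=> x; rewrite mulr_ge0.
  - by move=> x; have := sqr_ge0 (W x - 1)%R; rewrite sqrrB expr1n mulr1 mulr2n; lra.
rewrite expectation_scale// (weight_mean HW) mule1.
rewrite expectation_add//; last by move=> x; exact: sqr_ge0.
rewrite integral_constant (_ : \int[P]_x (W x ^+ 2)%:E = m2%:E).
  by rewrite -EFinD lee_fin; lra.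
rewrite -(momentE HW)// /emoment; apply: eq_integral => x _.
by rewrite mul0r expR0 mulr1.
Qed.

Lemma small_near (C e : R) : (0 <= C)%R -> (0 < e)%R -> \forall r \near \oo, (C / r%:R <= e)%R.
Proof.
move=> C0 e0; near=> r; have r0 : (0 < r%:R :> R)%R by near: r; exact: near_natr_gt.
rewrite ler_pdivrMr// mulrC -ler_pdivrMr// ltW//; near: r; exact: near_natr_gt.
Unshelve. all: by end_near.
Qed.

Lemma scale_near th e : (0 < e)%R -> \forall r \near \oo, (`|th * h r| <= e)%R.
Proof.
move=> e0; have t0 : (0 < `|th| + 1)%R by rewrite ltr_wpDl.
near=> r; have hr : (0 < h r)%R by near: r.
have : (h r < e / (`|th| + 1))%R by near: r; apply: h_lt; rewrite divr_gt0.
rewrite ltr_pdivlMr// => H; rewrite normrM (gtr0_norm hr) mulrC.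
by apply: le_trans (ltW H); rewrite ler_wpM2l ?(ltW hr)// lerDl.
Unshelve. all: by end_near.
Qed.

Lemma moderate_upper n a th x : (0 < th)%R -> (x < th * a - th ^+ 2 * ((m2 - 1) / 2))%R ->
  eventually_iid P W (fun r V =>
    P [set u | (1 + h r * a <= mass V n.+1 u)%R] <= (expR (- (r%:R * h r ^+ 2 * x)))%:E).
Proof.
move=> th0 xa.
pose g := ((th * a - th ^+ 2 * ((m2 - 1) / 2) - x) / 2)%R.
have g0 : (0 < g)%R by rewrite divr_gt0// subr_gt0.
(* The error is spent twice: [eps / 2] for replacing [m2] by [m2 + eps], which covers the second
   moment [m2 * (1 + C / r)] of [W_i Z_i], and [eps] for the expansion. *)
pose eps := (g / (3 / 2 * th ^+ 2))%R.
have th20 : (0 < th ^+ 2)%R by rewrite exprn_gt0.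
have eps0 : (0 < eps)%R by apply: divr_gt0 => //; apply: mulr_gt0 => //; lra.
have epsE : (th ^+ 2 * (3 / 2 * eps) = g)%R by rewrite /eps; field; rewrite gt_eqF.
have [b [b0 bc]] := weight_between HW.
have m1 := second_moment_ge1.
have m20 : (0 <= m2)%R by lra.
have [C [C0 HC]] := second_moment_mass HW n.
have k0 : (0 <= 8 * moment P W 3 b)%R := mulr_ge0 (ler0n R 8) (moment_ge0 HW 3 b).
have me0 : (0 <= m2 + eps)%R by rewrite addr_ge0// ltW.
have [y0 [y00 Hy]] := gaussian_upper me0 k0 eps0.
(* A mass above 2 has an exponential cost [r * kap], eventually larger than the target
   [r * h r ^+ 2 * (x + g)]. *)
have [kap [kap0 Hkap]] : exists k : R, (0 < k)%R /\ k%:E < cascade_rate P W c n 2.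
  have [k [k00 Hk]] := cascade_rate_gt0 HW n (ltr1n R 2).
  exists (k / 2)%R; split; first by rewrite divr_gt0.
  by apply: lt_le_trans Hk; rewrite lte_fin ltr_pdivrMr// ltr_pMr// ltr1n.
have HZ := upper_tail_right (@upper_tail_holds _ _ _ _ _ _ HW n) (ler1n R 2) Hkap.
have Mb0 := moment_ge0 HW 0 b.
near=> r; have r0 : (0 < r)%N by near: r; exact: nbhs_infty_gt.
have r0' : (0 < r%:R :> R)%R by rewrite ltr0n.
have hr : (0 < h r)%R by near: r.
split => // V iidV.
have [_ /= hz] : holds_at HZ r by near: r; exact: HZ.
pose t := (th * h r)%R.
have t0 : (0 < t)%R by rewrite mulr_gt0.
have t2 : (t * 2 <= b)%R.
  rewrite -ler_pdivlMr// /t; apply: (le_trans (ler_norm _)).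
  by near: r; apply: scale_near; rewrite divr_gt0.
have ty : (`|th * h r| <= y0)%R by near: r; apply: scale_near.
have Ce : (m2 * (C / r%:R) <= eps)%R.
  by rewrite mulrA; near: r; apply: small_near; [exact: mulr_ge0|exact: eps0].
have tc : (t * 2)%:E < c by apply: le_lt_trans bc; rewrite lee_fin.
pose E := expR (t + t ^+ 2 * ((m2 + eps - 1) / 2 + eps)).
have E1 : (1 <= E)%R.
  rewrite /E -[leLHS]expR0 ler_expR addr_ge0 ?(ltW t0)// mulr_ge0 ?sqr_ge0//.
  by rewrite addr_ge0 ?(ltW eps0)// divr_ge0// subr_ge0 (le_trans m1)// lerDl ltW.
have HE i : \int[P]_x (expR (t * (V [:: i] x * mass (shift V i) n x)) *
    \1_(`]-oo, 2%R]) (mass (shift V i) n x))%:E <= E%:E.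
  apply: le_trans (truncated_exponential_taylor HW iidV
    (fun i => mean_mass HW n r0 (iid_shift i iidV))
    (fun i => HC _ _ r0 (iid_shift i iidV)) i (ltW t0) tc) _.
  rewrite lee_fin; apply: Hy => //.
  rewrite gtr0_norm//; apply: lerD.
    by rewrite lerD2l ler_wpM2l ?divr_ge0 ?sqr_ge0// mulrDr mulr1 lerD2l.
  have := ler_wpM2l (mulr_ge0 (ler0n R 8) (exprn_ge0 3 (ltW t0))) (moment_le HW 3 t2 bc).
  by move=> /le_trans; apply; rewrite le_eqVlt; apply/orP; left; apply/eqP; ring.
have H1 : P [set u | [/\ (r%:R * (1 + h r * a) <= offspring_sum V n u)%R,
      (forall i, mass (shift V i) n u <= 2)%R &
      exists i, (-1 < mass (shift V i) n u)%R]] <=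
    (M b * r%:R * expR (- (r%:R * h r ^+ 2 * (x + g))))%:E.
  have hq i : P (mass (shift V i) n @^-1` `](-1)%R, +oo[) <= 1%:E.
    apply: probability_le1; apply: measurable_preimage_fun => //.
    exact: (measurable_mass n (iid_shift i iidV)).
  apply: le_trans (upper_tail_cell HW iidV (r%:R * (1 + h r * a))%R (ltW t0) tc ler01
    (le_trans ler01 E1) hq HE) _.
  rewrite lee_fin mul1r [leRHS]mulrAC [leRHS]mulrC ler_wpM2l// -mulrA.
  apply: ler_pM; [exact: (moment_ge0 HW)| |exact: (moment_le HW)|].
    by rewrite mulr_ge0 ?expR_ge0// exprn_ge0// (le_trans ler01).
  apply: (@le_trans _ _ (E ^+ r * expR (- (t * (r%:R * (1 + h r * a))))))%R.
    by rewrite ler_wpM2r ?expR_ge0// ler_weXn2l// leq_pred.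
  rewrite /E -expRM_natl -expRD ler_expR le_eqVlt; apply/orP; left; apply/eqP.
  have -> : (x + g = th * a - th ^+ 2 * ((m2 - 1) / 2) - th ^+ 2 * (3 / 2 * eps))%R.
    by rewrite epsE /g; field.
  by rewrite /t; field.
have H2 := exists_gt_bound iidV (fun i => hz _ (iid_shift i iidV)).
apply: (@le_trans _ _ ((M b * r%:R * expR (- (r%:R * h r ^+ 2 * (x + g))))%:E +
   (r%:R * expR (- (r%:R * kap)))%:E)).
  apply: le_trans (leeD H1 H2).
  apply: le_trans (measureU2 _ _ _); last 2 first.
  - exact: (measurable_cell iidV).
  - exact: (measurable_exists_gt iidV).
  apply: le_measure; rewrite ?inE.
  - exact: measurable_mass_ge iidV.
  - by apply: measurableU; [exact: (measurable_cell iidV)|exact: (measurable_exists_gt iidV)].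
  - move=> u /=; rewrite massS_ge// => ha.
    have [h5|h5] := pselect (forall i, mass (shift V i) n u <= 2)%R; [left|right].
      split => //; exists (Ordinal r0); apply: (@lt_le_trans _ _ 0%R) => //.
      exact: mass_ge0 (iid_shift _ iidV).
    by move/existsNP: h5 => [i h5]; exists i; rewrite ltNge; apply/negP.
have hk : (h r ^+ 2 * (x + g) <= kap)%R.
  have hx : (`|(x + g) * h r| <= kap)%R by near: r; apply: scale_near.
  have h1 : (`|1 * h r| <= 1)%R by near: r; apply: scale_near.
  rewrite mul1r (gtr0_norm hr) in h1.
  apply: le_trans hx; apply: le_trans (ler_norm _) _.
  rewrite expr2 -mulrA normrM (gtr0_norm hr) (mulrC (h r)) -[leRHS]mul1r.
  by rewrite (mulrC (x + g)%R) mulrC; apply: ler_wpM2r.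
rewrite -EFinD lee_fin.
have H3 : ((M b + 1) * r%:R <= expR (g * (r%:R * h r ^+ 2)))%R.
  by near: r; apply: h_exp; rewrite ?addr_ge0.
apply: (@le_trans _ _ ((M b + 1) * r%:R * expR (- (r%:R * h r ^+ 2 * (x + g)))))%R.
  rewrite (mulrDl (M b)) mul1r mulrDl lerD2l ler_wpM2l// ler_expR lerN2 -mulrA.
  by rewrite ler_wpM2l.
apply: (le_trans (ler_wpM2r (expR_ge0 _) H3)).
rewrite -expRD ler_expR le_eqVlt; apply/orP; left; apply/eqP; ring.
Unshelve. all: by end_near.
Qed.

Lemma moderate_lower n a th x : (0 < th)%R -> (x < th * a - th ^+ 2 * ((m2 - 1) / 2))%R ->
  eventually_iid P W (fun r V =>
    P [set u | (mass V n.+1 u <= 1 - h r * a)%R] <= (expR (- (r%:R * h r ^+ 2 * x)))%:E).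
Proof.
move=> th0 xa.
pose g := ((th * a - th ^+ 2 * ((m2 - 1) / 2) - x) / 2)%R.
have g0 : (0 < g)%R by rewrite divr_gt0// subr_gt0.
pose eps := (g / (3 / 2 * th ^+ 2))%R.
have th20 : (0 < th ^+ 2)%R by rewrite exprn_gt0.
have eps0 : (0 < eps)%R by apply: divr_gt0 => //; apply: mulr_gt0 => //; lra.
have epsE : (th ^+ 2 * (3 / 2 * eps) = g)%R by rewrite /eps; field; rewrite gt_eqF.
have m1 := second_moment_ge1.
have m20 : (0 <= m2)%R by lra.
have [C [C0 HC]] := second_moment_mass HW n.
have me0 : (0 <= m2 + eps)%R by rewrite addr_ge0// ltW.
have [y0 [y00 Hy]] := gaussian_upper me0 (lexx 0%R) eps0.
near=> r; have r0 : (0 < r)%N by near: r; exact: nbhs_infty_gt.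
have r0' : (0 < r%:R :> R)%R by rewrite ltr0n.
have hr : (0 < h r)%R by near: r.
split => // V iidV.
pose t := (th * h r)%R.
have t0 : (0 < t)%R by rewrite mulr_gt0.
have ty : (`|th * h r| <= y0)%R by near: r; apply: scale_near.
have Ce : (m2 * (C / r%:R) <= eps)%R.
  by rewrite mulrA; near: r; apply: small_near; [exact: mulr_ge0|exact: eps0].
pose E := expR (- t + t ^+ 2 * ((m2 + eps - 1) / 2 + eps)).
have HE i : \int[P]_x (expR (- t * (V [:: i] x * mass (shift V i) n x)))%:E <= E%:E.
  apply: le_trans (exponential_lower_taylor HW iidV
    (fun i => mean_mass HW n r0 (iid_shift i iidV))
    (fun i => HC _ _ r0 (iid_shift i iidV)) i (ltW t0)) _.
  rewrite lee_fin /E -[(t ^+ 2)%R in leRHS]sqrrN; apply: Hy; first by rewrite normrN.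
  by rewrite mulr0 addr0 sqrrN lerD2l ler_wpM2l ?divr_ge0 ?sqr_ge0// mulrDr mulr1 lerD2l.
rewrite (_ : [set u | _] = [set u | (offspring_sum V n u <= r%:R * (1 - h r * a))%R]); last first.
  by apply/seteqP; split => u /=; rewrite massS_le.
apply: le_trans (lower_tail_bound iidV _ (ltW t0) (expR_ge0 _) HE) _.
rewrite lee_fin /E -expRM_natl -expRD ler_expR.
have : (r%:R * h r ^+ 2 * x <= r%:R * h r ^+ 2 * (x + g))%R.
  by rewrite ler_wpM2l ?lerDl ?(ltW g0)// mulr_ge0// sqr_ge0.
have -> : (x + g = th * a - th ^+ 2 * ((m2 - 1) / 2) - th ^+ 2 * (3 / 2 * eps))%R.
  by rewrite epsE /g; field.
move=> H; apply: (@le_trans _ _ (- (r%:R * h r ^+ 2 *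
  (th * a - th ^+ 2 * ((m2 - 1) / 2) - th ^+ 2 * (3 / 2 * eps)))))%R; last by rewrite lerN2.
rewrite le_eqVlt; apply/orP; left; apply/eqP; rewrite /t; field.
Unshelve. all: by end_near.
Qed.

(** All [r] masses must be within [h r * e] of 1 at once, a window that shrinks with [r]. The
    moderate tails give an error exponential in the speed, which survives the product over [r]
    offsprings. *)
Lemma moderate_near_one n e : (0 < e)%R -> exists k, (0 < k)%R /\
  eventually_iid P W (fun r V => (1 - expR (- (r%:R * h r ^+ 2 * k)))%:E <=
    P (mass V n @^-1` `[(1 - h r * e)%R, (1 + h r * e)%R])).
Proof.
move=> e0; case: n => [|n].
  exists 1%R; split => //; near=> r; split; first by near: r; exact: nbhs_infty_gt.
  have hr : (0 < h r)%R by near: r.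
  have he : (0 < h r * e)%R by rewrite mulr_gt0.
  move=> V iidV; rewrite (_ : _ @^-1` _ = setT) ?(@probability_setT _ _ _ P).
    by rewrite lee_fin gerBl expR_ge0.
  by apply/seteqP; split => u //= _; rewrite mass0 in_itv/=; apply/andP; split; lra.
have m1 := second_moment_ge1.
have m20 : (0 < m2)%R by lra.
(* Then the exponent at [e / 2] exceeds [th * e / 4 = 2 * k]; the spare [k] absorbs the factor 2 of
   the two tails. *)
pose th := (e / 2 / m2)%R.
have th0 : (0 < th)%R by rewrite !divr_gt0.
pose k := (th * e / 8)%R.
have k0 : (0 < k)%R by rewrite divr_gt0// mulr_gt0.
have Hk : (2 * k < th * (e / 2) - th ^+ 2 * ((m2 - 1) / 2))%R.
  have : (th * (th * m2) = th * (e / 2))%R by rewrite /th; field; rewrite gt_eqF.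
  have : (0 < th * e)%R by rewrite mulr_gt0.
  have : (0 < th ^+ 2)%R by rewrite exprn_gt0.
  by rewrite /k mulrA -expr2; lra.
exists k; split => //.
have U := moderate_upper n th0 Hk; have L := moderate_lower n th0 Hk.
near=> r; split; first by near: r; exact: nbhs_infty_gt.
have hr : (0 < h r)%R by near: r.
have he : (0 < h r * e)%R by rewrite mulr_gt0.
have [_ /= h1] : holds_at U r by near: r; exact: U.
have [_ /= h2] : holds_at L r by near: r; exact: L.
move=> V iidV; have mm := measurable_mass n.+1 iidV.
have mB : measurable (mass V n.+1 @^-1` `[(1 - h r * e)%R, (1 + h r * e)%R]).
  exact: measurable_preimage_fun.
have mL := measurable_set_le (1 - h r * (e / 2))%R mm.
have mU := measurable_mass_ge n.+1 (1 + h r * (e / 2))%R iidV.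
rewrite -[X in _ <= P X]setCK probability_setC; last exact: measurableC.
rewrite EFinB leeB//.
apply: (@le_trans _ _ ((expR (- (r%:R * h r ^+ 2 * (2 * k))))%:E +
    (expR (- (r%:R * h r ^+ 2 * (2 * k))))%:E)).
  apply: le_trans (leeD (h1 V iidV) (h2 V iidV)).
  apply: le_trans (measureU2 _ mU mL); apply: le_measure; rewrite ?inE.
  - exact: measurableC.
  - exact: measurableU.
  move=> u /= /negP; rewrite in_itv/= negb_and -!ltNge => /orP[h3|h3]; [right|left] => /=; lra.
rewrite -EFinD lee_fin.
have : (1 / k < r%:R * h r ^+ 2)%R by near: r; exact: speed_gt.
rewrite ltr_pdivrMr// => hk.
rewrite (_ : - (r%:R * h r ^+ 2 * (2 * k)) = - (r%:R * h r ^+ 2 * k) + - (r%:R * h r ^+ 2 * k))%R; last by ring.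
move: hk; move: (r%:R * h r ^+ 2 * k)%R => z z1.
rewrite expRD; have e0' := expR_gt0 (- z)%R.
have : (2 * expR (- z) <= 1)%R.
  rewrite expRN -ler_pdivlMr ?invr_gt0 ?expR_gt0// invrK mul1r.
  by have := expR_ge1Dx z; lra.
by nra.
Unshelve. all: by end_near.
Qed.

Lemma moment_gaussian eps : (0 < eps)%R -> exists y0, (0 < y0)%R /\
  forall y, (`|y| <= y0)%R -> [/\ y%:E < c,
    (expR (y + y ^+ 2 * ((m2 - 1) / 2 - eps)) <= M y)%R &
    (M y <= expR (y + y ^+ 2 * ((m2 - 1) / 2 + eps)))%R].
Proof.
move=> eps0; have [b [b0 bc]] := weight_between HW.
have m20 : (0 <= m2)%R := le_trans ler01 second_moment_ge1.
have m30 := moment_ge0 HW 3 b.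
have [y1 [y10 Hup]] := gaussian_upper m20 m30 eps0.
have [y2 [y20 Hlo]] := gaussian_lower m20 m30 eps0.
exists (Num.min b (Num.min y1 y2)); split; first by rewrite !lt_min b0 y10 y20.
move=> y; rewrite !le_min => /andP[yb /andP[yy1 yy2]].
have := moment_third_order HW (ltW b0) bc yb; rewrite ler_norml => /andP[h1 h2].
split.
- by apply: le_lt_trans bc; rewrite lee_fin (le_trans (ler_norm _)).
- by apply: Hlo yy2 _ _; [exact: (moment_ge0 HW)|move: h1; rewrite lerBrDr addrC].
- by apply: Hup yy1 _; rewrite addrC -lerBlDr.
Qed.

(* [th * (m2 - 1)] is the normalized mean of the root sum under the exponential
   tilt of parameter [th * h r], up to a vanishing error. *)
Lemma moderate_root_sum th e del : (0 < e)%R -> (0 < del)%R ->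
  eventually_iid P W (fun r V =>
    (expR (- (r%:R * h r ^+ 2 * (th ^+ 2 * ((m2 - 1) / 2) + del))))%:E <=
    P [set u | (r%:R * (1 + h r * (th * (m2 - 1) - e)) <
      \sum_(j <- enum 'I_r) V [:: j] u < r%:R * (1 + h r * (th * (m2 - 1) + e)))%R]).
Proof.
move=> e0 d0; have q0 : (0 <= m2 - 1)%R by rewrite subr_ge0 second_moment_ge1.
have [u [e1 [eps [u0 [e10 e1e eps0] Hchoice]]]] := tilt_choice th q0 e0 d0.
have [y0 [y00 HM]] := moment_gaussian eps0.
move: (m2 - 1)%R q0 HM Hchoice => q q0 HM Hchoice.
near=> r; have r0 : (0 < r)%N by near: r; exact: nbhs_infty_gt.
have r0' : (0 < r%:R :> R)%R by rewrite ltr0n.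
have hr : (0 < h r)%R by near: r.
split => // V iidV.
have a1 : (`|(th + u) * h r| <= y0)%R by near: r; apply: scale_near.
have a2 : (`|(th - u) * h r| <= y0)%R by near: r; apply: scale_near.
have a3 : (`|th * h r| <= y0)%R by near: r; apply: scale_near.
have N1 : (8 / (u * e1) < r%:R * h r ^+ 2)%R by near: r; exact: speed_gt.
have N2 : (4 / del < r%:R * h r ^+ 2)%R by near: r; exact: speed_gt.
have [C1 C2 C3 C4 C5] := Hchoice _ _ r0' hr N1 N2.
have szE : size (enum 'I_r) = r by rewrite size_enum_ord.
have powE (x : R) : (expR x ^+ r = expR (r%:R * x))%R by rewrite expRM_natl.
have mS : measurable_fun setT (fun x => \sum_(j <- enum 'I_r) V [:: j] x)%R.
  by apply: measurable_sum => j; case: iidV.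
have up y : (`|y * h r| <= y0)%R ->
    \int[P]_x (expR (y * h r * \sum_(j <- enum 'I_r) V [:: j] x))%:E <=
    (expR (r%:R * (y * h r + (y * h r) ^+ 2 * (q / 2 + eps))))%:E.
  move=> yy; have [yc _ hy] := HM _ yy.
  rewrite (root_sum_mgf HW iidV (enum_uniq _) yc) szE lee_fin -powE.
  by apply: lerXn2r hy; rewrite ?nnegrE ?expR_ge0//; exact: (moment_ge0 HW).
have lo : (expR (r%:R * (th * h r + (th * h r) ^+ 2 * (q / 2 - eps))))%:E <=
    \int[P]_x (expR (th * h r * \sum_(j <- enum 'I_r) V [:: j] x))%:E.
  have [yc hy _] := HM _ a3.
  rewrite (root_sum_mgf HW iidV (enum_uniq _) yc) szE lee_fin -powE.
  by apply: lerXn2r hy; rewrite ?nnegrE ?expR_ge0//; exact: (moment_ge0 HW).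
have up1 := up _ a1; have up2 := up _ a2.
have D1 : ((th + u) * h r = th * h r + u * h r)%R by rewrite mulrDl.
have D2 : ((th - u) * h r = th * h r - u * h r)%R by rewrite mulrBl.
have := @tilting_bound _ _ _ P _ (th * h r)%R (u * h r)%R _ _ _ _ _ _ mS
  (mulr_ge0 (ltW u0) (ltW hr)) C1 C2 lo.
rewrite -D1 -D2 => /(_ _ _ up1 up2 C3 C4) H.
apply: (le_trans _ (le_trans H _)); first by rewrite lee_fin ler_expR.
apply: le_measure; rewrite ?inE; [exact: measurable_set_oo..|].
move=> x /= /andP[h1 h2]; apply/andP; split.
  by apply: le_lt_trans h1; rewrite ler_wpM2l// lerD2l ler_wpM2l ?(ltW hr)// lerD2l lerN2.
by apply: (lt_le_trans h2); rewrite ler_wpM2l// lerD2l ler_wpM2l ?(ltW hr)// lerD2l.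
Unshelve. all: by end_near.
Qed.

(** No jump at this scale: the weights of the first generation carry the whole deviation, which
    explains why the rate does not depend on the height. *)
Lemma moderate_local n th x e : (0 < e)%R -> (th ^+ 2 * ((m2 - 1) / 2) < x)%R ->
  eventually_iid P W (fun r V => (expR (- (r%:R * h r ^+ 2 * x)))%:E <=
    P [set u | (`|(h r)^-1 * (mass V n.+1 u - 1) - th * (m2 - 1)| < e)%R]).
Proof.
move=> e0 xth; pose del := ((x - th ^+ 2 * ((m2 - 1) / 2)) / 2)%R.
have d0 : (0 < del)%R by rewrite divr_gt0// subr_gt0.
have e40 : (0 < e / 4)%R by rewrite divr_gt0.
have [k [k0 HZ]] := moderate_near_one n e40.
have HS := moderate_root_sum th e40 d0.
have k20 : (0 < k / 2)%R by rewrite divr_gt0.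
near=> r; have r0 : (0 < r)%N by near: r; exact: nbhs_infty_gt.
have r0' : (0 < r%:R :> R)%R by rewrite ltr0n.
have hr : (0 < h r)%R by near: r.
split => // V iidV.
have [_ /= hz] : holds_at HZ r by near: r; exact: HZ.
have [_ /= hs] : holds_at HS r by near: r; exact: HS.
have x2 : (x = th ^+ 2 * ((m2 - 1) / 2) + del + del)%R by rewrite /del; field.
have hsmall : (`|(`|th * (m2 - 1)| + e / 4) * h r| <= 1)%R by near: r; apply: scale_near.
have Hexp : (2 * r%:R <= expR (k * (r%:R * h r ^+ 2)))%R.
  by near: r; apply: h_exp.
have Hexp2 : (r%:R <= expR (k / 2 * (r%:R * h r ^+ 2)))%R.
  by rewrite -[leLHS]mul1r; near: r; apply: h_exp.
have Nk : (2 / del < r%:R * h r ^+ 2)%R by near: r; exact: speed_gt.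
rewrite ltr_pdivrMr// in Nk.
have Nk2 : (0 < r%:R * h r ^+ 2)%R by rewrite mulr_gt0// exprn_gt0.
pose y := expR (- (r%:R * h r ^+ 2 * k)).
have yr : (r%:R * y <= 1 / 2)%R.
  rewrite /y expRN ler_pdivrMr ?expR_gt0//.
  move: Hexp; rewrite (mulrC k); lra.
have y0 : (0 <= y)%R by exact: expR_ge0.
have y12 : (y <= 2^-1)%R.
  have : (1 * y <= r%:R * y)%R by rewrite ler_wpM2r// ler1n.
  by lra.
pose G : set R := `[(1 - h r * (e / 4))%R, (1 + h r * (e / 4))%R]%classic.
pose C1 := [set z : R | (r%:R * (1 + h r * (th * (m2 - 1) - e / 4)) < z <
  r%:R * (1 + h r * (th * (m2 - 1) + e / 4)))%R].
have mG : measurable G by exact: measurable_itv.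
have mC1 : measurable C1.
  rewrite (_ : C1 = `](r%:R * (1 + h r * (th * (m2 - 1) - e / 4)))%R,
    (r%:R * (1 + h r * (th * (m2 - 1) + e / 4)))%R[%classic) //.
have PE := sum_good iidV n (enum_uniq 'I_r) mG mC1.
have mV j : measurable_fun setT (V [:: j]) by case: iidV.
have mZ j := measurable_mass n (iid_shift j iidV).
apply: (@le_trans _ _ (P ((fun u => \sum_(j <- enum 'I_r) V [:: j] u)%R @^-1` C1 `&`
  [set u | forall j, j \in enum 'I_r -> G (mass (shift V j) n u)]))).
  rewrite PE x2 mulrDr opprD expRD EFinM; apply: lee_pmul; rewrite ?lee_fin ?expR_ge0//.
    exact: hs.
  apply: le_trans (prod_lower (r := r) y0 y12 _ _); last 2 first.
  - by rewrite size_enum_ord.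
  - by move=> j; exact: (hz _ (iid_shift j iidV)).
  rewrite lee_fin ler_expR lerN2; apply: le_trans (ltW Nk); apply: ler_piMr => //.
  by apply: (le_trans yr); rewrite ler_pdivrMr// mul1r ler1n.
have mm := measurable_mass n.+1 iidV.
apply: le_measure; rewrite ?inE.
- apply: measurableI.
    by apply: measurable_preimage_fun => //; exact: measurable_sum.
  rewrite (_ : [set u | _] = \bigcap_(j in [set: 'I_r]) (mass (shift V j) n @^-1` G)).
    apply: fin_bigcap_measurable; first exact: finite_finset.
    by move=> j _; apply: measurable_preimage_fun (mZ j) _.
  apply/seteqP; split => u /= H j; first by move=> _; apply: H; rewrite mem_enum.
  by move=> _; exact: H.
- by apply: measurable_ball_set; apply: measurable_funM => //; exact: measurable_funB.
move=> u /= [/andP[h1 h2] hG].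
have V0 j : (0 <= V [:: j] u)%R by case: iidV.
rewrite massS; set S := (\sum_(j <- enum 'I_r) V [:: j] u)%R in h1 h2.
have -> : (\sum_(i < r) V [:: i] u * mass (shift V i) n u =
   \sum_(j <- enum 'I_r) V [:: j] u * mass (shift V j) n u)%R by rewrite big_enum.
set Y := (\sum_(j <- enum 'I_r) V [:: j] u * mass (shift V j) n u)%R.
have Gj j : (1 - h r * (e / 4) <= mass (shift V j) n u <= 1 + h r * (e / 4))%R.
  by have := hG j (mem_enum _ _); rewrite /G /= in_itv.
have y1' : ((1 - h r * (e / 4)) * S <= Y)%R.
  rewrite /S /Y mulr_sumr; apply: ler_sum => j _; have /andP[hh _] := Gj j.
  by rewrite mulrC ler_wpM2l.
have y2' : (Y <= (1 + h r * (e / 4)) * S)%R.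
  rewrite /S /Y mulr_sumr; apply: ler_sum => j _; have /andP[_ hh] := Gj j.
  by rewrite (mulrC (1 + h r * (e / 4))%R) ler_wpM2l.
have S0 : (0 <= S)%R by apply: sumr_ge0.
move: S Y h1 h2 y1' y2' S0 => S Y h1 h2 y1' y2' S0.
exact: (moderate_deviation r0' hr e0 hsmall h1 h2 y1' y2' S0).
Unshelve. all: by end_near.
Qed.

End moderate.

(** * The Gaussian rate and the moderate deviation principle *)

Section moderate_deviations.
Context (R : realType) d (T : measurableType d) (P : probability T R).
Context (W : T -> R) (c : \bar R).
Hypothesis HW : cascade_weight P W c.
Local Notation var := (moment P W 2 0 - 1)%R.

Definition gaussian_rate (q a : R) : \bar R :=
  if q == 0%R then (if a == 0%R then 0 else +oo) else (a ^+ 2 / (2 * q))%:E.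

(** Dual form of the rate, with optimal parameter [a / q]. For [q = 0] the supremum is infinite and
    a large [th] is taken instead. *)
Lemma gaussian_rate_above (q a x : R) : (0 <= q)%R -> (0 < a)%R -> x%:E < gaussian_rate q a ->
  exists th : R, (0 < th)%R /\ (x < th * a - th ^+ 2 * (q / 2))%R.
Proof.
move=> q0 a0; rewrite /gaussian_rate; have [->|qn0] := eqVneq q 0%R.
  rewrite gt_eqF// => _; exists (Num.max 1 (x / a + 1))%R; split.
    by rewrite lt_max ltr01.
  rewrite mul0r mulr0 subr0 -ltr_pdivrMr// lt_max; apply/orP; right; lra.
have {q0 qn0} q0 : (0 < q)%R by rewrite lt_neqAle eq_sym qn0.
rewrite lte_fin => H; exists (a / q)%R; split; first by rewrite divr_gt0.
apply: (lt_le_trans H); rewrite le_eqVlt; apply/orP; left; apply/eqP.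
by field; rewrite gt_eqF.
Qed.

Lemma gaussian_rate_local (q a x : R) : (0 <= q)%R -> gaussian_rate q a < x%:E ->
  exists th : R, a = (th * q)%R /\ (th ^+ 2 * (q / 2) < x)%R.
Proof.
move=> q0; rewrite /gaussian_rate; have [->|qn0] := eqVneq q 0%R.
  case: eqP => // -> ; rewrite lte_fin => x0; exists 0%R.
  by rewrite !mulr0 mul0r mulr0.
rewrite lte_fin => H; exists (a / q)%R; split; first by rewrite divfK.
by apply: le_lt_trans H; rewrite le_eqVlt; apply/orP; left; apply/eqP; field.
Qed.

Lemma gaussian_rateN (q a : R) : gaussian_rate q (- a) = gaussian_rate q a.
Proof. by rewrite /gaussian_rate oppr_eq0 sqrrN. Qed.

Lemma gaussian_rate_nondecreasing (q a b : R) : (0 <= q)%R -> (0 <= a)%R -> (a <= b)%R ->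
  gaussian_rate q a <= gaussian_rate q b.
Proof.
move=> q0 a0 ab; rewrite /gaussian_rate; case: eqP => [_|/eqP qn0].
  case: (eqVneq b 0%R) => [b0|_]; last by rewrite leey.
  have -> : a = 0%R by apply/le_anti; rewrite a0 -b0 ab.
  by rewrite eqxx.
have {q0 qn0} q0 : (0 < q)%R by rewrite lt_neqAle eq_sym qn0.
rewrite lee_fin ler_wpM2r ?invr_ge0 ?mulr_ge0 ?(ltW q0)//.
by rewrite lerXn2r// nnegrE (le_trans a0).
Qed.

Lemma gaussian_rate_lsc (q a x : R) : (0 <= q)%R -> (0 < a)%R -> x%:E < gaussian_rate q a ->
  exists b, [/\ (0 <= b)%R, (b < a)%R & x%:E < gaussian_rate q b].
Proof.
move=> q0 a0 H; have [th [th0 xth]] := gaussian_rate_above q0 a0 H.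
pose u := ((x + th ^+ 2 * (q / 2)) / th)%R.
have ua : (u < a)%R by rewrite ltr_pdivrMr// -ltrBrDr (mulrC a).
have m0 : (0 <= Num.max 0 u)%R by rewrite le_max lexx.
have mu : (u <= Num.max 0 u)%R by rewrite le_max lexx orbT.
have ma : (Num.max 0 u < a)%R by rewrite gt_max a0 ua.
exists ((Num.max 0 u + a) / 2)%R; split; [lra|lra|].
have ub : (u < (Num.max 0 u + a) / 2)%R by lra.
move: ((_ + a) / 2)%R ub => b; rewrite ltr_pdivrMr// => ub.
apply: (@lt_le_trans _ _ (th * b - th ^+ 2 * (q / 2))%:E); first by rewrite lte_fin ltrBrDr (mulrC th).
rewrite /gaussian_rate; case: eqP => [q00|/eqP qn0].
  case: eqP => [b0|_]; last by rewrite leey.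
  by rewrite q00 b0 mulr0 mul0r mulr0 subr0.
have {q0 qn0} q0 : (0 < q)%R by rewrite lt_neqAle eq_sym qn0.
rewrite lee_fin ler_pdivlMr ?mulr_gt0// -subr_ge0.
rewrite (_ : _ - _ = (b - th * q) ^+ 2)%R ?sqr_ge0//; by field.
Qed.

Lemma moderate_deviations (V : forall r : nat, seq 'I_r -> T -> R) n (alpha : R) :
  (forall r, (2 <= r)%N -> iid_family P W (@V r)) -> (0 < alpha)%R -> (alpha < 2^-1)%R ->
  large_deviation_principle P (fun r x => r%:R `^ alpha * (mass (@V r) n.+1 x - 1))%R
    (fun r => r%:R `^ (1 - 2 * alpha))%R (gaussian_rate var).
Proof.
move=> iidV al0 al1.
have q0 : (0 <= var)%R by rewrite subr_ge0 (second_moment_ge1 HW).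
pose h r : R := (r%:R `^ (- alpha))%R.
pose p := (1 - 2 * alpha)%R.
have p0 : (0 < p)%R by rewrite /p; lra.
have vE r : (0 < r)%N -> (r%:R `^ p = r%:R * h r ^+ 2)%R.
  move=> r0; rewrite /h -powR_mulrn ?powR_ge0// -powRrM -[X in (X * _)%R]powRr1//.
  rewrite -powRD; last by rewrite pnatr_eq0 -lt0n r0 implybT.
  by congr powR; rewrite /p; ring.
have h0 r : (0 < r)%N -> (0 < h r)%R by move=> r0; rewrite powR_gt0// ltr0n.
have YE r : (0 < r)%N -> (r%:R `^ alpha = (h r)^-1)%R.
  by move=> r0; rewrite /h powRN invrK.
have r_gt0 : \forall r \near \oo, (0 < r)%N by exact: nbhs_infty_gt.
have powy (b : R) : (0 < b)%R -> forall A, \forall r \near \oo, (A < r%:R `^ b)%R.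
  move=> b0 A; near=> r.
  have A1 : (0 < Num.max A 1)%R by rewrite lt_max ltr01 orbT.
  have : (Num.max A 1 `^ b^-1 < r%:R)%R by near: r; exact: near_natr_gt.
  move=> /(gt0_ltr_powR b0); rewrite -powRrM mulVf ?gt_eqF// powRr1 ?(ltW A1)//.
  rewrite !nnegrE powR_ge0 ler0n => /(_ isT isT); apply: le_lt_trans.
  by rewrite le_max lexx.
have h_gt0 : \forall r \near \oo, (0 < h r)%R by apply: filterS r_gt0 => r; exact: h0.
have h_lt e : (0 < e)%R -> \forall r \near \oo, (h r < e)%R.
  move=> e0; near=> r; have r0 : (0 < r)%N by near: r.
  have : (e^-1 < r%:R `^ alpha)%R by near: r; exact: powy.
  by rewrite YE// ltf_pV2 ?posrE ?h0.
have h_exp A e : (0 <= A)%R -> (0 < e)%R ->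
    \forall r \near \oo, (A * r%:R <= expR (e * (r%:R * h r ^+ 2)))%R.
  (* Raise [g r^p <= exp (g r^p)] to the power [2 / p]: the right side becomes [exp (e r^p)] and the
     left one a multiple of [r ^+ 2], which beats [A * r]. *)
  move=> A0 e0; pose g := (e * p / 2)%R.
  have g0 : (0 < g)%R by rewrite divr_gt0// mulr_gt0.
  near=> r; have r0 : (0 < r)%N by near: r.
  have r0' : (0 < r%:R :> R)%R by rewrite ltr0n.
  rewrite -vE//.
  have gp : (0 < g `^ (2 / p))%R by rewrite powR_gt0.
  have rA : (A / g `^ (2 / p) < r%:R)%R by near: r; exact: near_natr_gt.
  rewrite ltr_pdivrMr// in rA.
  apply: (@le_trans _ _ ((g * r%:R `^ p) `^ (2 / p)))%R.
    rewrite powRM ?powR_ge0 ?(ltW g0)// -powRrM (_ : p * (2 / p) = 2%:R)%R; last first.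
      by field; rewrite gt_eqF.
    by rewrite powR_mulrn// expr2 mulrA ler_wpM2r// mulrC ltW.
  have grp : (0 <= g * r%:R `^ p)%R by rewrite mulr_ge0 ?powR_ge0 ?(ltW g0).
  rewrite (_ : expR _ = expR (g * r%:R `^ p) `^ (2 / p))%R.
    rewrite ge0_ler_powR ?nnegrE ?expR_ge0//; first by rewrite divr_ge0 ?(ltW p0).
    by apply: le_trans (expR_ge1Dx _); rewrite lerDr.
  have -> : (e * r%:R `^ p = 2 / p * (g * r%:R `^ p))%R.
    by rewrite /g; move: (r%:R `^ p)%R => z; field; rewrite gt_eqF.
  by move: (g * _)%R => z; rewrite /powR gt_eqF ?expR_gt0// expRK.
have Hspeed := speed_gt h_exp.
apply: (@ldp_of_tails _ _ _ _ _ _ _ 0%R).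
- move=> r r2; apply: measurable_funM => //; apply: measurable_funB => //.
  exact: (measurable_mass n.+1 (iidV r r2)).
- by apply/cvgryPgt => A; exact: powy.
- move=> a; rewrite /gaussian_rate; case: ifP => _; first by case: ifP => // _; rewrite leey.
  by rewrite lee_fin divr_ge0 ?sqr_ge0// mulr_ge0.
- by rewrite /gaussian_rate eqxx expr0n mul0r; case: ifP.
- by move=> a b a0 ab; exact: gaussian_rate_nondecreasing.
- move=> a b ab b0; rewrite -(gaussian_rateN _ a) -(gaussian_rateN _ b).
  by apply: gaussian_rate_nondecreasing; rewrite ?lerN2// oppr_ge0.
- by move=> a x; exact: gaussian_rate_lsc.
- move=> a x a0; rewrite -(gaussian_rateN _ a) => H.
  have a0' : (0 < - a)%R by rewrite oppr_gt0.
  have [b [b0 ba xb]] := gaussian_rate_lsc q0 a0' H.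
  exists (- b)%R; rewrite gaussian_rateN; split => //; lra.
- move=> a x a0 H; have [th [th0 xth]] := gaussian_rate_above q0 a0 H.
  have := eventually_family iidV (moderate_upper HW h_gt0 h_lt h_exp n th0 xth).
  apply: filterS2 r_gt0 => r r0; rewrite vE// YE//; apply: le_trans.
  rewrite (_ : [set u | _] = [set u | (1 + h r * a <= mass (@V r) n.+1 u)%R])//.
  have E u : (a <= (h r)^-1 * (mass (@V r) n.+1 u - 1))%R = (1 + h r * a <= mass (@V r) n.+1 u)%R.
    by rewrite ler_pdivlMl ?h0// lerBrDl.
  by apply/seteqP; split => u /=; rewrite E.
- move=> a x a0; rewrite -gaussian_rateN => H.
  have a0' : (0 < - a)%R by rewrite oppr_gt0.
  have [th [th0 xth]] := gaussian_rate_above q0 a0' H.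
  have := eventually_family iidV (moderate_lower HW h_gt0 h_lt n th0 xth).
  apply: filterS2 r_gt0 => r r0; rewrite vE// YE//; apply: le_trans.
  rewrite (_ : [set u | _] = [set u | (mass (@V r) n.+1 u <= 1 - h r * - a)%R])//.
  have E u : ((h r)^-1 * (mass (@V r) n.+1 u - 1) <= a)%R = (mass (@V r) n.+1 u <= 1 - h r * - a)%R.
    by rewrite ler_pdivrMl ?h0// mulrN opprK lerBlDl.
  by apply/seteqP; split => u /=; rewrite E.
- move=> a x e e0 H; have [th [-> xth]] := gaussian_rate_local q0 H.
  have := eventually_family iidV (moderate_local HW h_gt0 h_lt h_exp n e0 xth).
  by apply: filterS2 r_gt0 => r r0; rewrite vE// YE.
Unshelve. all: by end_near.
Qed.

End moderate_deviations.

(** * Almost sure modifications of a large deviation principle *)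

Section transfer.
Context (R : realType) d (T : measurableType d) (P : probability T R).

Lemma limn_esup_near_eq (u v : nat -> \bar R) : (\forall r \near \oo, u r = v r) ->
  limn_esup u = limn_esup v.
Proof.
have half (f g : nat -> \bar R) : (\forall r \near \oo, f r = g r) -> limn_esup f <= limn_esup g.
  move=> fg; apply: le_ereal_inf_tmp => _ [A nA <-].
  apply: (@le_trans _ _ (ereal_sup (f @` (A `&` [set r | f r = g r])))).
    by apply: ereal_inf_lbound; exists (A `&` [set r | f r = g r]) => //; exact: filterI.
  apply: ge_ereal_sup => _ [r [Ar fgr] <-]; rewrite fgr.
  by apply: ereal_sup_ubound; exists r.
move=> uv; apply/eqP; rewrite eq_le !half//.
by apply: filterS uv => r ->.
Qed.

Lemma limn_einf_near_eq (u v : nat -> \bar R) : (\forall r \near \oo, u r = v r) ->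
  limn_einf u = limn_einf v.
Proof.
move=> uv; rewrite /limn_einf; congr (- _); apply: limn_esup_near_eq.
by apply: filterS uv => r /= ->.
Qed.

Lemma ldp_ae_eq (Y Y' : nat -> T -> R) v I :
  (forall r, (2 <= r)%N -> measurable_fun setT (Y' r)) ->
  (forall r, (2 <= r)%N -> {ae P, forall x, Y r x = Y' r x}) ->
  large_deviation_principle P Y v I -> large_deviation_principle P Y' v I.
Proof.
move=> mY' YY' [mY vy I0 closedY openY].
have E (A : set R) : measurable A ->
    \forall r \near \oo, ((v r)^-1)%:E * lne (P (Y r @^-1` A)) = ((v r)^-1)%:E * lne (P (Y' r @^-1` A)).
  move=> mA; near=> r; have r2 : (2 <= r)%N by near: r; exact: nbhs_infty_ge.
  congr (_ * lne _); rewrite -!expectation_indic_comp//; [|exact: mY'|exact: mY].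
  apply: ae_eq_integral => //.
  - by apply/measurable_EFinP; apply: measurableT_comp (mY r r2); exact: measurable_indic.
  - by apply/measurable_EFinP; apply: measurableT_comp (mY' r r2); exact: measurable_indic.
  - by apply: filterS (YY' r r2) => x /= -> _.
split => //.
  move=> F cF; rewrite -(limn_esup_near_eq (E F _)); last exact: closed_measurable.
  exact: closedY.
move=> G oG; rewrite -(limn_einf_near_eq (E G _)); last exact: open_measurable.
exact: openY.
Unshelve. all: by end_near.
Qed.

Definition pospart (X : T -> R) (x : T) : R := Num.max (X x) 0%R.

Lemma measurable_pospart (X : T -> R) : measurable_fun setT X -> measurable_fun setT (pospart X).
Proof. by move=> mX; apply: measurable_maxr. Qed.

Lemma pospart_ge0 (X : T -> R) x : (0 <= pospart X x)%R.
Proof. by rewrite le_max lexx orbT. Qed.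

Lemma pospart_id (X : T -> R) x : (0 <= X x)%R -> pospart X x = X x.
Proof. by move=> X0; rewrite /pospart (max_idPl X0). Qed.

Lemma measurable_max0_preimage (A : set R) : measurable A ->
  measurable ((fun y : R => Num.max y 0%R) @^-1` A).
Proof.
move=> mA; rewrite -[X in measurable X]setTI.
have mm : measurable_fun setT (fun y : R => Num.max y 0%R) by exact: measurable_maxr.
exact: mm.
Qed.

End transfer.

(** * Reduction to a weight that is nonnegative everywhere *)

Section nonnegative_version.
Context (R : realType) (d : measure_display) (T : measurableType d) (P : probability T R).
Context (W : {RV P >-> R}) (c : \bar R).
Hypothesis W_ge0 : {ae P, forall x, (0 <= W x)%R}.
Hypothesis W_mean : 'E_P[W] = 1.
Hypothesis c_gt0 : 0 < c.
Hypothesis W_tail : (w^-1)%:E * lne (P [set x | (w <= W x)%R]) @[w --> +oo%R] --> - c.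

Local Notation Wp := (pospart W).

Let mW : measurable_fun setT W.
Proof. exact: measurable_funP. Qed.

Lemma ae_eq_pospart (f : R -> R) : measurable_fun setT f ->
  \int[P]_x (f (W x))%:E = \int[P]_x (f (Wp x))%:E.
Proof.
move=> mf; apply: ae_eq_integral => //.
- by apply/measurable_EFinP; apply: measurableT_comp.
- by apply/measurable_EFinP; apply: measurableT_comp => //; exact: measurable_pospart.
- by apply: filterS W_ge0 => x /= W0 _; rewrite pospart_id.
Qed.

Lemma cascade_weight_pospart : cascade_weight P Wp c.
Proof.
split => //.
- exact: measurable_pospart.
- by move=> x; exact: pospart_ge0.
- by rewrite -(ae_eq_pospart (@measurable_id _ R setT)); move: W_mean; rewrite unlock.
apply: cvg_trans W_tail; apply: near_eq_cvg.
near=> w; have w0 : (0 < w)%R by near: w; apply: nbhs_pinfty_gt; exact: num_real.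
congr (_ * lne (P _)); apply/seteqP; split => x /=; rewrite /pospart le_max.
  by move=> ->.
by move=> /orP[//|]; rewrite leNgt w0.
Unshelve. all: by end_near.
Qed.

Lemma log_laplace_pospart : log_laplace P W = log_laplace P Wp.
Proof.
apply/funext => t; rewrite /log_laplace /mmt_gen_fun unlock; congr lne.
rewrite (ae_eq_pospart (f := fun y => expR (y * t))); first exact: eq_integral.
by apply: measurableT_comp => //; exact: measurable_funM.
Qed.

Lemma variance_pospart : 'V_P[W] = (moment P Wp 2 0 - 1)%:E.
Proof.
have HW := cascade_weight_pospart.
rewrite /variance unlock W_mean /= expectation.unlock.
transitivity (\int[P]_x ((W x - 1) ^+ 2)%:E); first by apply: eq_integral => x _; rewrite expr2.
rewrite (ae_eq_pospart (f := fun y => (y - 1) ^+ 2)%R); last first.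
  by apply: measurable_funX; exact: measurable_funB.
have c0 : (0%R : R)%:E < c by [].
have [_] := @quadratic_moment _ _ _ _ _ _ HW 1 (-2) 1 0 0 0 0 c0 c0.
rewrite (moment00 P Wp) (moment10 HW) => H.
transitivity (\int[P]_x ((1 + -2 * Wp x + 1 * Wp x ^+ 2) * expR (0 * Wp x) + 0 * (Wp x ^+ 0 * expR (0 * Wp x)))%:E).
  by apply: eq_integral => x _; rewrite !mul0r expR0 addr0; congr _%:E; ring.
by rewrite H; congr _%:E; ring.
Qed.

Lemma moderate_rateE : moderate_rate P W = gaussian_rate (moment P Wp 2 0 - 1).
Proof.
by apply/funext => a; rewrite /moderate_rate /gaussian_rate variance_pospart eqe.
Qed.

Section family.
Variables (r : nat) (V : seq 'I_r -> {RV P >-> R}).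
Hypothesis V_iid : iid_copies W V.

Local Notation Vp := (fun w => pospart (V w)).

Lemma iid_family_pospart : iid_family P Wp Vp.
Proof.
have [indep law] := V_iid; split.
- by move=> w; apply: measurable_pospart; exact: measurable_funP.
- by move=> w x; exact: pospart_ge0.
- move=> s A us s0 mA; apply: (indep s (fun j => (fun y => Num.max y 0%R) @^-1` A j)) => //.
  by move=> j; exact: measurable_max0_preimage.
- move=> w w0 A mA; exact: (law w w0 _ (measurable_max0_preimage mA)).
Qed.

Lemma ae_family_ge0 : {ae P, forall x, forall w, w != [::] -> (0 <= V w x)%R}.
Proof.
have [_ law] := V_iid.
have one w : w != [::] -> {ae P, forall x, (0 <= V w x)%R}.
  move=> w0; have mA : measurable (`]-oo, 0%R[%classic : set R) by exact: measurable_itv.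
  have neg (X : {RV P >-> R}) : ~` [set x | (0 <= X x)%R] = X @^-1` `]-oo, 0%R[.
    by apply/seteqP; split => x /=; rewrite in_itv/= ltNge => /negP.
  have mX (X : {RV P >-> R}) : measurable (X @^-1` `]-oo, 0%R[).
    by rewrite -[X in measurable X]setTI; exact: measurable_funP.
  have : P.-negligible (~` [set x | (0 <= W x)%R]) := W_ge0.
  rewrite neg => /(negligibleP P (mX W)) H.
  suff : P.-negligible (~` [set x | (0 <= V w x)%R]) by [].
  rewrite neg; apply/(negligibleP P (mX _)).
  by rewrite -[LHS]/(distribution P (V w) _) (law w w0).
(* Words are countably many: [pickle] numbers them, and a number that codes no word imposes
   nothing. *)
have H := @ae_foralln _ _ _ P (fun k x => forall w : seq 'I_r, pickle w = k ->
  w != [::] -> (0 <= V w x)%R).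
apply: filterS (H _) => [x Hx w|k]; first exact: Hx.
have [[w wk]|nk] := pselect (exists w : seq 'I_r, pickle w = k); last first.
  by apply: aeW => x w wk; case: nk; exists w.
have [w0|w0] := eqVneq w [::].
  apply: aeW => x w'; rewrite -wk => /(pcan_inj (@pickleK _)) ->.
  by rewrite w0.
by apply: filterS (one w w0) => x Hx w'; rewrite -wk => /(pcan_inj (@pickleK _)) ->.
Qed.

Lemma cascade_mass_pospart n : {ae P, forall x, mass Vp n x = cascade_mass V n x}.
Proof.
apply: filterS ae_family_ge0 => x Hx; rewrite /mass /cascade_mass.
congr (_ * _)%R; apply: eq_bigr => t _; apply: eq_bigr => k _.
rewrite pospart_id//; apply: Hx.
by rewrite -size_eq0 size_take size_tuple; case: ifP => // _; rewrite -lt0n (leq_ltn_trans _ (ltn_ord k)).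
Qed.

Lemma measurable_cascade_mass n : measurable_fun setT (cascade_mass V n).
Proof.
apply: measurable_funM => //; apply: measurable_sum => t.
by apply: measurable_prod => k _; exact: measurable_funP.
Qed.

End family.
End nonnegative_version.

Theorem theorem3 (R : realType) (d : measure_display) (T : measurableType d)
  (P : probability T R) (W : {RV P >-> R}) (c : \bar R)
  (V : forall r : nat, seq 'I_r -> {RV P >-> R})
  (W_ge0 : {ae P, forall x, (0 <= W x)%R})
  (W_mean : 'E_P[W] = 1)
  (c_gt0 : 0 < c)
  (W_tail : (w^-1)%:E * lne (P [set x | (w <= W x)%R]) @[w --> +oo%R] --> - c)
  (V_iid : forall r : nat, (2 <= r)%N -> iid_copies W (@V r)) :
  [/\ forall (alpha : R) (n : nat),
        (0 < alpha)%R -> (alpha < 2^-1)%R -> (1 <= n)%N ->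
        large_deviation_principle P
          (fun r x => r%:R `^ alpha * (cascade_mass (@V r) n x - 1))%R
          (fun r => r%:R `^ (1 - 2 * alpha))%R
          (moderate_rate P W),
      forall n : nat, (1 <= n)%N ->
        large_deviation_principle P
          (fun r => cascade_mass (@V r) n)
          (fun r => r%:R)
          (large_rate c (legendre (log_laplace P W)) n) &
      forall (alpha : R) (n : nat), (0 < alpha)%R -> (1 <= n)%N ->
        large_deviation_principle P
          (fun r x => r%:R `^ (- alpha) * cascade_mass (@V r) n x)%R
          (fun r => r%:R `^ (1 + alpha / n%:R))%R
          (very_large_rate c n)].
Proof.
have HW := cascade_weight_pospart W_ge0 W_mean c_gt0 W_tail.
have HV r (r2 : (2 <= r)%N) := iid_family_pospart (V_iid r r2).
have HZ n r (r2 : (2 <= r)%N) := cascade_mass_pospart W_ge0 (V_iid r r2) n.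
have mZ n r := measurable_cascade_mass (@V r) n.
split=> [alpha [//|n] a0 a1 _|[//|n] _|alpha [//|n] a0 _].
- rewrite (moderate_rateE W_ge0 W_mean c_gt0 W_tail).
  apply: ldp_ae_eq (moderate_deviations HW (V := fun r w => pospart (@V r w)) n HV a0 a1).
    by move=> r _; apply: measurable_funM => //; exact: measurable_funB.
  by move=> r r2; apply: filterS (HZ n.+1 r r2) => x /= ->.
- rewrite (log_laplace_pospart W_ge0) (large_rateE HW).
  apply: ldp_ae_eq (large_deviations HW (V := fun r w => pospart (@V r w)) n HV).
    by move=> r _; exact: mZ.
  by move=> r r2; exact: HZ.
apply: ldp_ae_eq (very_large_deviations HW (V := fun r w => pospart (@V r w)) n HV a0).
  by move=> r _; exact: measurable_funM.
by move=> r r2; apply: filterS (HZ n.+1 r r2) => x /= ->.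
Qed.
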